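(* Let $U$ be a normal ultrafilter on a measurable cardinal $\delta$. (i) If $\kappa>\delta$ is the minimal cardinal with $\mathcal{P}(\kappa)\nsubseteq\mathrm{Ult}(V,U)$, then there is an unbounded subset of $\kappa$ that is fresh over $\mathrm{Ult}(V,U)$. (ii) If $\lambda$ is a limit ordinal with $\mathrm{cof}(\lambda)^{\mathrm{Ult}(V,U)}=j_U(\delta^+)$, then there is an unbounded subset of $\lambda$ that is fresh over $\mathrm{Ult}(V,U)$. (iii) If $2^\delta=\delta^+$ holds and $\lambda$ is a limit ordinal with $\mathrm{cof}(\lambda)=\delta^+$, then there is an unbounded subset of $\lambda$ that is fresh over $\mathrm{Ult}(V,U)$.
   Context: We work in ZFC; $V$ is the universe of sets. For a normal ultrafilter $U$ on a measurable cardinal $\delta$, $\mathrm{Ult}(V,U)$ denotes the transitive collapse of the ultrapower of $V$ by $U$, and $j_U:V\to\mathrm{Ult}(V,U)$ is the corresponding elementary embedding. $\mathrm{cof}(\lambda)^{\mathrm{Ult}(V,U)}$ is the cofinality of $\lambda$ computed in $\mathrm{Ult}(V,U)$. Given a class $M$, a set $A$ of ordinals is fresh over $M$ if $A\notin M$ and $A\cap\alpha\in M$ for all $\alpha<\mathrm{lub}(A)$, where $\mathrm{lub}(A)$ is the least upper bound of $A$ (so $\mathrm{lub}(A)=\lambda$ if $A$ is an unbounded subset of a limit ordinal $\lambda$). *)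

(* Defs.v *)
(* Working in ZFC is rendered as working in an arbitrary model [V] of
   first-order ZFC; separation and replacement range over formulas of the
   language of set theory with parameters.  Classes are predicates on [V]. *)

Set Implicit Arguments.
Unset Strict Implicit.
Unset Printing Implicit Defensive.

Record set_structure : Type := SetStructure {
  carrier :> Type;
  mem : carrier -> carrier -> Prop
}.
Arguments mem {s} _ _.

Declare Scope set_structure_scope.
Notation "x ∈ y" := (mem x y) (at level 70, no associativity)
  : set_structure_scope.
Open Scope set_structure_scope.

(* First-order formulas, with de Bruijn indices for variables. *)

Inductive formula : Type :=
| FMem (i j : nat)
| FEq (i j : nat)
| FNot (p : formula)
| FAnd (p q : formula)
| FAll (p : formula).

Definition scons {V : Type} (x : V) (e : nat -> V) (n : nat) : V :=
  match n with O => x | S m => e m end.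

Fixpoint sat {V : set_structure} (e : nat -> V) (p : formula) : Prop :=
  match p with
  | FMem i j => e i ∈ e j
  | FEq i j => e i = e j
  | FNot q => ~ sat e q
  | FAnd q r => sat e q /\ sat e r
  | FAll q => forall x : V, sat (scons x e) q
  end.

(* A binary relation on [V] that is a class: definable with parameters. *)
Definition class_relation {V : set_structure} (R : V -> V -> Prop) : Prop :=
  exists (p : formula) (e : nat -> V),
    forall x y, R x y <-> sat (scons x (scons y e)) p.

Definition subset {V : set_structure} (x y : V) : Prop :=
  forall z, z ∈ x -> z ∈ y.

Notation "x ⊆ y" := (subset x y) (at level 70, no associativity)
  : set_structure_scope.

Definition is_empty {V : set_structure} (x : V) : Prop := forall z, ~ z ∈ x.

Definition nonempty {V : set_structure} (x : V) : Prop := exists z, z ∈ x.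

Definition is_upair {V : set_structure} (p x y : V) : Prop :=
  forall z, z ∈ p <-> z = x \/ z = y.

Definition is_successor {V : set_structure} (s x : V) : Prop :=
  forall z, z ∈ s <-> z ∈ x \/ z = x.

Definition is_powerset {V : set_structure} (p x : V) : Prop :=
  forall z, z ∈ p <-> z ⊆ x.

Definition is_inter {V : set_structure} (b x y : V) : Prop :=
  forall z, z ∈ b <-> z ∈ x /\ z ∈ y.

Record ZFC (V : set_structure) : Prop := {
  zfc_extensionality :
    forall x y : V, (forall z, z ∈ x <-> z ∈ y) -> x = y;
  zfc_foundation :
    forall x : V, nonempty x -> exists y, y ∈ x /\ forall z, z ∈ x -> ~ z ∈ y;
  zfc_pairing :
    forall x y : V, exists p, is_upair p x y;
  zfc_union :
    forall x : V, exists u, forall z, z ∈ u <-> exists y, y ∈ x /\ z ∈ y;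
  zfc_powerset :
    forall x : V, exists p, is_powerset p x;
  zfc_infinity :
    exists w : V, (exists x, is_empty x /\ x ∈ w) /\
      forall x, x ∈ w -> exists s, is_successor s x /\ s ∈ w;
  zfc_separation :
    forall (p : formula) (e : nat -> V) (a : V),
      exists b, forall x, x ∈ b <-> x ∈ a /\ sat (scons x e) p;
  zfc_replacement :
    forall (p : formula) (e : nat -> V) (a : V),
      (forall x y z, x ∈ a -> sat (scons x (scons y e)) p ->
         sat (scons x (scons z e)) p -> y = z) ->
      exists b, forall y,
        y ∈ b <-> exists x, x ∈ a /\ sat (scons x (scons y e)) p;
  zfc_choice :
    forall a : V,
      (forall x, x ∈ a -> nonempty x) ->
      (forall x y z, x ∈ a -> y ∈ a -> z ∈ x -> z ∈ y -> x = y) ->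
      exists c, forall x, x ∈ a -> exists! y, y ∈ x /\ y ∈ c
}.

(* Functions are sets of Kuratowski pairs; [maps f x y] reads f(x) = y. *)

Definition is_pair {V : set_structure} (p x y : V) : Prop :=
  forall z, z ∈ p <-> is_upair z x x \/ is_upair z x y.

Definition maps {V : set_structure} (f x y : V) : Prop :=
  exists p, is_pair p x y /\ p ∈ f.

Definition function_on {V : set_structure} (f a : V) : Prop :=
  (forall p, p ∈ f -> exists x y, x ∈ a /\ is_pair p x y) /\
  (forall x, x ∈ a -> exists! y, maps f x y).

Definition function {V : set_structure} (f a b : V) : Prop :=
  function_on f a /\ forall x y, maps f x y -> y ∈ b.

Definition bijection {V : set_structure} (f a b : V) : Prop :=
  function f a b /\ forall y, y ∈ b -> exists! x, maps f x y.

Definition equinumerous {V : set_structure} (a b : V) : Prop :=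
  exists f, bijection f a b.

Definition constant_function {V : set_structure} (f a x : V) : Prop :=
  function_on f a /\ forall z y, maps f z y -> y = x.

Definition transitive_set {V : set_structure} (x : V) : Prop :=
  forall y, y ∈ x -> y ⊆ x.

Definition well_ordered_by_mem {V : set_structure} (a : V) : Prop :=
  (forall x, x ∈ a -> ~ x ∈ x) /\
  (forall x y z, x ∈ a -> y ∈ a -> z ∈ a -> x ∈ y -> y ∈ z -> x ∈ z) /\
  (forall x y, x ∈ a -> y ∈ a -> x ∈ y \/ x = y \/ y ∈ x) /\
  (forall s, s ⊆ a -> nonempty s -> exists m, m ∈ s /\ forall y, y ∈ s -> ~ y ∈ m).

Definition ordinal {V : set_structure} (a : V) : Prop :=
  transitive_set a /\ well_ordered_by_mem a.

Definition ord_le {V : set_structure} (a b : V) : Prop := a ∈ b \/ a = b.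

Definition limit_ordinal {V : set_structure} (a : V) : Prop :=
  ordinal a /\ nonempty a /\ forall x, x ∈ a -> exists y, y ∈ a /\ x ∈ y.

Definition is_omega {V : set_structure} (w : V) : Prop :=
  limit_ordinal w /\ forall n, n ∈ w -> ~ limit_ordinal n.

Definition cardinal {V : set_structure} (k : V) : Prop :=
  ordinal k /\ forall a, a ∈ k -> ~ equinumerous a k.

Definition uncountable_cardinal {V : set_structure} (k : V) : Prop :=
  cardinal k /\ exists w, is_omega w /\ w ∈ k.

Definition cardinal_successor {V : set_structure} (k kp : V) : Prop :=
  cardinal kp /\ k ∈ kp /\ forall m, cardinal m -> k ∈ m -> ord_le kp m.

(* 2^k = c *)
Definition two_power {V : set_structure} (k c : V) : Prop :=
  cardinal c /\ exists p, is_powerset p k /\ equinumerous p c.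

Definition unbounded_subset {V : set_structure} (A l : V) : Prop :=
  A ⊆ l /\ forall a, a ∈ l -> exists b, b ∈ A /\ ord_le a b.

Definition cofinal_map {V : set_structure} (f c l : V) : Prop :=
  function f c l /\
  forall a, a ∈ l -> exists x b, x ∈ c /\ maps f x b /\ ord_le a b.

(* cof(l) = c *)
Definition cofinality {V : set_structure} (l c : V) : Prop :=
  ordinal c /\ (exists f, cofinal_map f c l) /\
  forall d, d ∈ c -> ~ exists f, cofinal_map f d l.

(* [M] as a structure in its own right: a notion evaluated in
   [class_structure M] is the notion relativized to [M]. *)
Definition class_structure {V : set_structure} (M : V -> Prop) : set_structure :=
  {| carrier := {x : V | M x};
     mem := fun x y => proj1_sig x ∈ proj1_sig y |}.

(* cof(l)^M = c; in particular l and c belong to M *)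
Definition cofinality_in {V : set_structure} (M : V -> Prop) (l c : V) : Prop :=
  exists l' c' : class_structure M,
    proj1_sig l' = l /\ proj1_sig c' = c /\ cofinality l' c'.

Definition ultrafilter {V : set_structure} (d U : V) : Prop :=
  (forall X, X ∈ U -> X ⊆ d) /\
  d ∈ U /\
  (forall X, X ∈ U -> nonempty X) /\
  (forall X Y, X ∈ U -> X ⊆ Y -> Y ⊆ d -> Y ∈ U) /\
  (forall X Y Z, X ∈ U -> Y ∈ U -> is_inter Z X Y -> Z ∈ U) /\
  (forall X Y, X ⊆ d -> (forall z, z ∈ Y <-> z ∈ d /\ ~ z ∈ X) ->
     X ∈ U \/ Y ∈ U).

Definition nonprincipal {V : set_structure} (d U : V) : Prop :=
  forall x S, x ∈ d -> is_upair S x x -> ~ S ∈ U.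

(* closure under intersections of fewer than d many members *)
Definition complete {V : set_structure} (d U : V) : Prop :=
  forall c F X, c ∈ d -> function F c U ->
    (forall x, x ∈ X <->
       x ∈ d /\ forall a Y, a ∈ c -> maps F a Y -> x ∈ Y) ->
    X ∈ U.

Definition closed_under_diagonal_intersections {V : set_structure} (d U : V)
  : Prop :=
  forall F X, function F d U ->
    (forall x, x ∈ X <->
       x ∈ d /\ forall a Y, a ∈ x -> maps F a Y -> x ∈ Y) ->
    X ∈ U.

Definition measurable_cardinal {V : set_structure} (d : V) : Prop :=
  uncountable_cardinal d /\
  exists W, ultrafilter d W /\ nonprincipal d W /\ complete d W.

Definition normal_ultrafilter {V : set_structure} (d U : V) : Prop :=
  ultrafilter d U /\ nonprincipal d U /\ complete d U /\
  closed_under_diagonal_intersections d U.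

(* {x < d | r (f(x)) (g(x))} ∈ U *)
Definition ultra_rel {V : set_structure} (d U : V) (r : V -> V -> Prop)
  (f g : V) : Prop :=
  exists X, X ∈ U /\
    forall x, x ∈ X <->
      x ∈ d /\ exists y z, maps f x y /\ maps g x z /\ r y z.

(* [C f x] says that the transitive collapse of the ultrapower sends the class
   of the function f on d to x: [C] induces an isomorphism of the ultrapower
   with a transitive class.  Requiring [C] to be a class is essential: in a
   non-standard [V], uniqueness of the collapse only holds among classes. *)
Definition is_ultrapower_collapse {V : set_structure} (d U : V)
  (C : V -> V -> Prop) : Prop :=
  class_relation C /\
  (forall f x, C f x -> function_on f d) /\
  (forall f, function_on f d -> exists! x, C f x) /\
  (forall f g x y, C f x -> C g y -> (x = y <-> ultra_rel d U eq f g)) /\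
  (forall f g x y, C f x -> C g y -> (x ∈ y <-> ultra_rel d U mem f g)) /\
  (forall f x y, C f x -> y ∈ x -> exists g, C g y).

(* Ult(V,U), as a class of [V] *)
Definition Ult {V : set_structure} (d U : V) (x : V) : Prop :=
  exists C, is_ultrapower_collapse d U C /\ exists f, C f x.

(* j_U(x) = y *)
Definition ultrapower_embedding {V : set_structure} (d U : V) (x y : V) : Prop :=
  exists C, is_ultrapower_collapse d U C /\
    exists f, constant_function f d x /\ C f y.

Definition is_lub {V : set_structure} (A l : V) : Prop :=
  ordinal l /\ (forall a, a ∈ A -> ord_le a l) /\
  forall m, ordinal m -> (forall a, a ∈ A -> ord_le a m) -> ord_le l m.

Definition fresh_over {V : set_structure} (M : V -> Prop) (A : V) : Prop :=
  (forall a, a ∈ A -> ordinal a) /\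
  ~ M A /\
  exists l, is_lub A l /\
    forall a, a ∈ l -> exists B, is_inter B A a /\ M B.

Definition powerset_included {V : set_structure} (k : V) (M : V -> Prop) : Prop :=
  forall X, X ⊆ k -> M X.

(* Main.v *)
From Stdlib Require Import Classical ClassicalEpsilon FunctionalExtensionality PropExtensionality.
From Stdlib Require Import Setoid Arith.
From Corelib Require Import ssreflect.
Require Import Defs.

Set SsrOldRewriteGoalsOrder.

(** Write [M] for the ultrapower of [V] by the normal ultrafilter [U] on [d],
    and say that [d] covers a set if the set is a partial image of [d], that
    is, has at most [d] elements.  Two facts about [M] carry the whole
    argument.

    Closure: a subset [S] of [M] covered by [d] is an element of [M]
    ([small_subset_in]).  If [K i] represents the [i]-th element of [S], then
    the function sending [x] to the set of all [K i] at [x], for [i] below [x],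
    represents [S], because regressive functions are almost constant.  Two
    functions that represent the same set agree almost everywhere; hence every
    function representing [S] takes, for almost all [x], a value covered by [x]
    itself ([small_subset_ae]).

    Unbounded sets with small segments: if [A] is unbounded in the limit
    ordinal [l] and all its proper initial segments are covered by [d], then
    these segments are in [M], so [A] is fresh as soon as it is not in [M].  If
    [A] is in [M] and is represented by [G], then for almost all [x] the order
    type of [G x] is at most [d]: otherwise choose [h x] in [G x] with [d]
    elements of [G x] below it, and the initial segment of [A] below the
    ordinal represented by [h] contradicts [small_subset_ae]
    ([small_segments_order_type]).

    Now let [dp] be the successor cardinal of [d].  If [l] has cofinality [dp],
    then the range [A] of a weakly increasing cofinal map from [dp] to [l] has
    small segments.  So has every subset of [A], so that if no unbounded subset
    of [A] were fresh, then all subsets of [A] would be in [M].  They would all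
    be represented by choosing a subset of [G x] for each [x] in [d], and so,
    after a pairing of [d] with itself, by subsets of [d].  But [A] maps onto
    [dp], and under the cardinal arithmetic assumption [dp] maps onto the power
    set of [d]: thus [A] would map onto its own power set
    ([fresh_of_cofinality_successor]).

    If [l] has cofinality [j(dp)] in [M], where [l] is represented by [L], then
    by the theorem of Los almost all [L x] have cofinality [dp].  Weakly
    increasing cofinal maps [B x] from [dp] to [L x], evaluated at [i] in [dp],
    represent ordinals below [l] whose set [A] is again unbounded with small
    segments, by the regularity of [dp].  It is not in [M], since a set [G x]
    of order type at most [d] is bounded in [L x]
    ([fresh_of_internal_cofinality]).

    For a minimal cardinal [k] with a subset [X] outside [M] it is enough that
    all subsets of each ordinal [a] in [k] are in [M], because then all
    [inter X a] are.  Let [m] be the cardinality of [a].  If [m] is at most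
    [d], closure applies.  Otherwise the power set of [m] is included in [M] by
    minimality.  A map of [m] onto [a] pulls the order of [a] back to a
    well-founded relation on [m], which is coded by a subset of [m] through a
    pairing function in [M]; collapsing that relation inside [M] recovers the
    map ([powerset_below]).

    Separation and replacement concern formulas only.  Sets are therefore built
    by terms whose definability is checked by a tactic, and the theorem of Los
    is proved for all formulas. *)

(** * Parametrically definable predicates and terms *)

Section Definability.
Context {V : set_structure}.
Implicit Types (e : nat -> V) (P Q : (nat -> V) -> Prop) (t u : (nat -> V) -> V).

Definition tail e : nat -> V := fun n => e (S n).

(** Each variable of a formula is either read in the environment or bound to a
    parameter.  Parameters can thus be arbitrary elements that occur in a
    predicate, and never have to be listed. *)
Definition instantiate (s : nat -> nat + V) e : nat -> V :=
  fun n => match s n with inl i => e i | inr v => v end.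

Definition definable_prop P : Prop :=
  exists p s, forall e, P e <-> sat (instantiate s e) p.

Definition definable_term t : Prop := definable_prop (fun e => e 0 = t (tail e)).

(** [D1], [D2], [D3] are definability for classes, and [T1], [T2] for class
    functions. *)
Definition D1 (R : V -> Prop) := definable_prop (fun e => R (e 0)).
Definition D2 (R : V -> V -> Prop) := definable_prop (fun e => R (e 0) (e 1)).
Definition D3 (R : V -> V -> V -> Prop) := definable_prop (fun e => R (e 0) (e 1) (e 2)).
Definition T1 (f : V -> V) := definable_term (fun e => f (e 0)).
Definition T2 (f : V -> V -> V) := definable_term (fun e => f (e 0) (e 1)).

Fixpoint rename (r : nat -> nat) (p : formula) : formula :=
  match p with
  | FMem i j => FMem (r i) (r j)
  | FEq i j => FEq (r i) (r j)
  | FNot q => FNot (rename r q)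
  | FAnd q q' => FAnd (rename r q) (rename r q')
  | FAll q => FAll (rename (fun n => match n with 0 => 0 | S m => S (r m) end) q)
  end.

Lemma sat_ext p : forall e e', (forall n, e n = e' n) -> sat e p <-> sat e' p.
Proof.
  move=> e e' H. have -> : e = e' by apply: functional_extensionality.
  reflexivity.
Qed.

Lemma sat_rename p : forall r e, sat e (rename r p) <-> sat (fun n => e (r n)) p.
Proof.
  elim: p => [i j|i j|p IH|p IHp q IHq|p IH] r e /=; try reflexivity.
  - by rewrite IH.
  - by rewrite IHp IHq.
  - split=> H x; move: (H x); rewrite IH; apply sat_ext; by case.
Qed.

Lemma def_ext P Q : (forall e, P e <-> Q e) -> definable_prop P -> definable_prop Q.
Proof. move=> H [p [s Hp]]. exists p, s => e. by rewrite -H. Qed.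

Lemma def_mem_atom (a b : nat + V) :
  definable_prop (fun e => instantiate (fun _ => a) e 0 ∈ instantiate (fun _ => b) e 0).
Proof.
  exists (FMem 0 1), (fun n => match n with 0 => a | _ => b end) => e /=.
  reflexivity.
Qed.

Lemma def_eq_atom (a b : nat + V) :
  definable_prop (fun e => instantiate (fun _ => a) e 0 = instantiate (fun _ => b) e 0).
Proof.
  exists (FEq 0 1), (fun n => match n with 0 => a | _ => b end) => e /=.
  reflexivity.
Qed.

Lemma def_not P : definable_prop P -> definable_prop (fun e => ~ P e).
Proof. move=> [p [s H]]. exists (FNot p), s => e /=. by rewrite H. Qed.

Lemma def_and P Q : definable_prop P -> definable_prop Q -> definable_prop (fun e => P e /\ Q e).
Proof.
  move=> [p [s Hp]] [q [t Hq]].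
  (* the variables of the two formulas are kept apart by parity *)
  exists (FAnd (rename (fun n => 2 * n) p) (rename (fun n => 2 * n + 1) q)).
  exists (fun n => if Nat.even n then s (Nat.div2 n) else t (Nat.div2 n)) => e.
  rewrite /= !sat_rename Hp Hq.
  have E1 : forall n, instantiate s e n =
     instantiate (fun n => if Nat.even n then s (Nat.div2 n) else t (Nat.div2 n)) e (2 * n).
  { move=> n. by rewrite /instantiate Nat.even_even Nat.div2_double. }
  have E2 : forall n, instantiate t e n =
     instantiate (fun n => if Nat.even n then s (Nat.div2 n) else t (Nat.div2 n)) e (2 * n + 1).
  { move=> n. by rewrite /instantiate Nat.even_odd Nat.add_1_r Nat.div2_succ_double. }
  by rewrite (sat_ext p _ _ E1) (sat_ext q _ _ E2).
Qed.

Lemma def_all (F : V -> (nat -> V) -> Prop) :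
  definable_prop (fun e => F (e 0) (fun n => e (S n))) -> definable_prop (fun e => forall z, F z e).
Proof.
  move=> [p [s Hp]].
  exists (FAll (rename (fun n => match s n with inl 0 => 0 | _ => S n end) p)).
  exists (fun n => match s n with inl (S j) => inl j | inl 0 => inl 0 | inr v => inr v end).
  move=> e /=. split=> H z; move: (H z).
  - rewrite (Hp (scons z e)) sat_rename. apply sat_ext => n.
    rewrite /instantiate. case E: (s n) => [[|j]|v] //=; by rewrite E.
  - rewrite sat_rename => Hs. apply (Hp (scons z e)). move: Hs. apply sat_ext => n.
    rewrite /instantiate. case E: (s n) => [[|j]|v] //=; by rewrite E.
Qed.

Lemma def_const (A : Prop) : definable_prop (fun _ => A).
Proof.
  case: (classic A) => H.
  - by exists (FAll (FEq 0 0)), (fun _ => inl 0) => e /=; split.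
  - by exists (FNot (FAll (FEq 0 0))), (fun _ => inl 0) => e /=; split.
Qed.

Lemma def_or P Q : definable_prop P -> definable_prop Q -> definable_prop (fun e => P e \/ Q e).
Proof.
  move=> HP HQ. apply: (def_ext (fun e => ~ (~ P e /\ ~ Q e))); first by move=> e; tauto.
  by apply: def_not; apply: def_and; apply: def_not.
Qed.

Lemma def_imp P Q : definable_prop P -> definable_prop Q -> definable_prop (fun e => P e -> Q e).
Proof.
  move=> HP HQ. apply: (def_ext (fun e => ~ (P e /\ ~ Q e))); first by move=> e; tauto.
  by apply: def_not; apply: def_and => //; apply: def_not.
Qed.

Lemma def_iff P Q : definable_prop P -> definable_prop Q -> definable_prop (fun e => P e <-> Q e).
Proof. by move=> HP HQ; apply: def_and; apply: def_imp. Qed.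

Lemma def_ex (F : V -> (nat -> V) -> Prop) :
  definable_prop (fun e => F (e 0) (fun n => e (S n))) -> definable_prop (fun e => exists z, F z e).
Proof.
  move=> H. apply: (def_ext (fun e => ~ (forall z, ~ F z e))).
  - move=> e. split; first by move/not_all_ex_not => [z /NNPP]; exists z.
    move=> [z Hz] H'. by apply: H'; exact: Hz.
  - apply: def_not. apply: (def_all (fun z e => ~ F z e)). exact: def_not.
Qed.

Lemma def_rename P (r : nat -> nat) : definable_prop P -> definable_prop (fun e => P (fun n => e (r n))).
Proof.
  move=> [p [s H]].
  exists p, (fun n => match s n with inl i => inl (r i) | inr v => inr v end) => e.
  rewrite H. apply sat_ext => n. rewrite /instantiate. by case: (s n).
Qed.

Lemma dt_var n : definable_term (fun e => e n).
Proof. exact: (def_eq_atom (inl 0) (inl (S n))). Qed.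

Lemma dt_const c : definable_term (fun _ => c).
Proof. exact: (def_eq_atom (inl 0) (inr c)). Qed.

Lemma dt_rename t (r : nat -> nat) : definable_term t -> definable_term (fun e => t (fun n => e (r n))).
Proof.
  move=> H.
  exact: (def_rename _ (fun n => match n with 0 => 0 | S m => S (r m) end) H).
Qed.

(** Substituting a term amounts to quantifying over its unique value, which
    reduces formulas with terms to formulas with variables. *)
Lemma def_let (F : V -> (nat -> V) -> Prop) t :
  definable_term t -> definable_prop (fun e => F (e 0) (fun n => e (S n))) -> definable_prop (fun e => F (t e) e).
Proof.
  move=> Ht HF. apply: (def_ext (fun e => exists z, z = t e /\ F z e)).
  - move=> e. split; first by move=> [z [-> ?]]. by move=> ?; exists (t e).
  - apply: (def_ex (fun z e => z = t e /\ F z e)). by apply: def_and.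
Qed.

Lemma def_rel1 (R : V -> Prop) t : D1 R -> definable_term t -> definable_prop (fun e => R (t e)).
Proof.
  move=> HR Ht. apply: (def_let (fun z _ => R z)) => //.
Qed.

Lemma def_rel2 (R : V -> V -> Prop) t u :
  D2 R -> definable_term t -> definable_term u -> definable_prop (fun e => R (t e) (u e)).
Proof.
  move=> HR Ht Hu. apply: (def_let (fun z e => R z (u e))) => //.
  apply: (def_let (fun y e => R (e 0) y)); first exact: (dt_rename u S Hu).
  exact: (def_rename _ (fun n => match n with 0 => 1 | _ => 0 end) HR).
Qed.

Lemma def_rel3 (R : V -> V -> V -> Prop) t u v :
  D3 R -> definable_term t -> definable_term u -> definable_term v -> definable_prop (fun e => R (t e) (u e) (v e)).
Proof.
  move=> HR Ht Hu Hv. apply: (def_let (fun z e => R z (u e) (v e))) => //.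
  apply: (def_let (fun z e => R (e 0) z (v (fun n => e (S n)))));
    first exact: (dt_rename u S Hu).
  apply: (def_let (fun z e => R (e 1) (e 0) z));
    first exact: (dt_rename v (fun n => S (S n)) Hv).
  exact: (def_rename _ (fun n => match n with 0 => 2 | 1 => 1 | _ => 0 end) HR).
Qed.

Lemma dt_op1 (f : V -> V) t : T1 f -> definable_term t -> definable_term (fun e => f (t e)).
Proof.
  move=> Hf Ht. apply: (def_rel2 (fun z y => z = f y)); [exact: Hf|exact: dt_var|].
  exact: (dt_rename t S Ht).
Qed.

Lemma dt_op2 (f : V -> V -> V) t u : T2 f -> definable_term t -> definable_term u -> definable_term (fun e => f (t e) (u e)).
Proof.
  move=> Hf Ht Hu. apply: (def_rel3 (fun z x y => z = f x y)); [exact: Hf|exact: dt_var| |].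
  - exact: (dt_rename t S Ht).
  - exact: (dt_rename u S Hu).
Qed.

Lemma D2_mem : D2 (@mem V).
Proof. exact: (def_mem_atom (inl 0) (inl 1)). Qed.
Lemma D2_eq : D2 (@eq V).
Proof. exact: (def_eq_atom (inl 0) (inl 1)). Qed.

Lemma class_relation_D2 R : class_relation R -> D2 R.
Proof.
  move=> [p [c H]].
  exists p, (fun n => match n with 0 => inl 0 | 1 => inl 1 | S (S m) => inr (c m) end) => e.
  rewrite H. apply sat_ext. by case=> [|[|n]].
Qed.

Lemma D2_class_relation (c : V) R : D2 R -> class_relation R.
Proof.
  move=> [p [s H]].
  exists (rename (fun n => match s n with inl 0 => 0 | inl 1 => 1 | _ => S (S n) end) p).
  exists (fun n => match s n with inr v => v | _ => c end) => x y.
  rewrite (H (scons x (scons y (fun _ => c)))) sat_rename. apply sat_ext => n.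
  rewrite /instantiate. case E: (s n) => [[|[|j]]|v] //=; by rewrite E.
Qed.

End Definability.

Create HintDb definability.
#[export] Hint Resolve D2_mem D2_eq : definability.

Ltac definable_constant := solve [assumption | eauto 2 with definability nocore].
(** Extended below whenever a variable-binding term former is introduced. *)
Ltac unfold_binder := fail.

(** Relations and operations are tried with the largest number of arguments
    first, since a partial application would hide an argument that depends on
    the environment. *)
Ltac definable_step :=
  cbv beta;
  match goal with
  | |- definable_prop (fun _ => ?P) => exact (def_const P)
  | |- definable_prop (fun e => ~ (@?A e)) => apply (def_not A)
  | |- definable_prop (fun e => @?A e /\ @?B e) => apply (def_and A B)
  | |- definable_prop (fun e => @?A e \/ @?B e) => apply (def_or A B)
  | |- definable_prop (fun e => @?A e <-> @?B e) => apply (def_iff A B)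
  | |- definable_prop (fun e => @?A e -> @?B e) => apply (def_imp A B)
  | |- definable_prop (fun e => forall z, @?F e z) => apply (def_all (fun z e => F e z))
  | |- definable_prop (fun e => ex (@?F e)) => apply (def_ex (fun z e => F e z))
  | |- definable_prop (fun e => unique _ _) => unfold unique
  | |- definable_prop _ => unfold_binder
  | |- definable_prop (fun e => ?R (@?t e) (@?u e) (@?v e)) =>
      simple refine (def_rel3 R t u v _ _ _ _); [definable_constant| | |]
  | |- definable_prop (fun e => ?R (@?t e) (@?u e)) =>
      simple refine (def_rel2 R t u _ _ _); [definable_constant| |]
  | |- definable_prop (fun e => ?R (@?t e)) =>
      simple refine (def_rel1 R t _ _); [definable_constant|]
  | |- definable_term (fun _ => ?c) => exact (dt_const c)
  | |- definable_term (fun e => e ?n) => exact (dt_var n)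
  | |- definable_term _ => unfold_binder
  | |- definable_term (fun e => ?f (@?t e) (@?u e)) =>
      simple refine (dt_op2 f t u _ _ _); [definable_constant| |]
  | |- definable_term (fun e => ?f (@?t e)) =>
      simple refine (dt_op1 f t _ _); [definable_constant|]
  | |- D1 _ => unfold D1
  | |- D2 _ => unfold D2
  | |- D3 _ => unfold D3
  | |- T1 _ => unfold T1
  | |- T2 _ => unfold T2
  end.

Ltac definable := repeat definable_step.

Section Notions.
Context {V : set_structure}.
Lemma D2_subset : D2 (@subset V).
Proof. unfold subset. definable. Qed.
Lemma D3_upair : D3 (@is_upair V).
Proof. unfold is_upair; definable. Qed.
Hint Resolve D2_subset D3_upair : definability.
Lemma D1_empty : D1 (@is_empty V).
Proof. unfold is_empty; definable. Qed.
Lemma D1_nonempty : D1 (@nonempty V).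
Proof. unfold nonempty; definable. Qed.
Lemma D2_successor : D2 (@is_successor V).
Proof. unfold is_successor; definable. Qed.
Lemma D2_powerset : D2 (@is_powerset V).
Proof. unfold is_powerset; definable. Qed.
Lemma D3_inter : D3 (@is_inter V).
Proof. unfold is_inter; definable. Qed.
Lemma D3_pair : D3 (@is_pair V).
Proof. unfold is_pair; definable. Qed.
Hint Resolve D3_pair D1_empty D1_nonempty D2_successor D2_powerset D3_inter : definability.
Lemma D3_maps : D3 (@maps V).
Proof. unfold maps; definable. Qed.
Hint Resolve D3_maps : definability.
Lemma D2_function_on : D2 (@function_on V).
Proof. unfold function_on; definable. Qed.
Hint Resolve D2_function_on : definability.
Lemma D3_function : D3 (@function V).
Proof. unfold function; definable. Qed.
Hint Resolve D3_function : definability.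
Lemma D1_ordinal : D1 (@ordinal V).
Proof. unfold ordinal, transitive_set, well_ordered_by_mem; definable. Qed.
Lemma D2_ord_le : D2 (@ord_le V).
Proof. unfold ord_le; definable. Qed.
Hint Resolve D1_ordinal D2_ord_le : definability.
End Notions.
#[export] Hint Resolve D2_subset D3_upair D3_pair D1_empty D1_nonempty D2_successor D2_powerset
  D3_inter D3_maps D2_function_on D3_function D1_ordinal D2_ord_le : definability.

(** * Properties expressed by one formula in all structures *)

(** The theorem of Los compares the same formula in [V] and in the ultrapower;
    here the formula must not depend on the structure. *)
Section UniformDefinability.
Implicit Types P Q : forall W : set_structure, (nat -> W) -> Prop.

Definition uniformly_definable P : Prop := exists p, forall (W : set_structure) (e : nat -> W), P W e <-> sat e p.

Lemma udef_ext P Q : (forall W e, P W e <-> Q W e) -> uniformly_definable P -> uniformly_definable Q.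
Proof. move=> H [p Hp]. exists p => W e. by rewrite -H. Qed.

Lemma udef_mem i j : uniformly_definable (fun W e => e i ∈ e j).
Proof. by exists (FMem i j). Qed.

Lemma udef_eq i j : uniformly_definable (fun W e => e i = e j).
Proof. by exists (FEq i j). Qed.

Lemma udef_not P : uniformly_definable P -> uniformly_definable (fun W e => ~ P W e).
Proof. move=> [p Hp]. exists (FNot p) => W e /=. by rewrite Hp. Qed.

Lemma udef_and P Q : uniformly_definable P -> uniformly_definable Q -> uniformly_definable (fun W e => P W e /\ Q W e).
Proof. move=> [p Hp] [q Hq]. exists (FAnd p q) => W e /=. by rewrite Hp Hq. Qed.

Lemma udef_all (F : forall W : set_structure, W -> (nat -> W) -> Prop) :
  uniformly_definable (fun W e => F W (e 0) (fun n => e (S n))) -> uniformly_definable (fun W e => forall z, F W z e).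
Proof.
  move=> [p Hp]. exists (FAll p) => W e /=.
  split=> H z; [apply/(Hp W (scons z e))|apply: (proj2 (Hp W (scons z e)))]; exact: H.
Qed.

Lemma udef_or P Q : uniformly_definable P -> uniformly_definable Q -> uniformly_definable (fun W e => P W e \/ Q W e).
Proof.
  move=> HP HQ. apply: (udef_ext (fun W e => ~ (~ P W e /\ ~ Q W e))); first by move=> W e; tauto.
  by apply: udef_not; apply: udef_and; apply: udef_not.
Qed.

Lemma udef_imp P Q : uniformly_definable P -> uniformly_definable Q -> uniformly_definable (fun W e => P W e -> Q W e).
Proof.
  move=> HP HQ. apply: (udef_ext (fun W e => ~ (P W e /\ ~ Q W e))); first by move=> W e; tauto.
  by apply: udef_not; apply: udef_and => //; apply: udef_not.
Qed.

Lemma udef_iff P Q : uniformly_definable P -> uniformly_definable Q -> uniformly_definable (fun W e => P W e <-> Q W e).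
Proof. by move=> HP HQ; apply: udef_and; apply: udef_imp. Qed.

Lemma udef_ex (F : forall W : set_structure, W -> (nat -> W) -> Prop) :
  uniformly_definable (fun W e => F W (e 0) (fun n => e (S n))) -> uniformly_definable (fun W e => exists z, F W z e).
Proof.
  move=> H. apply: (udef_ext (fun W e => ~ (forall z, ~ F W z e))).
  - move=> W e. split; first by move/not_all_ex_not => [z /NNPP]; exists z.
    move=> [z Hz] H'. by apply: H'; exact: Hz.
  - apply: udef_not. apply: (udef_all (fun W z e => ~ F W z e)). exact: udef_not.
Qed.

End UniformDefinability.

Ltac udefinable :=
  repeat (cbv beta;
  match goal with
  | |- uniformly_definable (fun W e => ~ (@?A W e)) => apply (udef_not A)
  | |- uniformly_definable (fun W e => @?A W e /\ @?B W e) => apply (udef_and A B)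
  | |- uniformly_definable (fun W e => @?A W e \/ @?B W e) => apply (udef_or A B)
  | |- uniformly_definable (fun W e => @?A W e <-> @?B W e) => apply (udef_iff A B)
  | |- uniformly_definable (fun W e => @?A W e -> @?B W e) => apply (udef_imp A B)
  | |- uniformly_definable (fun W e => forall z, @?F W e z) => apply (udef_all (fun W z e => F W e z))
  | |- uniformly_definable (fun W e => ex (@?F W e)) => apply (udef_ex (fun W z e => F W e z))
  | |- uniformly_definable (fun W e => unique _ _) => unfold unique
  | |- uniformly_definable (fun W e => e ?i ∈ e ?j) => exact (udef_mem i j)
  | |- uniformly_definable (fun W e => e ?i = e ?j) => exact (udef_eq i j)
  end).

Lemma udef_cofinality : uniformly_definable (fun W e => cofinality (e 0) (e 1)).
Proof.
  unfold cofinality, ordinal, transitive_set, well_ordered_by_mem, cofinal_map, function, function_on,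
   ord_le, maps, is_pair, is_upair, subset, nonempty.
  udefinable.
Qed.

(** * Set theory with term notation *)

(** With the axioms bundled into the model, terms that depend on them need no
    argument beyond the elements they are applied to. *)
Record zfc_model : Type := ZFCModel {
  structure :> set_structure;
  model_zfc : ZFC structure
}.

Section Terms.
Context {V : zfc_model}.
Implicit Types (a b c f g h p q r s u v w x y z : V) (P Q : V -> Prop) (F G : V -> V).

Lemma set_ext (x y : V) : (forall z, z ∈ x <-> z ∈ y) -> x = y.
Proof. exact: (zfc_extensionality (model_zfc V)). Qed.

Lemma V_inhabited : inhabited V.
Proof. case: (zfc_infinity (model_zfc V)) => w _; by split. Qed.

(** Without the default value, the graph of a description would not be
    definable at the arguments where existence or uniqueness fails. *)
Definition the P : V :=
  epsilon V_inhabited (fun v => unique P v \/ (~ (exists w, unique P w) /\ is_empty v)).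

Definition setof P : V := the (fun b => forall x, x ∈ b <-> P x).

Definition is_set P : Prop := exists b, forall x, x ∈ b <-> P x.

(** Separation for definable predicates: the de Bruijn index of the element
    variable has to be moved to [0], and the parameters go to the others. *)
Lemma sep_is_set P (a : V) : D1 P -> (forall x, P x -> x ∈ a) -> is_set P.
Proof.
  move=> [p [s H]] Ha.
  case: V_inhabited => c.
  case: (zfc_separation (model_zfc V) (rename (fun n => match s n with inl 0 => 0 | _ => S n end) p)
     (fun n => match s n with inr v => v | _ => c end) a) => b Hb.
  exists b => x. rewrite Hb sat_rename.
  have E : sat (fun n => scons x (fun n => match s n with inr v => v | _ => c end)
                (match s n with inl 0 => 0 | _ => S n end)) p <-> P x.
  { rewrite (H (scons x (fun _ => c))). apply sat_ext => n.
    rewrite /instantiate. case E: (s n) => [[|j]|v] //=; by rewrite E. }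
  rewrite E. split; first tauto. by move=> ?; split=> //; apply: Ha.
Qed.

Lemma empty_exists : exists b : V, is_empty b.
Proof.
  case: V_inhabited => c.
  case: (@sep_is_set (fun _ => False) c) => //; first exact: def_const.
  by move=> b Hb; exists b => z; rewrite Hb.
Qed.

Lemma the_char P : unique P (the P) \/ (~ (exists w, unique P w) /\ is_empty (the P)).
Proof.
  rewrite /the. apply epsilon_spec.
  case: (classic (exists w, unique P w)).
  - move=> [w Hw]. by exists w; left.
  - move=> H. case: empty_exists => b Hb. by exists b; right.
Qed.

Lemma the_eq_iff P v :
  v = the P <-> (unique P v \/ (~ (exists w, unique P w) /\ is_empty v)).
Proof.
  split; first by move->; exact: the_char.
  move=> H. move: (the_char P) => H'.
  case: H => [[Hv Hu]|[Hn He]]; case: H' => [[Ht Hu']|[Hn' He']].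
  - exact: Hu.
  - by case: Hn'; exists v.
  - by case: Hn; exists (the P).
  - apply: set_ext => z. split=> Hz; [by case: (He z)|by case: (He' z)].
Qed.

Lemma the_spec P : (exists! v, P v) -> P (the P).
Proof.
  move=> H. case: (the_char P) => [[]//|[Hn _]]. by case: Hn.
Qed.

Lemma the_eq P v : P v -> (forall w, P w -> w = v) -> the P = v.
Proof.
  move=> H Hu. apply: (Hu). apply: the_spec. exists v; split=> // w Hw.
  by rewrite (Hu w Hw).
Qed.

Lemma setofE P x : is_set P -> (x ∈ setof P <-> P x).
Proof.
  move=> [b Hb].
  have -> : setof P = b.
  { apply: the_eq => // w Hw. apply: set_ext => z. by rewrite Hw Hb. }
  exact: Hb.
Qed.

Lemma setof_ext P Q : (forall x, P x <-> Q x) -> setof P = setof Q.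
Proof.
  move=> H. rewrite /setof. f_equal. apply: functional_extensionality => b.
  apply: propositional_extensionality.
  split=> H' x; by rewrite H' ?H -?H.
Qed.

Lemma dt_the (P : (nat -> V) -> V -> Prop) :
  definable_prop (fun e => P (fun n => e (S n)) (e 0)) -> definable_term (fun e => the (P e)).
Proof.
  move=> H. rewrite /definable_term.
  apply: (def_ext (fun e => unique (P (tail e)) (e 0) \/
     (~ (exists w, unique (P (tail e)) w) /\ is_empty (e 0)))).
  { move=> e. by rewrite the_eq_iff. }
  have H1 : definable_prop (fun e => P (fun n => e (S (S n))) (e 0)).
  { exact: (def_rename _ (fun n => match n with 0 => 0 | S m => S (S m) end) H). }
  have H2 : definable_prop (fun e => unique (P (tail e)) (e 0)).
  { apply: def_and => //. definable.
    - exact: H1. }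
  have H3 := def_rename _ (fun n => match n with 0 => 0 | S m => S (S m) end) H2.
  apply: def_or; first exact: H2. apply: def_and; last by definable.
  apply: def_not. apply: (def_ex (fun w e => unique (P (tail e)) w)). exact: H3.
Qed.

Lemma dt_setof (P : (nat -> V) -> V -> Prop) :
  definable_prop (fun e => P (fun n => e (S n)) (e 0)) -> definable_term (fun e => setof (P e)).
Proof.
  move=> H. apply: (dt_the (fun e b => forall x, x ∈ b <-> P e x)).
  apply: (def_all (fun x e => x ∈ e 0 <-> P (fun n => e (S n)) x)).
  apply: def_iff; first by definable.
  exact: (def_rename _ (fun n => match n with 0 => 0 | S m => S (S m) end) H).
Qed.

End Terms.

Ltac unfold_binder ::=
  match goal with
  | |- definable_term (fun e => the (@?P e)) => apply (dt_the P)
  | |- definable_term (fun e => setof (@?P e)) => apply (dt_setof P)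
  end.

Section BasicSets.
Context {V : zfc_model}.
Implicit Types (a b c f g h p q r s u v w x y z : V) (P Q : V -> Prop) (F G : V -> V).

Definition sep (a : V) P : V := setof (fun x => x ∈ a /\ P x).
Definition img (a : V) F : V := setof (fun y => exists x, x ∈ a /\ y = F x).
Definition upair (x y : V) : V := setof (fun z => z = x \/ z = y).
Definition pair (x y : V) : V := the (fun p => is_pair p x y).
Definition app (f x : V) : V := the (fun y => maps f x y).
Definition lam (a : V) F : V := img a (fun x => pair x (F x)).
Definition bigcup (x : V) : V := setof (fun z => exists y, y ∈ x /\ z ∈ y).
Definition union (x y : V) : V := bigcup (upair x y).
Definition power (x : V) : V := setof (fun z => z ⊆ x).
Definition empty : V := setof (fun _ => False).
Definition succ (x : V) : V := setof (fun z => z ∈ x \/ z = x).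
Definition inter (x y : V) : V := setof (fun z => z ∈ x /\ z ∈ y).
Definition cond (A : Prop) (x y : V) : V := the (fun z => (A /\ z = x) \/ (~ A /\ z = y)).

End BasicSets.

Ltac unfold_binder_more := fail.
Ltac unfold_binder ::=
  match goal with
  | |- definable_term (fun e => the (@?P e)) => apply (dt_the P)
  | |- definable_term (fun e => setof (@?P e)) => apply (dt_setof P)
  | |- definable_term (fun e => sep _ _) => unfold sep
  | |- definable_term (fun e => img _ _) => unfold img
  | |- definable_term (fun e => lam _ _) => unfold lam
  | |- definable_term (fun e => cond _ _ _) => unfold cond
  | |- _ => unfold_binder_more
  end.

Section BasicDef.
Context {V : zfc_model}.
Lemma T2_upair : T2 (@upair V). Proof. unfold upair; definable. Qed.
Lemma T2_pair : T2 (@pair V). Proof. unfold pair; definable. Qed.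
Lemma T2_app : T2 (@app V). Proof. unfold app; definable. Qed.
Lemma T1_bigcup : T1 (@bigcup V). Proof. unfold bigcup; definable. Qed.
Hint Resolve T2_upair T2_pair T2_app T1_bigcup : definability.
Lemma T2_union : T2 (@union V). Proof. unfold union; definable. Qed.
Lemma T1_power : T1 (@power V). Proof. unfold power; definable. Qed.
Lemma T1_succ : T1 (@succ V). Proof. unfold succ; definable. Qed.
Lemma T2_inter : T2 (@inter V). Proof. unfold inter; definable. Qed.
End BasicDef.
#[export] Hint Resolve T2_upair T2_pair T2_app T1_bigcup T2_union T1_power T1_succ T2_inter : definability.

Section BasicFacts.
Context {V : zfc_model}.
Implicit Types (a b c f g h p q r s u v w x y z : V) (P Q : V -> Prop) (F G : V -> V).

Lemma sepE a P x : D1 P -> (x ∈ sep a P <-> x ∈ a /\ P x).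
Proof.
  move=> HP. apply: setofE. apply: (sep_is_set _ a); last by move=> ? [].
  definable.
Qed.

Lemma replacement_is_set (a : V) (R : V -> V -> Prop) :
  D2 R -> (forall x y z, x ∈ a -> R x y -> R x z -> y = z) ->
  is_set (fun y => exists x, x ∈ a /\ R x y).
Proof.
  move=> HR Hf. case: (@V_inhabited V) => c.
  case: (D2_class_relation c _ HR) => p [e Hp].
  case: (@zfc_replacement _ (model_zfc V) p e a).
  - move=> x y z Hx. rewrite -!Hp. exact: Hf.
  - move=> b Hb. exists b => y. rewrite Hb.
    split=> [] [x [Hx H]]; exists x; by rewrite ?Hp // -?Hp.
Qed.

Lemma imgE a F y : T1 F -> (y ∈ img a F <-> exists x, x ∈ a /\ y = F x).
Proof.
  move=> HF. apply: setofE.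
  apply: (replacement_is_set a (fun x y => y = F x)); first by definable.
  by move=> x ? ? _ -> ->.
Qed.

Lemma img_mem a F x : T1 F -> x ∈ a -> F x ∈ img a F.
Proof. move=> HF Hx. rewrite imgE //. by exists x. Qed.

Lemma upairE x y z : z ∈ upair x y <-> z = x \/ z = y.
Proof.
  apply: setofE. case: (zfc_pairing (model_zfc V) x y) => p Hp. by exists p.
Qed.

Lemma is_upairE p x y : is_upair p x y <-> p = upair x y.
Proof.
  split.
  - move=> H. apply: set_ext => z. rewrite upairE. exact: H.
  - move=> -> z. exact: upairE.
Qed.

Lemma upair_inj x y x' y' : upair x y = upair x' y' -> (x = x' /\ y = y') \/ (x = y' /\ y = x').
Proof.
  move=> H.
  have H1 : forall z, (z = x \/ z = y) <-> (z = x' \/ z = y').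
  { move=> z. by rewrite -!upairE H. }
  have := proj1 (H1 x) (or_introl eq_refl). have := proj1 (H1 y) (or_intror eq_refl).
  have := proj2 (H1 x') (or_introl eq_refl). have := proj2 (H1 y') (or_intror eq_refl).
  intuition congruence.
Qed.

Lemma is_pairE p x y : is_pair p x y <-> p = pair x y.
Proof.
  have H0 : forall p, is_pair p x y <-> p = upair (upair x x) (upair x y).
  { move=> q. rewrite -is_upairE /is_pair /is_upair.
    split=> H z; rewrite H; by rewrite ?is_upairE -?is_upairE. }
  have -> : pair x y = upair (upair x x) (upair x y).
  { apply: the_eq; by [rewrite H0|move=> w; rewrite H0]. }
  exact: H0.
Qed.

Lemma pair_inj x y x' y' : pair x y = pair x' y' -> x = x' /\ y = y'.
Proof.
  have H0 : forall x y, pair x y = upair (upair x x) (upair x y).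
  { move=> u v. symmetry. rewrite -is_pairE => z. by rewrite upairE !is_upairE. }
  rewrite !H0 => /upair_inj [] [/upair_inj H1 /upair_inj H2]; intuition congruence.
Qed.

Lemma mapsE f x y : maps f x y <-> pair x y ∈ f.
Proof.
  split; first by move=> [p [/is_pairE -> ?]].
  move=> H. exists (pair x y); split=> //. by rewrite is_pairE.
Qed.

Lemma lam_maps a F x y : T1 F -> (maps (lam a F) x y <-> x ∈ a /\ y = F x).
Proof.
  move=> HF. rewrite mapsE /lam imgE; last by definable. split.
  - by move=> [x' [Hx' /pair_inj [-> ->]]].
  - move=> [Hx ->]. by exists x.
Qed.

Lemma lam_app a F x : T1 F -> x ∈ a -> app (lam a F) x = F x.
Proof.
  move=> HF Hx. apply: the_eq; first by rewrite lam_maps.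
  by move=> w; rewrite lam_maps // => [] [].
Qed.

Lemma lam_function_on a F : T1 F -> function_on (lam a F) a.
Proof.
  move=> HF. split.
  - move=> p. rewrite /lam imgE; last by definable.
    move=> [x [Hx ->]]. exists x, (F x). by rewrite is_pairE.
  - move=> x Hx. exists (F x). split; first by rewrite lam_maps.
    by move=> y; rewrite lam_maps // => [] [].
Qed.

Lemma lam_function a b F : T1 F -> (forall x, x ∈ a -> F x ∈ b) -> function (lam a F) a b.
Proof.
  move=> HF Hb. split; first exact: lam_function_on.
  move=> x y. rewrite lam_maps // => [] [Hx ->]. exact: Hb.
Qed.

Lemma function_on_maps f a x y : function_on f a -> x ∈ a -> (maps f x y <-> y = app f x).
Proof.
  move=> [_ H] Hx. case: (H x Hx) => v [Hv Hu].
  have -> : app f x = v by apply: the_eq => // w Hw; rewrite (Hu w).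
  split; [by move/Hu|by move->].
Qed.

Lemma function_on_dom f a x y : function_on f a -> maps f x y -> x ∈ a.
Proof.
  move=> [H _] [p [Hp Hpf]]. case: (H p Hpf) => x' [y' [Hx' Hp']].
  move: Hp Hp'. by rewrite !is_pairE => -> /pair_inj [-> _].
Qed.

Lemma function_on_ext f g a : function_on f a -> function_on g a ->
  (forall x, x ∈ a -> app f x = app g x) -> f = g.
Proof.
  have H : forall f g : V, function_on f a -> function_on g a ->
    (forall x, x ∈ a -> app f x = app g x) -> f ⊆ g.
  { move=> {}f {}g Hf Hg Hfg p Hp. case: (proj1 Hf p Hp) => x [y [Hx Hpxy]].
    have Hm : maps f x y by exists p.
    have : maps g x y by rewrite (function_on_maps g a) // -Hfg // -(function_on_maps f a).
    move: Hpxy. by rewrite is_pairE mapsE => ->. }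
  move=> Hf Hg Hfg. apply: set_ext => z. split; apply: H => // x Hx.
  by rewrite Hfg.
Qed.

Lemma function_eta f a : function_on f a -> f = lam a (fun x => app f x).
Proof.
  move=> Hf. apply: (function_on_ext f _ a) => //.
  - apply: lam_function_on. definable.
  - move=> x Hx. rewrite lam_app //. definable.
Qed.

Lemma function_app f a b x : function f a b -> x ∈ a -> app f x ∈ b.
Proof.
  move=> [Hf Hb] Hx. apply: (Hb x). by rewrite (function_on_maps f a).
Qed.

Lemma functionE f a b : function f a b <-> function_on f a /\ forall x, x ∈ a -> app f x ∈ b.
Proof.
  split.
  - move=> H. split; first by case: H. move=> x. exact: function_app.
  - move=> [H1 H2]. split=> // x y Hm.
    have Hx := function_on_dom _ _ _ _ H1 Hm.
    move: Hm. rewrite (function_on_maps f a) // => ->. exact: H2.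
Qed.

Lemma bigcupE x z : z ∈ bigcup x <-> exists y, y ∈ x /\ z ∈ y.
Proof. apply: setofE. case: (zfc_union (model_zfc V) x) => u Hu. by exists u. Qed.

Lemma unionE x y z : z ∈ union x y <-> z ∈ x \/ z ∈ y.
Proof.
  rewrite /union bigcupE. split.
  - move=> [w []]. rewrite upairE => [] [] ->; tauto.
  - move=> [] H; [exists x|exists y]; rewrite upairE; tauto.
Qed.

Lemma powerE x z : z ∈ power x <-> z ⊆ x.
Proof. apply: setofE. case: (zfc_powerset (model_zfc V) x) => u Hu. by exists u. Qed.

Lemma emptyE z : ~ z ∈ empty.
Proof.
  rewrite /empty setofE //. case: (@empty_exists V) => b Hb. exists b => x.
  by split => // /Hb.
Qed.

Lemma succE x z : z ∈ succ x <-> z ∈ x \/ z = x.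
Proof.
  apply: setofE. exists (union x (upair x x)) => y. rewrite unionE upairE. tauto.
Qed.

Lemma interE x y z : z ∈ inter x y <-> z ∈ x /\ z ∈ y.
Proof. apply: (sepE x (fun z => z ∈ y)). definable. Qed.

Lemma is_interE b x y : is_inter b x y <-> b = inter x y.
Proof.
  split.
  - move=> H. apply: set_ext => z. by rewrite interE H.
  - by move=> -> z; rewrite interE.
Qed.

Lemma cond_true (A : Prop) x y : A -> cond A x y = x.
Proof. move=> HA. apply: the_eq; first tauto. tauto. Qed.

Lemma cond_false (A : Prop) x y : ~ A -> cond A x y = y.
Proof. move=> HA. apply: the_eq; first tauto. tauto. Qed.

Lemma subset_antisym (x y : V) : x ⊆ y -> y ⊆ x -> x = y.
Proof. move=> H1 H2. apply: set_ext => z. split; [exact: H1|exact: H2]. Qed.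

Lemma foundation_set (a : V) P : D1 P -> (exists x, x ∈ a /\ P x) ->
  exists x, x ∈ a /\ P x /\ forall y, y ∈ a -> P y -> ~ y ∈ x.
Proof.
  move=> HP [x [Hx Px]].
  case: (@zfc_foundation _ (model_zfc V) (sep a P)).
  - exists x. by rewrite sepE.
  - move=> y []. rewrite sepE // => [] [Hy Py] H. exists y; split=> //; split=> // z Hz Pz Hzy.
    apply: (H z) => //. by rewrite sepE.
Qed.

Lemma mem_irrefl (x : V) : ~ x ∈ x.
Proof.
  move=> Hx. case: (@zfc_foundation _ (model_zfc V) (upair x x)).
  - exists x. rewrite upairE. tauto.
  - move=> y []. rewrite upairE => Hy H. have {}Hy : y = x by tauto. subst y.
    apply: (H x) => //. rewrite upairE. tauto.
Qed.

Lemma mem_asym (x y : V) : x ∈ y -> ~ y ∈ x.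
Proof.
  move=> Hx Hy. case: (@zfc_foundation _ (model_zfc V) (upair x y)).
  - exists x. rewrite upairE. tauto.
  - move=> z []. rewrite upairE => [] [] -> H.
    + apply: (H y) => //. rewrite upairE. tauto.
    + apply: (H x) => //. rewrite upairE. tauto.
Qed.

End BasicFacts.

(** * Ordinals *)

Section Ordinals.
Context {V : zfc_model}.
Implicit Types (a b c d f g h p q r s u v w x y z : V) (P Q : V -> Prop) (F G : V -> V).

Lemma no_3_cycle x y z : x ∈ y -> y ∈ z -> ~ z ∈ x.
Proof.
  move=> Hxy Hyz Hzx.
  case: (@foundation_set V (union (upair x y) (upair z z)) (fun _ => True)).
  - definable.
  - exists x. rewrite unionE upairE. tauto.
  - move=> m []. rewrite unionE !upairE => Hm [_ H].
    have {}H : forall k, k = x \/ k = y \/ k = z -> ~ k ∈ m.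
    { move=> k Hk. apply: H => //. rewrite unionE !upairE. tauto. }
    have Hx := H x. have Hy := H y. have Hz := H z.
    case: Hm => [[]|[]] E; subst m; tauto.
Qed.

Lemma ordinalI a : transitive_set a ->
  (forall x y, x ∈ a -> y ∈ a -> x ∈ y \/ x = y \/ y ∈ x) -> ordinal a.
Proof.
  move=> Ht Hl. split=> //. repeat split => //.
  - move=> x _. exact: mem_irrefl.
  - move=> x y z Hx Hy Hz Hxy Hyz. case: (Hl x z Hx Hz) => [//|[E|Hzx]].
    + subst z. by case: (mem_asym _ _ Hxy).
    + by case: (no_3_cycle _ _ _ Hxy Hyz).
  - move=> s Hs [x Hx]. case: (@foundation_set V s (fun _ => True)); first by definable.
    + by exists x.
    + move=> m [Hm [_ H]]. exists m; split=> // y Hy. exact: H.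
Qed.

Lemma ordinal_total a x y : ordinal a -> x ∈ a -> y ∈ a -> x ∈ y \/ x = y \/ y ∈ x.
Proof. move=> [_ [_ [_ [H _]]]]. exact: H. Qed.

Lemma ordinal_trans a y x : ordinal a -> y ∈ a -> x ∈ y -> x ∈ a.
Proof. move=> [H _] Hy Hx. exact: (H y Hy). Qed.

Lemma ordinal_elem a x : ordinal a -> x ∈ a -> ordinal x.
Proof.
  move=> Ha Hx. apply: ordinalI.
  - move=> y Hy z Hz. have Hya := ordinal_trans _ _ _ Ha Hx Hy.
    have Hza := ordinal_trans _ _ _ Ha Hya Hz.
    case: (ordinal_total _ _ _ Ha Hza Hx) => [//|[E|Hxz]].
    + subst z. by case: (mem_asym _ _ Hy).
    + by case: (no_3_cycle _ _ _ Hz Hy).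
  - move=> y z Hy Hz. apply: (ordinal_total a) => //; exact: (ordinal_trans _ x).
Qed.

(** If [c] is a proper subset, the least element of [a] outside [c] is [c]. *)
Lemma transitive_subset_ordinal a c : ordinal a -> transitive_set c -> c ⊆ a ->
  c = a \/ c ∈ a.
Proof.
  move=> Ha Hc Hs. case: (classic (c = a)) => [|Hne]; first by left. right.
  have [x [Hx Hxc]] : exists x, x ∈ a /\ ~ x ∈ c.
  { apply: NNPP => H. apply: Hne. apply: subset_antisym => // z Hz.
    apply: NNPP => Hn. apply: H. by exists z. }
  case: (@foundation_set V a (fun x => ~ x ∈ c)); first by definable.
  { by exists x. }
  move=> m [Hm [Hmc H]].
  have -> // : c = m.
  apply: subset_antisym => z Hz.
  - case: (ordinal_total _ _ _ Ha (Hs _ Hz) Hm) => [//|[E|Hmz]].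
    + by subst z.
    + case: Hmc. exact: (Hc z).
  - apply: NNPP => Hn. apply: (H z) => //. exact: (ordinal_trans _ m).
Qed.

Lemma ord_trich a b : ordinal a -> ordinal b -> a ∈ b \/ a = b \/ b ∈ a.
Proof.
  move=> Ha Hb.
  have Ht : transitive_set (inter a b).
  { move=> x. rewrite interE => [] [Hxa Hxb] y Hy. rewrite interE.
    split; [exact: (ordinal_trans _ x)|exact: (ordinal_trans _ x)]. }
  have H1 : inter a b ⊆ a by move=> z; rewrite interE => [] [].
  have H2 : inter a b ⊆ b by move=> z; rewrite interE => [] [].
  case: (transitive_subset_ordinal _ _ Ha Ht H1) => E1;
    case: (transitive_subset_ordinal _ _ Hb Ht H2) => E2.
  - right; left. by rewrite -E1 E2.
  - left. by rewrite -{1}E1.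
  - right; right. by rewrite -{1}E2.
  - have : inter a b ∈ inter a b by apply/interE.
    by move/mem_irrefl.
Qed.

Lemma ord_le_subset a b : ordinal b -> ord_le a b -> a ⊆ b.
Proof. move=> Hb [H|-> //] z Hz. exact: (ordinal_trans _ a). Qed.

Lemma subset_ord_le a b : ordinal a -> ordinal b -> a ⊆ b -> ord_le a b.
Proof.
  move=> Ha Hb H. case: (transitive_subset_ordinal _ _ Hb (proj1 Ha) H); [by right|by left].
Qed.

Lemma ord_lt_or_ge a b : ordinal a -> ordinal b -> a ∈ b \/ ord_le b a.
Proof.
  move=> Ha Hb. case: (ord_trich _ _ Ha Hb) => [|[->|]]; [by left|by right; right|by right; left].
Qed.

Lemma ord_le_trans a b c : ordinal c -> ord_le a b -> ord_le b c -> ord_le a c.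
Proof.
  move=> Hc [Hab|->] // [Hbc|<-]; last by left.
  left. exact: (ordinal_trans _ b).
Qed.

Lemma ord_le_not_gt a b : ordinal b -> ord_le a b -> ~ b ∈ a.
Proof.
  move=> Hb [H|->]; [exact: mem_asym|exact: mem_irrefl].
Qed.

Lemma ord_le_lt_trans a b c : ordinal c -> ord_le a b -> b ∈ c -> a ∈ c.
Proof. move=> Hc [H|-> //] Hb. exact: (ordinal_trans _ b). Qed.

Lemma ord_lt_le_trans a b c : ordinal c -> a ∈ b -> ord_le b c -> a ∈ c.
Proof. move=> Hc Hab [H|<- //]. exact: (ordinal_trans _ b). Qed.

Lemma ordinal_least P : D1 P -> (exists a, ordinal a /\ P a) ->
  exists a, ordinal a /\ P a /\ forall b, b ∈ a -> ~ P b.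
Proof.
  move=> HP [a [Ha Pa]].
  case: (classic (exists b, b ∈ a /\ P b)) => [H|Hn]; last first.
  { exists a; split=> //; split=> // b Hb Pb. apply: Hn. by exists b. }
  case: (foundation_set _ _ HP H) => m [Hm [Pm Hmin]].
  exists m. split; first exact: (ordinal_elem a). split=> // b Hb Pb.
  apply: (Hmin b) => //. exact: (ordinal_trans _ m).
Qed.

Lemma ordinal_ind P : D1 P ->
  (forall a, ordinal a -> (forall b, b ∈ a -> P b) -> P a) -> forall a, ordinal a -> P a.
Proof.
  move=> HP H a Ha. apply: NNPP => Hn.
  case: (@ordinal_least (fun a => ~ P a)); first by definable.
  - by exists a.
  - move=> m [Hm [Hnm Hmin]]. apply: Hnm. apply: H => // b Hb.
    apply: NNPP. exact: Hmin.
Qed.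

Lemma empty_ordinal : ordinal (empty : V).
Proof. apply: ordinalI => x; [by move/emptyE|by move=> ? /emptyE]. Qed.

Lemma succ_ordinal a : ordinal a -> ordinal (succ a).
Proof.
  move=> Ha. apply: ordinalI.
  - move=> x. rewrite succE => [] [Hx|->] y Hy; rewrite succE; left => //.
    exact: (ordinal_trans _ x).
  - move=> x y. rewrite !succE => [] [Hx|->] [Hy|->]; try tauto.
    exact: (ordinal_total a).
Qed.

Lemma succ_self a : a ∈ succ a.
Proof. rewrite succE. tauto. Qed.

Lemma succ_le a b : ordinal a -> ordinal b -> a ∈ b -> ord_le (succ a) b.
Proof.
  move=> Ha Hb H. apply: subset_ord_le => //; first exact: succ_ordinal.
  move=> z. rewrite succE => [] [Hz|-> //]. exact: (ordinal_trans _ a).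
Qed.

Lemma lt_succ_le a b : a ∈ succ b <-> ord_le a b.
Proof. by rewrite succE. Qed.

Lemma bigcup_ordinal s : (forall x, x ∈ s -> ordinal x) -> ordinal (bigcup s).
Proof.
  move=> Hs. apply: ordinalI.
  - move=> x. rewrite bigcupE => [] [y [Hy Hx]] z Hz. rewrite bigcupE.
    exists y; split=> //. apply: (ordinal_trans _ x) => //. exact: Hs.
  - move=> x y. rewrite !bigcupE => [] [x' [Hx' Hx]] [y' [Hy' Hy]].
    apply: ord_trich.
    + apply: (ordinal_elem x') => //; exact: Hs.
    + apply: (ordinal_elem y') => //; exact: Hs.
Qed.

Lemma bigcup_ub s x : (forall x, x ∈ s -> ordinal x) -> x ∈ s -> ord_le x (bigcup s).
Proof.
  move=> Hs Hx. apply: subset_ord_le; [exact: Hs|exact: bigcup_ordinal|].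
  move=> z Hz. rewrite bigcupE. by exists x.
Qed.

Lemma ordinals_bounded s : (forall x, x ∈ s -> ordinal x) ->
  exists b, ordinal b /\ forall x, x ∈ s -> x ∈ b.
Proof.
  move=> Hs. exists (succ (bigcup s)). split.
  - apply: succ_ordinal. exact: bigcup_ordinal.
  - move=> x Hx. rewrite lt_succ_le. exact: bigcup_ub.
Qed.

Lemma succ_bigcup a : ordinal a -> bigcup (succ a) = a.
Proof.
  move=> Ha. apply: subset_antisym => z.
  - rewrite bigcupE => [] [y []]. rewrite succE => [] [Hy|-> //] Hz.
    exact: (ordinal_trans _ y).
  - move=> Hz. rewrite bigcupE. exists a; split=> //. exact: succ_self.
Qed.

Definition least P : V := the (fun a => ordinal a /\ P a /\ forall b, b ∈ a -> ~ P b).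

Lemma least_spec P : D1 P -> (exists a, ordinal a /\ P a) ->
  ordinal (least P) /\ P (least P) /\ forall b, b ∈ least P -> ~ P b.
Proof.
  move=> HP He.
  apply: (the_spec (fun a => ordinal a /\ P a /\ forall b, b ∈ a -> ~ P b)).
  case: (ordinal_least _ HP He) => m [Hm [Pm Hmin]].
  exists m; split=> // m' [Hm' [Pm' Hmin']].
  case: (ord_trich _ _ Hm Hm') => [H|[//|H]]; [by case: (Hmin' _ H)|by case: (Hmin _ H)].
Qed.

Lemma least_le P b : D1 P -> ordinal b -> P b -> ord_le (least P) b.
Proof.
  move=> HP Hb Pb. have [H1 [H2 H3]] : _ := least_spec P HP (ex_intro _ b (conj Hb Pb)).
  case: (ord_lt_or_ge b (least P)) => // H. by case: (H3 _ H).
Qed.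

End Ordinals.

Ltac unfold_binder_more ::=
  match goal with
  | |- definable_term (fun e => least _) => unfold least
  end.

(** * Recursion on well-founded relations *)

Section Recursion.
Context {V : zfc_model}.
Implicit Types (a b c d f g h p q r s u v w x y z : V) (P Q : V -> Prop) (F G : V -> V).

Lemma lam_ext a F F' : T1 F -> T1 F' -> (forall x, x ∈ a -> F x = F' x) -> lam a F = lam a F'.
Proof.
  move=> HF HF' H. apply: (function_on_ext _ _ a); try exact: lam_function_on.
  move=> x Hx. by rewrite !lam_app // H.
Qed.

Definition well_founded_on (A : V) (R : V -> V -> Prop) : Prop :=
  forall s, s ⊆ A -> nonempty s -> exists m, m ∈ s /\ forall y, y ∈ s -> ~ R y m.

Lemma well_founded_min A R P : well_founded_on A R -> D1 P -> (exists x, x ∈ A /\ P x) ->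
  exists x, x ∈ A /\ P x /\ forall y, y ∈ A -> P y -> ~ R y x.
Proof.
  move=> HR HP [x [Hx Px]]. case: (HR (sep A P)).
  - move=> z. by rewrite sepE // => [] [].
  - exists x. by rewrite sepE.
  - move=> m []. rewrite sepE // => [] [Hm Pm] H. exists m; split=> //; split=> // y Hy Py.
    apply: H. by rewrite sepE.
Qed.

Lemma well_founded_induct A R P : well_founded_on A R -> D1 P ->
  (forall x, x ∈ A -> (forall y, y ∈ A -> R y x -> P y) -> P x) ->
  forall x, x ∈ A -> P x.
Proof.
  move=> HR HP H x Hx. apply: NNPP => Hn.
  case: (well_founded_min A R (fun x => ~ P x)) => //; first by definable.
  { by exists x. }
  move=> m [Hm [Hnm Hmin]]. apply: Hnm. apply: H => // y Hy Hr.
  apply: NNPP => Hny. exact: (Hmin y).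
Qed.

Lemma mem_well_founded A : well_founded_on A mem.
Proof.
  move=> s _ [x Hx]. case: (@foundation_set V s (fun _ => True)); first by definable.
  - by exists x.
  - move=> m [Hm [_ H]]. exists m; split=> // y Hy. exact: H.
Qed.

Section OneRecursion.
Variables (A : V) (R : V -> V -> Prop) (G : V -> V -> V).
Hypotheses (HR : D2 R) (HG : T2 G) (wf : well_founded_on A R).

Let pred x := sep A (fun y => R y x).
Let step f x := G x (lam (pred x) (app f)).

Let approx D f : Prop :=
  D ⊆ A /\ (forall x y, x ∈ D -> y ∈ A -> R y x -> y ∈ D) /\
  forall x, x ∈ D -> app f x = step f x.

Let T1_pred : T1 pred.
Proof. unfold pred. definable. Qed.

Let T2_step : T2 step.
Proof. unfold step. definable. Qed.

Let D2_approx : D2 approx.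
Proof. unfold approx. definable. Qed.

Let predE x y : y ∈ pred x <-> y ∈ A /\ R y x.
Proof. apply: sepE. definable. Qed.

Let step_ext f f' x : (forall y, y ∈ A -> R y x -> app f y = app f' y) -> step f x = step f' x.
Proof.
  move=> H. rewrite /step. f_equal. apply: lam_ext; try by definable.
  move=> y /predE [Hy Hr]. exact: H.
Qed.

Let approx_agree D f D' f' x : approx D f -> approx D' f' -> x ∈ D -> x ∈ D' ->
  app f x = app f' x.
Proof.
  move=> [HD [Hcl Hf]] [HD' [Hcl' Hf']] HxD HxD'.
  apply: (well_founded_induct A R (fun x => x ∈ D -> x ∈ D' -> app f x = app f' x)) => //;
    [by definable| |exact: HD].
  move=> {HxD HxD'} {}x Hx IH HxD HxD'. rewrite Hf // Hf' //. apply: step_ext => y Hy Hr.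
  apply: IH => //; [exact: (Hcl x)|exact: (Hcl' x)].
Qed.

(** The values of all partial solutions defined on [R]-closed sets fit
    together, and their union is defined everywhere: at a minimal missing point
    it could be extended. *)
Theorem wf_recursion :
  exists f, function_on f A /\
    forall x, x ∈ A -> app f x = G x (lam (sep A (fun y => R y x)) (app f)).
Proof.
  pose covered x := exists D f, approx D f /\ x ∈ D.
  pose (val := fun x => the (fun v => exists D f, approx D f /\ x ∈ D /\ v = app f x)).
  have Hcov : D1 covered by unfold covered; definable.
  have Hval : T1 val by unfold val; definable.
  have val_eq : forall D f x, approx D f -> x ∈ D -> val x = app f x.
  { move=> D f x Hf Hx. apply: the_eq; first by exists D, f.
    move=> w [D' [f' [Hf' [Hx' ->]]]]. exact: (approx_agree D' f' D f). }
  pose (f0 := lam A val). pose (D0 := sep A covered).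
  have f0_eq : forall D f x, approx D f -> x ∈ D -> app f0 x = app f x.
  { move=> D f x Hf Hx. rewrite lam_app //; first exact: (val_eq D).
    exact: (proj1 Hf). }
  have H0 : approx D0 f0.
  { split; first by move=> x; rewrite sepE // => [] [].
    split.
    - move=> x y. rewrite !sepE // => [] [Hx [D [f [Hf HxD]]]] Hy Hr. split=> //.
      exists D, f; split=> //. exact: (proj1 (proj2 Hf) x).
    - move=> x. rewrite sepE // => [] [Hx [D [f [Hf HxD]]]].
      rewrite (f0_eq D f) // (proj2 (proj2 Hf)) //. apply: step_ext => y Hy Hr.
      symmetry. apply: (f0_eq D) => //. exact: (proj1 (proj2 Hf) x). }
  have Hall : forall x, x ∈ A -> x ∈ D0.
  { apply: (well_founded_induct A R (fun x => x ∈ D0)) => //; first by definable.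
    move=> x Hx IH. apply: NNPP => Hn.
    pose (f1 := lam A (fun y => cond (y = x) (step f0 x) (app f0 y))).
    have Hf1 : T1 (fun y => cond (y = x) (step f0 x) (app f0 y)) by definable.
    have f1x : app f1 x = step f0 x by rewrite lam_app // cond_true.
    have f1y : forall y, y ∈ D0 -> app f1 y = app f0 y.
    { move=> y Hy. rewrite lam_app //; last exact: (proj1 H0).
      rewrite cond_false // => E. by subst y. }
    apply: Hn. rewrite sepE //. split=> //.
    exists (union D0 (upair x x)), f1. split; last by rewrite unionE upairE; tauto.
    split; [|split].
    - move=> z. rewrite unionE upairE => [] [Hz|[] -> //]. exact: (proj1 H0).
    - move=> z y. rewrite !unionE !upairE => Hz Hy Hr. left.
      case: Hz => [Hz|Hz]; first exact: (proj1 (proj2 H0) z).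
      apply: IH => //. by case: Hz => E; subst z.
    - move=> z. rewrite unionE upairE => [] [Hz|Hz].
      + rewrite (f1y z Hz) (proj2 (proj2 H0) z Hz). apply: step_ext => y Hy Hr.
        symmetry. apply: f1y. exact: (proj1 (proj2 H0) z).
      + have {Hz} -> : z = x by tauto. rewrite f1x. apply: step_ext => y Hy Hr.
        symmetry. apply: f1y. exact: IH. }
  exists f0. split; first exact: lam_function_on.
  move=> x Hx. apply: (proj2 (proj2 H0)). exact: Hall.
Qed.

End OneRecursion.
End Recursion.

(** * The natural numbers, the cumulative hierarchy, and choice *)

Section Hierarchy.
Context {V : zfc_model}.
Implicit Types (a b c d f g h m n p q r s u v w x y z : V) (P Q : V -> Prop) (F G : V -> V).

Lemma limit_ordinalI a : ordinal a -> a <> empty -> (forall b, a <> succ b) -> limit_ordinal a.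
Proof.
  move=> Ha He Hs. split=> //. split.
  - apply: NNPP => Hn. apply: He. apply: set_ext => z.
    split=> [Hz|/emptyE //]. case: Hn. by exists z.
  - move=> x Hx. exists (succ x). split; last exact: succ_self.
    move: (ordinal_elem _ _ Ha Hx) => Hxo.
    case: (succ_le _ _ Hxo Ha Hx) => // E. by case: (Hs x).
Qed.

Lemma no_set_of_ordinals s : ~ forall x, ordinal x -> x ∈ s.
Proof.
  move=> H. case: (@ordinals_bounded V (sep s ordinal)).
  - move=> x. rewrite sepE; [by case|definable].
  - move=> b [Hb Hs]. apply: (mem_irrefl b). apply: Hs.
    rewrite sepE; last by definable. split=> //. exact: H.
Qed.

Lemma D1_limit : D1 (@limit_ordinal V).
Proof. unfold limit_ordinal. definable. Qed.
Hint Resolve D1_limit : definability.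

(** The least ordinal outside an inductive set is a limit ordinal. *)
Lemma omega_exists : exists w : V, is_omega w.
Proof.
  case: (zfc_infinity (model_zfc V)) => w [[e [He Hew]] Hs].
  have [a [Ha [Haw Hmin]]] : exists a, ordinal a /\ ~ a ∈ w /\ forall b, b ∈ a -> ~ ~ b ∈ w.
  { apply: (ordinal_least (fun a => ~ a ∈ w)); first by definable.
    apply: NNPP => H. apply: (no_set_of_ordinals w) => x Hx.
    apply: NNPP => Hn. apply: H. by exists x. }
  have Hlim : limit_ordinal a.
  { apply: limit_ordinalI => //.
    - move=> E. apply: Haw. have -> // : a = e.
      apply: set_ext => z. split=> [|/He //]. by rewrite E => /emptyE.
    - move=> b E. have Hb : b ∈ w by apply: NNPP; apply: Hmin; rewrite E; exact: succ_self.
      case: (Hs b Hb) => s [Hsb Hsw]. apply: Haw. rewrite E.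
      have -> // : succ b = s. apply: set_ext => z. by rewrite succE Hsb. }
  case: (@ordinal_least V limit_ordinal); first by definable.
  { by exists a. }
  move=> m [_ [Hm Hm']]. by exists m.
Qed.

Lemma omega_ordinal w : is_omega w -> ordinal w.
Proof. by case => [] []. Qed.

Lemma omega_succ w n : is_omega w -> n ∈ w -> succ n ∈ w.
Proof.
  move=> Hw Hn. move: (omega_ordinal _ Hw) => Ho.
  case: Hw => [[_ [_ H]] _]. case: (H n Hn) => y [Hy Hny].
  apply: (ord_le_lt_trans _ y) => //. apply: succ_le => //; exact: (ordinal_elem w).
Qed.

Lemma omega_empty w : is_omega w -> empty ∈ w.
Proof.
  move=> Hw. move: (omega_ordinal _ Hw) => Ho. case: Hw => [[_ [[x Hx] _]] _].
  apply: (ord_le_lt_trans _ x) => //. apply: subset_ord_le.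
  - exact: empty_ordinal.
  - exact: (ordinal_elem w).
  - by move=> z /emptyE.
Qed.

Lemma omega_case w n : is_omega w -> n ∈ w -> n = empty \/ exists m, m ∈ w /\ n = succ m.
Proof.
  move=> Hw Hn. move: (omega_ordinal _ Hw) => Ho.
  apply: NNPP => H. case: Hw => [_ Hm]. apply: (Hm n) => //.
  apply: limit_ordinalI.
  - exact: (ordinal_elem w).
  - by move=> E; apply: H; left.
  - move=> b E. apply: H. right. exists b; split=> //. apply: (ordinal_trans _ n) => //.
    rewrite E. exact: succ_self.
Qed.

Lemma omega_ind w P : is_omega w -> D1 P -> P empty -> (forall n, n ∈ w -> P n -> P (succ n)) ->
  forall n, n ∈ w -> P n.
Proof.
  move=> Hw HP H0 HS n Hn. move: (omega_ordinal _ Hw) => Ho.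
  apply: (ordinal_ind (fun n => n ∈ w -> P n)) => //; first by definable.
  - move=> {Hn} {}n _ IH Hn. case: (omega_case _ _ Hw Hn) => [-> //|[m [Hm E]]].
    subst n. apply: HS => //. apply: IH => //. exact: succ_self.
  - exact: (ordinal_elem w).
Qed.

Lemma img_ext a F F' : (forall x, x ∈ a -> F x = F' x) -> img a F = img a F'.
Proof.
  move=> H. apply: setof_ext => y.
  split=> [] [x [Hx ->]]; exists x; by rewrite H.
Qed.

(** The union of the sets obtained from [x] by iterating unions along the
    natural numbers is transitive. *)
Lemma transitive_closure x : exists t, transitive_set t /\ x ⊆ t.
Proof.
  case: omega_exists => w Hw.
  case: (wf_recursion w mem (fun n h => union x (bigcup (img n (fun m => bigcup (app h m))))));
    try by definable.
  { exact: mem_well_founded. }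
  move=> f [_ Hf].
  have {}Hf : forall n, n ∈ w -> app f n = union x (bigcup (img n (fun m => bigcup (app f m)))).
  { move=> n Hn. rewrite (Hf n Hn). do 2 f_equal. apply: img_ext => m Hm.
    rewrite lam_app //; first by definable. rewrite sepE; last by definable.
    split=> //. apply: (ordinal_trans _ n) => //. exact: omega_ordinal. }
  exists (bigcup (img w (app f))). split.
  - move=> y. rewrite bigcupE => [] [v []]. rewrite imgE; last by definable.
    move=> [n [Hn ->]] Hy z Hz. rewrite bigcupE. exists (app f (succ n)). split.
    + apply: img_mem; first by definable. exact: omega_succ.
    + rewrite Hf; last exact: omega_succ. rewrite unionE. right.
      rewrite bigcupE. exists (bigcup (app f n)). split.
      * apply: (img_mem _ (fun m => bigcup (app f m))); first by definable. exact: succ_self.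
      * rewrite bigcupE. by exists y.
  - move=> y Hy. rewrite bigcupE. exists (app f empty). split.
    + apply: img_mem; first by definable. exact: omega_empty.
    + rewrite Hf ?unionE; [by left|exact: omega_empty].
Qed.

(** Foundation concerns sets only; for a class it is applied inside a
    transitive set that contains a counterexample. *)
Theorem mem_induction P : D1 P -> (forall x, (forall y, y ∈ x -> P y) -> P x) -> forall x, P x.
Proof.
  move=> HP H x. case: (transitive_closure (upair x x)) => t [Ht Hxt].
  apply: NNPP => Hn.
  case: (@foundation_set V t (fun x => ~ P x)); first by definable.
  - exists x; split=> //. apply: Hxt. rewrite upairE. tauto.
  - move=> m [Hm [Hnm Hmin]]. apply: Hnm. apply: H => y Hy.
    apply: NNPP => Hny. apply: (Hmin y) => //. exact: (Ht m).
Qed.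

Definition is_hierarchy f b : Prop :=
  forall c, c ∈ succ b -> app f c = bigcup (img c (fun d => power (app f d))).

(** The [b]-th stage of the cumulative hierarchy, usually written V with index
    [b]. *)
Definition stage b : V := the (fun v => exists f, is_hierarchy f b /\ v = app f b).

Lemma T1_stage : T1 stage.
Proof. unfold stage, is_hierarchy. definable. Qed.
Hint Resolve T1_stage : definability.

Lemma hierarchy_unique f f' b : ordinal b -> is_hierarchy f b -> is_hierarchy f' b ->
  app f b = app f' b.
Proof.
  move=> Hb Hf Hf'.
  apply: (ordinal_ind (fun c => c ∈ succ b -> app f c = app f' c)) => //; first by definable.
  - move=> c Hc IH Hcb. rewrite Hf // Hf' //. f_equal. apply: img_ext => d Hd.
    rewrite IH //. apply: (ordinal_trans _ c) => //. exact: succ_ordinal.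
  - exact: succ_self.
Qed.

Lemma is_hierarchy_below f b d : ordinal b -> is_hierarchy f b -> d ∈ b -> is_hierarchy f d.
Proof.
  move=> Hb Hf Hd c Hc. apply: Hf.
  move: (succ_ordinal _ Hb) => Hs.
  apply: (ord_le_lt_trans _ d) => //; first by rewrite -lt_succ_le.
  rewrite lt_succ_le. by left.
Qed.

Lemma stage_eq b : ordinal b -> stage b = bigcup (img b (fun d => power (stage d))).
Proof.
  move=> Hb.
  case: (wf_recursion (succ b) mem (fun n h => bigcup (img n (fun m => power (app h m)))));
    try by definable.
  { exact: mem_well_founded. }
  move=> f [_ Hf].
  have {}Hf : is_hierarchy f b.
  { move=> n Hn. rewrite (Hf n Hn). f_equal. apply: img_ext => m Hm.
    rewrite lam_app //; first by definable. rewrite sepE; last by definable.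
    split=> //. apply: (ordinal_trans _ n) => //. exact: succ_ordinal. }
  have stage_app : forall d, ordinal d -> is_hierarchy f d -> stage d = app f d.
  { move=> d Hd H. apply: the_eq; first by exists f.
    move=> v [f' [Hf' ->]]. exact: hierarchy_unique. }
  rewrite stage_app // (Hf b (succ_self b)). f_equal. apply: img_ext => d Hd.
  rewrite stage_app //; [exact: (ordinal_elem b)|exact: (is_hierarchy_below _ b)].
Qed.

Lemma stageE b x : ordinal b -> (x ∈ stage b <-> exists c, c ∈ b /\ x ⊆ stage c).
Proof.
  move=> Hb. rewrite stage_eq // bigcupE. split.
  - move=> [y []]. rewrite imgE; last by definable.
    move=> [c [Hc ->]]. rewrite powerE => Hx. by exists c.
  - move=> [c [Hc Hx]]. exists (power (stage c)). split; last by rewrite powerE.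
    apply: (img_mem _ (fun c => power (stage c))) => //. definable.
Qed.

Lemma stage_mono a b x : ordinal b -> a ∈ b -> x ∈ stage a -> x ∈ stage b.
Proof.
  move=> Hb Ha. rewrite stageE; last exact: (ordinal_elem b). rewrite stageE //.
  move=> [c [Hc Hx]]. exists c; split=> //. exact: (ordinal_trans _ a).
Qed.

(** Collection: replacement bounds the least stages at which witnesses appear.
    The hierarchy is needed because the witnesses themselves cannot be chosen
    before they are confined to a set. *)
Lemma stage_collection s (R : V -> V -> Prop) : D2 R ->
  (forall x, x ∈ s -> exists b, ordinal b /\ exists y, y ∈ stage b /\ R x y) ->
  exists b, ordinal b /\ forall x, x ∈ s -> exists y, y ∈ stage b /\ R x y.
Proof.
  move=> HR H.
  pose (rho := fun x => least (fun b => exists y, y ∈ stage b /\ R x y)).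
  have Hrho : T1 rho by unfold rho; definable.
  have Hspec : forall x, x ∈ s -> ordinal (rho x) /\ (exists y, y ∈ stage (rho x) /\ R x y).
  { move=> x Hx. case: (least_spec (fun b => exists y, y ∈ stage b /\ R x y)).
    - definable.
    - exact: H.
    - by move=> ? []. }
  case: (@ordinals_bounded V (img s rho)).
  { move=> b. rewrite imgE // => [] [x [Hx ->]]. by case: (Hspec x Hx). }
  move=> b [Hb Hlt]. exists b; split=> // x Hx.
  case: (Hspec x Hx) => _ [y [Hy Hr]]. exists y; split=> //.
  apply: (stage_mono (rho x)) => //. apply: Hlt. exact: img_mem.
Qed.

Theorem mem_stage x : exists b, ordinal b /\ x ∈ stage b.
Proof.
  apply: (mem_induction (fun x => exists b, ordinal b /\ x ∈ stage b)); first by definable.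
  move=> {}x IH.
  case: (stage_collection x eq); first by definable.
  { move=> y Hy. case: (IH y Hy) => b [Hb Hyb]. exists b; split=> //. by exists y. }
  move=> b [Hb H]. exists (succ b). split; first exact: succ_ordinal.
  rewrite stageE; last exact: succ_ordinal. exists b; split; first exact: succ_self.
  move=> y Hy. by case: (H y Hy) => y' [Hy' ->].
Qed.

(** Once the witnesses are confined to a stage, the fibers of the relation,
    tagged by their index, form a disjoint family of nonempty sets. *)
Theorem choice_function s (R : V -> V -> Prop) : D2 R ->
  (forall x, x ∈ s -> exists y, R x y) ->
  exists f, function_on f s /\ forall x, x ∈ s -> R x (app f x).
Proof.
  move=> HR H.
  have [b [Hb {}H]] : exists b, ordinal b /\ forall x, x ∈ s -> exists y, y ∈ stage b /\ R x y.
  { apply: stage_collection => // x Hx. case: (H x Hx) => y Hy.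
    case: (mem_stage y) => b [Hb Hyb]. exists b; split=> //. by exists y. }
  pose (fiber := fun x => img (sep (stage b) (R x)) (pair x)).
  have Hfib : T1 fiber by unfold fiber; definable.
  have fiberE : forall x p, p ∈ fiber x <-> exists y, y ∈ stage b /\ R x y /\ p = pair x y.
  { move=> x p. rewrite imgE; last by definable.
    split=> [] [y].
    - rewrite sepE; last by definable. move=> [[Hy Hr] ->]. by exists y.
    - move=> [Hy [Hr ->]]. exists y. rewrite sepE //. definable. }
  case: (@zfc_choice _ (model_zfc V) (img s fiber)).
  { move=> c. rewrite imgE // => [] [x [Hx ->]]. case: (H x Hx) => y [Hy Hr].
    exists (pair x y). rewrite fiberE. by exists y. }
  { move=> c d z. rewrite !imgE // => [] [x [Hx ->]] [x' [Hx' ->]].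
    rewrite !fiberE => [] [y [_ [_ ->]]] [y' [_ [_ /pair_inj [-> _]]]] //. }
  move=> c Hc.
  pose (val := fun x => the (fun y => pair x y ∈ c /\ y ∈ stage b /\ R x y)).
  have Hval : T1 val by unfold val; definable.
  exists (lam s val). split; first exact: lam_function_on.
  move=> x Hx. rewrite lam_app //.
  have [_ [_ //]] : pair x (val x) ∈ c /\ val x ∈ stage b /\ R x (val x).
  apply: (the_spec (fun y => pair x y ∈ c /\ y ∈ stage b /\ R x y)).
  case: (Hc (fiber x)); first exact: img_mem.
  move=> p [[Hp Hpc] Hu]. move: Hp. rewrite fiberE => [] [y [Hy [Hr E]]]. subst p.
  exists y; split=> // y' [Hy'c [Hy' Hr']].
  have /pair_inj [] // : pair x y = pair x y'.
  apply: Hu. split=> //. rewrite fiberE. by exists y'.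
Qed.

Theorem dependent_choice w s (R : V -> V -> Prop) x0 : is_omega w -> D2 R ->
  x0 ∈ s -> (forall x, x ∈ s -> exists y, y ∈ s /\ R y x) ->
  exists g, forall n, n ∈ w -> app g n ∈ s /\ R (app g (succ n)) (app g n).
Proof.
  move=> Hw HR H0 H.
  case: (choice_function s (fun x y => y ∈ s /\ R y x)) => //; first by definable.
  move=> sigma [_ Hs].
  case: (wf_recursion w mem (fun n h => cond (n = empty) x0 (app sigma (app h (bigcup n)))));
    try by definable.
  { exact: mem_well_founded. }
  move=> g [_ Hg]. exists g.
  have Hg0 : app g empty = x0.
  { rewrite Hg ?cond_true //. exact: omega_empty. }
  have HgS : forall n, n ∈ w -> app g (succ n) = app sigma (app g n).
  { move=> n Hn. move: (omega_succ _ _ Hw Hn) => Hsn.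
    move: (ordinal_elem _ _ (omega_ordinal _ Hw) Hn) => Hno.
    rewrite Hg // cond_false; last first.
    { move=> E. apply: (emptyE n). rewrite -E. exact: succ_self. }
    rewrite succ_bigcup // lam_app //; first by definable.
    rewrite sepE; last by definable. split=> //. exact: succ_self. }
  have Hin : forall n, n ∈ w -> app g n ∈ s.
  { apply: (omega_ind w (fun n => app g n ∈ s)) => //; first by definable.
    - by rewrite Hg0.
    - move=> n Hn Hgn. rewrite HgS //. by case: (Hs _ Hgn). }
  move=> n Hn. split; first exact: Hin. rewrite HgS //.
  by case: (Hs _ (Hin n Hn)).
Qed.

Theorem mostowski_collapse A (R : V -> V -> Prop) : D2 R -> well_founded_on A R ->
  exists f, function_on f A /\
    forall x, x ∈ A -> app f x = img (sep A (fun y => R y x)) (app f).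
Proof.
  move=> HR wf.
  case: (wf_recursion A R (fun x h => img (sep A (fun y => R y x)) (app h))) => //;
    first by definable.
  move=> f [Hf H]. exists f; split=> // x Hx. rewrite {1}H //. apply: img_ext => y Hy.
  rewrite lam_app //. definable.
Qed.

End Hierarchy.
#[export] Hint Resolve D1_limit T1_stage : definability.

(** * Cardinality *)

Section Cardinality.
Context {V : zfc_model}.
Implicit Types (a b c d f g h i j k m n p q r s u v w x y z : V) (P Q : V -> Prop) (F G : V -> V).

(** Comparison of sizes by partial surjections.  It is transitive, insensitive
    to empty sets, and for ordinals [b] equivalent to the existence of an
    injection of [a] into [b]. *)
Definition covers b a : Prop := exists s, forall y, y ∈ a -> exists i, i ∈ b /\ y = app s i.

Lemma D2_covers : D2 covers.
Proof. unfold covers. definable. Qed.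
Hint Resolve D2_covers : definability.

Lemma coversI b a F : T1 F -> (forall y, y ∈ a -> exists i, i ∈ b /\ y = F i) -> covers b a.
Proof.
  move=> HF H. exists (lam b F) => y Hy. case: (H y Hy) => i [Hi ->].
  exists i. by rewrite lam_app.
Qed.

Lemma covers_mono b b' a a' : b ⊆ b' -> a' ⊆ a -> covers b a -> covers b' a'.
Proof.
  move=> Hb Ha [s Hs]. exists s => y Hy. case: (Hs y (Ha _ Hy)) => i [Hi E].
  exists i. split=> //. exact: Hb.
Qed.

Lemma covers_refl a : covers a a.
Proof. apply: (coversI a a (fun x => x)); first by definable. by move=> y Hy; exists y. Qed.

Lemma covers_trans c b a : covers c b -> covers b a -> covers c a.
Proof.
  move=> [s Hs] [t Ht]. apply: (coversI _ _ (fun i => app t (app s i))); first by definable.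
  move=> y Hy. case: (Ht y Hy) => j [Hj ->]. case: (Hs j Hj) => i [Hi ->]. by exists i.
Qed.

Lemma equinumerousI a b F : T1 F -> (forall x, x ∈ a -> F x ∈ b) ->
  (forall x y, x ∈ a -> y ∈ a -> F x = F y -> x = y) ->
  (forall y, y ∈ b -> exists x, x ∈ a /\ y = F x) -> equinumerous a b.
Proof.
  move=> HF Hin Hinj Hon. exists (lam a F). split; first exact: lam_function.
  move=> y Hy. case: (Hon y Hy) => x [Hx ->]. exists x. split; first by rewrite lam_maps.
  move=> x'. rewrite lam_maps // => [] [Hx' E]. exact: Hinj.
Qed.

Lemma equinumerous_covers a b : equinumerous a b -> covers a b.
Proof.
  move=> [f [Hf H]]. exists f => y Hy. case: (H y Hy) => x [Hx _].
  have Hxa : x ∈ a by apply: (function_on_dom f _ _ y) => //; case: Hf.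
  exists x; split=> //. move: Hx. by rewrite (function_on_maps f a) //; case: Hf.
Qed.

(** The collapse [k] of a set of ordinals [x] under membership is strictly
    increasing and has an ordinal [t] as range; it maps the part of [x] below
    [y] onto [app k y], and never exceeds the identity. *)
Lemma order_type x : (forall y, y ∈ x -> ordinal y) ->
  exists k t, ordinal t /\ (forall y, y ∈ x -> app k y ∈ t) /\
    (forall y z, y ∈ x -> z ∈ x -> y ∈ z -> app k y ∈ app k z) /\
    (forall y z, y ∈ x -> z ∈ app k y -> exists u, u ∈ x /\ u ∈ y /\ z = app k u) /\
    (forall z, z ∈ t -> exists y, y ∈ x /\ z = app k y) /\
    (forall y, y ∈ x -> ord_le (app k y) y).
Proof.
  move=> Hx. case: (@mostowski_collapse V x mem); [by definable|exact: mem_well_founded|].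
  move=> k [_ Hk].
  have HkE : forall y z, y ∈ x -> (z ∈ app k y <-> exists u, u ∈ x /\ u ∈ y /\ z = app k u).
  { move=> y z Hy. rewrite Hk // imgE; last by definable.
    split=> [] [u].
    - rewrite sepE; last by definable. move=> [[Hu Huy] E]. by exists u.
    - move=> [Hu [Huy E]]. exists u. rewrite sepE //. definable. }
  have Hmon : forall y z, y ∈ x -> z ∈ x -> y ∈ z -> app k y ∈ app k z.
  { move=> y z Hy Hz Hyz. rewrite HkE //. by exists y. }
  have Hord : forall y, y ∈ x -> ordinal (app k y) /\ ord_le (app k y) y.
  { apply: (well_founded_induct x mem (fun y => ordinal (app k y) /\ ord_le (app k y) y));
      [exact: mem_well_founded|by definable|].
    move=> y Hy IH. have Ho : ordinal (app k y).
    { apply: ordinalI.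
      - move=> z /HkE => /(_ Hy) [u [Hu [Huy ->]]] v /HkE => /(_ Hu) [t [Ht [Htu ->]]].
        apply: Hmon => //. apply: (ordinal_trans _ u) => //. exact: Hx.
      - move=> z z' /HkE => /(_ Hy) [u [Hu [Huy ->]]] /HkE => /(_ Hy) [u' [Hu' [Huy' ->]]].
        apply: ord_trich; [by case: (IH u)|by case: (IH u')]. }
    split=> //. case: (ord_lt_or_ge y (app k y)) => //; first exact: Hx.
    move=> /HkE => /(_ Hy) [u [Hu [Huy E]]]. case: (IH u Hu Huy) => _ Hle.
    rewrite -E in Hle. by case: (ord_le_not_gt _ _ (Hx _ Hu) Hle). }
  exists k, (img x (app k)).
  have imE : forall z, z ∈ img x (app k) <-> exists y, y ∈ x /\ z = app k y.
  { move=> z. apply: imgE. definable. }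
  split; [|split; [|split; [|split; [|split]]]] => //.
  - apply: ordinalI.
    + move=> z /imE [y [Hy ->]] v /HkE => /(_ Hy) [u [Hu [_ ->]]]. apply/imE. by exists u.
    + move=> z z' /imE [y [Hy ->]] /imE [y' [Hy' ->]].
      apply: ord_trich; [by case: (Hord y)|by case: (Hord y')].
  - move=> y Hy. apply/imE. by exists y.
  - move=> y z Hy. by rewrite HkE.
  - move=> z /imE. done.
  - move=> y Hy. by case: (Hord y Hy).
Qed.

Lemma cardinal_ordinal c : cardinal c -> ordinal c.
Proof. by case. Qed.

(** The least preimages of a covering map form a subset of [b], whose order
    type is an ordinal at most [b] that is equinumerous with [c]. *)
Lemma cardinal_not_covered c b : cardinal c -> b ∈ c -> ~ covers b c.
Proof.
  move=> [Hc Hcard] Hb [s Hs]. have Hbo := ordinal_elem _ _ Hc Hb.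
  pose (r := fun y => least (fun i => i ∈ b /\ y = app s i)).
  have Hr : T1 r by unfold r; definable.
  have rspec : forall y, y ∈ c -> r y ∈ b /\ y = app s (r y).
  { move=> y Hy. case: (least_spec (fun i => i ∈ b /\ y = app s i)).
    - definable.
    - case: (Hs y Hy) => i [Hi E]. exists i. split=> //. exact: (ordinal_elem b).
    - by move=> _ []. }
  case: (order_type (img c r)).
  { move=> i. rewrite imgE // => [] [y [Hy ->]]. apply: (ordinal_elem b) => //.
    by case: (rspec y Hy). }
  move=> k [t [Ht [Hkt [Hmon [_ [Hon Hle]]]]]].
  have Htb : ord_le t b.
  { apply: subset_ord_le => // z Hz. case: (Hon z Hz) => i [].
    rewrite imgE // => [] [y [Hy E]] ->. subst i. case: (rspec y Hy) => Hry _.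
    apply: (ord_le_lt_trans _ (r y)) => //. apply: Hle. exact: img_mem. }
  have kinj : forall y y', y ∈ c -> y' ∈ c -> app k (r y) = app k (r y') -> y = y'.
  { move=> y y' Hy Hy' E. case: (rspec y Hy) => H1 H2. case: (rspec y' Hy') => H1' H2'.
    rewrite H2 H2'. f_equal.
    have Hi : r y ∈ img c r by exact: img_mem. have Hi' : r y' ∈ img c r by exact: img_mem.
    case: (ordinal_total b _ _ Hbo H1 H1') => [H|[//|H]].
    - have := Hmon _ _ Hi Hi' H. by rewrite E => /mem_irrefl.
    - have := Hmon _ _ Hi' Hi H. by rewrite E => /mem_irrefl. }
  apply: (Hcard t); first exact: (ord_le_lt_trans _ b).
  pose (F := fun i => the (fun y => y ∈ c /\ app k (r y) = i)).
  have HF : T1 F by unfold F; definable.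
  have Fval : forall y, y ∈ c -> F (app k (r y)) = y.
  { move=> y Hy. apply: the_eq => // w [Hw E]. exact: kinj. }
  have Fon : forall i, i ∈ t -> exists y, y ∈ c /\ i = app k (r y).
  { move=> i Hi. case: (Hon i Hi) => j []. rewrite imgE // => [] [y [Hy ->]] ->. by exists y. }
  apply: (equinumerousI t c F) => //.
  - move=> i Hi. case: (Fon i Hi) => y [Hy ->]. by rewrite Fval.
  - move=> i i' Hi Hi'. case: (Fon i Hi) => y [Hy ->]. case: (Fon i' Hi') => y' [Hy' ->].
    by rewrite !Fval // => ->.
  - move=> y Hy. exists (app k (r y)). rewrite Fval //. split=> //.
    apply: Hkt. exact: img_mem.
Qed.

Lemma ordinal_cardinality a : ordinal a -> exists m, cardinal m /\ ord_le m a /\ covers m a.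
Proof.
  move=> Ha. case: (ordinal_least (fun m => covers m a)); first by definable.
  { exists a. split=> //. exact: covers_refl. }
  move=> m [Hm [Hcov Hmin]]. exists m; split; [|split=> //].
  - split=> // b Hb /equinumerous_covers Hbm. apply: (Hmin b Hb). exact: (covers_trans _ m).
  - case: (ord_lt_or_ge a m) => // H. case: (Hmin a H). exact: covers_refl.
Qed.

(** No cardinal lies strictly between [d] and [dp], so the cardinality of [a]
    is at most [d]. *)
Lemma below_successor d dp a : ordinal d -> cardinal_successor d dp -> a ∈ dp -> covers d a.
Proof.
  move=> Hd [Hdp [_ Hmin]] Ha. have Hdpo := cardinal_ordinal _ Hdp.
  have Hao := ordinal_elem _ _ Hdpo Ha.
  case: (ordinal_cardinality _ Hao) => m [Hm [Hle Hcov]].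
  have Hmo := cardinal_ordinal _ Hm.
  apply: (covers_mono m _ a) => //. apply: ord_le_subset => //.
  case: (ord_lt_or_ge d m) => // H.
  case: (ord_le_not_gt dp a) => //. apply: (ord_le_trans _ m) => //. exact: Hmin.
Qed.

Lemma successor_not_covered d dp : cardinal_successor d dp -> ~ covers d dp.
Proof. move=> [Hdp [H _]]. exact: cardinal_not_covered. Qed.

Lemma monotone_enumeration x t k : (forall y, y ∈ x -> ordinal y) ->
  (forall y z, y ∈ x -> z ∈ x -> y ∈ z -> app k y ∈ app k z) ->
  (forall y, y ∈ x -> app k y ∈ t) ->
  (forall z, z ∈ t -> exists y, y ∈ x /\ z = app k y) ->
  exists r, (forall i, i ∈ t -> app r i ∈ x) /\ forall y, y ∈ x -> exists i, i ∈ t /\ y = app r i.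
Proof.
  move=> Hx Hmon Hkt Hon.
  pose (F := fun i => the (fun y => y ∈ x /\ app k y = i)).
  have HF : T1 F by unfold F; definable.
  have Fval : forall y, y ∈ x -> F (app k y) = y.
  { move=> y Hy. apply: the_eq => // z [Hz E].
    case: (ord_trich z y) => [| |H1|[//|H1]]; try exact: Hx.
    - have := Hmon _ _ Hz Hy H1. by rewrite E => /mem_irrefl.
    - have := Hmon _ _ Hy Hz H1. by rewrite E => /mem_irrefl. }
  exists (lam t F). split.
  - move=> i Hi. rewrite lam_app //. case: (Hon i Hi) => y [Hy ->]. by rewrite Fval.
  - move=> y Hy. exists (app k y). rewrite lam_app //; last exact: Hkt.
    rewrite Fval //. split=> //. exact: Hkt.
Qed.

(** If the order type exceeds [d], the initial segment below the element of
    rank [d] has order type [d], and a cardinal is not covered by a smaller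
    ordinal. *)
Lemma order_type_dichotomy d x : cardinal d -> (forall y, y ∈ x -> ordinal y) ->
  (exists t r, ord_le t d /\ (forall i, i ∈ t -> app r i ∈ x) /\
     forall y, y ∈ x -> exists i, i ∈ t /\ y = app r i) \/
  (exists h, h ∈ x /\ forall e, e ∈ d -> ~ covers e (inter x h)).
Proof.
  move=> Hd Hx. have Hdo := cardinal_ordinal _ Hd.
  case: (order_type x Hx) => k [t [Ht [Hkt [Hmon [Hseg [Hon _]]]]]].
  case: (ord_lt_or_ge d t) => // H.
  - right. case: (Hon d H) => h [Hh E]. exists h; split=> // e He Hcov.
    apply: (cardinal_not_covered d e) => //. apply: (covers_trans _ (inter x h)) => //.
    exists k => y. rewrite {1}E => Hy. case: (Hseg h y Hh Hy) => u [Hu [Huh ->]].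
    exists u. by rewrite interE.
  - left. exists t. case: (monotone_enumeration x t k) => // r Hr. by exists r.
Qed.

(** The natural numbers in [x] are shifted by one, which makes room for the
    additional element at [0]. *)
Lemma covers_succ w x : is_omega w -> w ⊆ x -> covers x (succ x).
Proof.
  move=> Hw Hx.
  apply: (coversI _ _ (fun i => cond (i = empty) x (cond (i ∈ w) (bigcup i) i)));
    first by definable.
  move=> y. rewrite succE => Hy. case: (classic (y = x)) => [->|Hne].
  - exists empty. rewrite cond_true //. split=> //. apply: Hx. exact: omega_empty.
  - case: (classic (y ∈ w)) => Hyw.
    + exists (succ y). have Hs := omega_succ _ _ Hw Hyw. split; first exact: Hx.
      rewrite cond_false; last first.
      { move=> E. apply: (emptyE y). rewrite -E. exact: succ_self. }
      rewrite cond_true // succ_bigcup //. apply: (ordinal_elem w) => //.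
      exact: omega_ordinal.
    + exists y. split; first tauto. rewrite cond_false; last first.
      { move=> E. apply: Hyw. rewrite E. exact: omega_empty. }
      by rewrite cond_false.
Qed.

Lemma infinite_cardinal_limit w c : is_omega w -> cardinal c -> w ∈ c -> limit_ordinal c.
Proof.
  move=> Hw Hc Hwc. have Hco := cardinal_ordinal _ Hc.
  apply: limit_ordinalI => //.
  - move=> E. rewrite E in Hwc. by move/emptyE: Hwc.
  - move=> b E. apply: (cardinal_not_covered c b) => //; first by rewrite E; exact: succ_self.
    rewrite E. apply: (covers_succ w) => //. apply: ord_le_subset.
    + apply: (ordinal_elem c) => //. rewrite E. exact: succ_self.
    + by rewrite -lt_succ_le -E.
Qed.

(** ** Products *)

Definition prod a b : V := setof (fun p => exists x y, x ∈ a /\ y ∈ b /\ p = pair x y).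
Definition fst p : V := the (fun x => exists y, p = pair x y).
Definition snd p : V := the (fun y => exists x, p = pair x y).

Lemma T2_prod : T2 prod. Proof. unfold prod. definable. Qed.
Lemma T1_fst : T1 fst. Proof. unfold fst. definable. Qed.
Lemma T1_snd : T1 snd. Proof. unfold snd. definable. Qed.
Hint Resolve T2_prod T1_fst T1_snd : definability.

Lemma prodE a b p : p ∈ prod a b <-> exists x y, x ∈ a /\ y ∈ b /\ p = pair x y.
Proof.
  apply: setofE. exists (bigcup (img a (fun x => img b (pair x)))) => q.
  rewrite bigcupE. split.
  - move=> [c []]. rewrite imgE; last by definable. move=> [x [Hx ->]].
    rewrite imgE; last by definable. move=> [y [Hy ->]]. by exists x, y.
  - move=> [x [y [Hx [Hy ->]]]]. exists (img b (pair x)). split.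
    + apply: (img_mem _ (fun x => img b (pair x))) => //. definable.
    + apply: img_mem => //. definable.
Qed.

Lemma pair_prod a b x y : x ∈ a -> y ∈ b -> pair x y ∈ prod a b.
Proof. move=> Hx Hy. apply/prodE. by exists x, y. Qed.

Lemma fst_pair x y : fst (pair x y) = x.
Proof. apply: the_eq; first by exists y. by move=> x' [y' /pair_inj []]. Qed.

Lemma snd_pair x y : snd (pair x y) = y.
Proof. apply: the_eq; first by exists x. by move=> x' [y' /pair_inj []]. Qed.

Lemma covers_prod a b : covers a b -> covers (prod a a) (prod b b).
Proof.
  move=> [s Hs]. apply: (coversI _ _ (fun p => pair (app s (fst p)) (app s (snd p))));
    first by definable.
  move=> p /prodE [x [y [Hx [Hy ->]]]]. case: (Hs x Hx) => i [Hi ->]. case: (Hs y Hy) => j [Hj ->].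
  exists (pair i j). split; first exact: pair_prod. by rewrite fst_pair snd_pair.
Qed.

(** ** Finite sets *)

Definition unbounded_in w s : Prop := forall k, k ∈ w -> exists x, x ∈ s /\ k ∈ x.

Lemma D2_unbounded_in : D2 unbounded_in.
Proof. unfold unbounded_in. definable. Qed.
Hint Resolve D2_unbounded_in : definability.

(** Induction on the number [n] of colours: unless the last colour occurs
    unboundedly, it can be avoided by passing to a final segment. *)
Lemma infinite_pigeonhole w n : is_omega w -> n ∈ w -> forall s f,
  s ⊆ w -> unbounded_in w s -> (forall x, x ∈ s -> app f x ∈ n) ->
  exists i, i ∈ n /\ unbounded_in w (sep s (fun x => app f x = i)).
Proof.
  move=> Hw Hn. have Hwo := omega_ordinal _ Hw. move: n Hn.
  apply: (omega_ind w (fun n => forall s f,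
    s ⊆ w -> unbounded_in w s -> (forall x, x ∈ s -> app f x ∈ n) ->
    exists i, i ∈ n /\ unbounded_in w (sep s (fun x => app f x = i)))) => //.
  - definable.
  - move=> s f Hs Hun Hf. case: (Hun empty); first exact: omega_empty.
    move=> x [Hx _]. by move: (Hf x Hx) => /emptyE.
  - move=> n Hn IH s f Hs Hun Hf.
    case: (classic (unbounded_in w (sep s (fun x => app f x = n)))) => Hc.
    { exists n. split=> //. exact: succ_self. }
    have [k [Hk Hno]] : exists k, k ∈ w /\ forall x, x ∈ s -> app f x = n -> ~ k ∈ x.
    { apply: NNPP => H. apply: Hc => k Hk. apply: NNPP => H'. apply: H.
      exists k; split=> // x Hx E Hkx. apply: H'. exists x. rewrite sepE //. definable. }
    have sE : forall x, x ∈ sep s (fun x => k ∈ x) <-> x ∈ s /\ k ∈ x.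
    { move=> x. apply: sepE. definable. }
    case: (IH (sep s (fun x => k ∈ x)) f).
    + by move=> x /sE [Hx _]; exact: Hs.
    + move=> k' Hk'.
      case: (ordinal_total w _ _ Hwo Hk Hk') => Hkk.
      * case: (Hun k' Hk') => x [Hx Hkx]. exists x; split=> //. apply/sE; split=> //.
        apply: (ordinal_trans _ k') => //. apply: (ordinal_elem w) => //. exact: Hs.
      * case: (Hun k Hk) => x [Hx Hkx]. exists x; split; first exact/sE.
        case: Hkk => [<- //|H]. apply: (ordinal_trans _ k) => //.
        apply: (ordinal_elem w) => //. exact: Hs.
    + move=> x /sE [Hx Hkx]. move: (Hf x Hx). rewrite succE => [] [//|E].
      by case: (Hno x).
    + move=> i [Hi Hu]. exists i. split; first by rewrite succE; left.
      move=> k' Hk'. case: (Hu k' Hk') => x [Hx Hkx]. exists x; split=> //.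
      move: Hx. rewrite sepE; last by definable. move=> [/sE [Hxs _] E].
      rewrite sepE //. definable.
Qed.

(** Apply the pigeonhole principle to both coordinates in turn: infinitely many
    numbers would be the image of one pair. *)
Lemma omega_not_covered_square w n : is_omega w -> n ∈ w -> ~ covers (prod n n) w.
Proof.
  move=> Hw Hn [s Hs]. have Hwo := omega_ordinal _ Hw.
  case: (choice_function w (fun y p => p ∈ prod n n /\ y = app s p)) => //; first by definable.
  move=> g [_ Hg].
  have Hun : unbounded_in w w.
  { move=> k Hk. exists (succ k). split; [exact: omega_succ|exact: succ_self]. }
  have Hpq : forall y, y ∈ w -> fst (app g y) ∈ n /\ snd (app g y) ∈ n /\
    app g y = pair (fst (app g y)) (snd (app g y)).
  { move=> y Hy. case: (Hg y Hy) => /prodE [p [q [Hp [Hq E]]]] _.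
    by rewrite E fst_pair snd_pair. }
  have H1 : forall y, y ∈ w -> app (lam w (fun y => fst (app g y))) y = fst (app g y).
  { move=> y Hy. rewrite lam_app //. definable. }
  have H2 : forall y, y ∈ w -> app (lam w (fun y => snd (app g y))) y = snd (app g y).
  { move=> y Hy. rewrite lam_app //. definable. }
  case: (infinite_pigeonhole w n Hw Hn w (lam w (fun y => fst (app g y)))) => //.
  { move=> x Hx. rewrite H1 //. by case: (Hpq x Hx). }
  move=> i [Hi]. set s1 := sep w _ => Hu1.
  have s1E : forall y, y ∈ s1 -> y ∈ w /\ fst (app g y) = i.
  { move=> y. rewrite sepE; last by definable. move=> [Hy]. by rewrite H1. }
  case: (infinite_pigeonhole w n Hw Hn s1 (lam w (fun y => snd (app g y)))) => //.
  { by move=> y /s1E []. }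
  { move=> x /s1E [Hx _]. rewrite H2 //. by case: (Hpq x Hx) => _ []. }
  move=> j [Hj]. set s2 := sep s1 _ => Hu2.
  have s2E : forall y, y ∈ s2 -> y ∈ w /\ app g y = pair i j.
  { move=> y. rewrite sepE; last by definable. move=> [/s1E [Hy E1]]. rewrite H2 // => E2.
    split=> //. case: (Hpq y Hy) => _ [_ ->]. by rewrite E1 E2. }
  case: (Hu2 empty); first exact: omega_empty. move=> x [Hx _].
  case: (Hu2 x); first by case: (s2E x Hx). move=> y [Hy Hxy].
  case: (s2E x Hx) => Hxw Ex. case: (s2E y Hy) => Hyw Ey.
  case: (Hg x Hxw) => _. rewrite Ex. case: (Hg y Hyw) => _. rewrite Ey => E1 E2.
  apply: (mem_irrefl x). by rewrite {2}E2 -E1.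
Qed.

Lemma omega_not_covered w n : is_omega w -> n ∈ w -> ~ covers n w.
Proof.
  move=> Hw Hn H. apply: (omega_not_covered_square w n) => //.
  apply: (covers_trans _ n) => //. apply: (coversI _ _ fst); first by definable.
  move=> y Hy. exists (pair y y). split; first exact: pair_prod. by rewrite fst_pair.
Qed.

End Cardinality.
#[export] Hint Resolve D2_covers T2_prod T1_fst T1_snd : definability.

(** * Squares of infinite ordinals *)

Section Squares.
Context {V : zfc_model}.
Implicit Types (a b c d f g h i j k m n p q r s u v w x y z : V) (P Q : V -> Prop) (F G : V -> V).

Let gmax p := union (fst p) (snd p).

(** Pairs are ordered by their maximum, then lexicographically, so that the
    predecessors of a pair lie in the square of a smaller ordinal. *)
Let goedel_lt p q : Prop :=
  gmax p ∈ gmax q \/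
  (gmax p = gmax q /\ (fst p ∈ fst q \/ (fst p = fst q /\ snd p ∈ snd q))).

Let T1_gmax : T1 gmax.
Proof. unfold gmax. definable. Qed.

Let D2_goedel_lt : D2 goedel_lt.
Proof. unfold goedel_lt. definable. Qed.

Lemma foundation_by s F P : T1 F -> D1 P -> (exists x, x ∈ s /\ P x) ->
  exists x, x ∈ s /\ P x /\ forall y, y ∈ s -> P y -> ~ F y ∈ F x.
Proof.
  move=> HF HP [x [Hx Px]].
  case: (foundation_set (img s F) (fun z => exists x, x ∈ s /\ P x /\ z = F x));
    first by definable.
  { exists (F x). split; first exact: img_mem. by exists x. }
  move=> z [_ [[m [Hm [Pm ->]]] Hmin]]. exists m; split=> //; split=> // y Hy Py.
  apply: Hmin; first exact: img_mem. by exists y.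
Qed.

Lemma goedel_well_founded A : well_founded_on A goedel_lt.
Proof.
  move=> s _ [x Hx].
  case: (foundation_by s gmax (fun _ => True)) => //; [by definable|by exists x|].
  move=> x1 [Hx1 [_ M1]].
  case: (foundation_by s fst (fun y => gmax y = gmax x1)); [by definable|by definable|by exists x1|].
  move=> x2 [Hx2 [E2 M2]].
  case: (foundation_by s snd (fun y => gmax y = gmax x1 /\ fst y = fst x2));
    [by definable|by definable|by exists x2|].
  move=> x3 [Hx3 [[E3 E3'] M3]]. exists x3; split=> // y Hy [|[E [H|[H1 H2]]]].
  - rewrite E3. exact: M1.
  - apply: (M2 y) => //; [by rewrite E|by rewrite -E3'].
  - apply: (M3 y) => //. split; [by rewrite E|by rewrite H1].
Qed.

Lemma square_elem m p : ordinal m -> p ∈ prod m m ->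
  fst p ∈ m /\ snd p ∈ m /\ p = pair (fst p) (snd p) /\ gmax p ∈ m /\
  ord_le (fst p) (gmax p) /\ ord_le (snd p) (gmax p).
Proof.
  move=> Hm /prodE [x [y [Hx [Hy E]]]]. subst p. rewrite /gmax !fst_pair !snd_pair.
  have Hxo := ordinal_elem _ _ Hm Hx. have Hyo := ordinal_elem _ _ Hm Hy.
  have Hmax : forall a b, ordinal a -> ord_le b a -> union a b = a /\ union b a = a.
  { move=> a b Ha Hb. have Hs := ord_le_subset _ _ Ha Hb.
    split; apply: subset_antisym => z; rewrite unionE; try tauto.
    - by move=> [//|]; apply: Hs.
    - by move=> [|//]; apply: Hs. }
  do 3 (split=> //).
  case: (ord_lt_or_ge x y) => // H.
  - case: (Hmax y x Hyo (or_introl H)) => _ ->. split=> //. split; [by left|by right].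
  - case: (Hmax x y Hxo H) => -> _. split=> //. split=> //. by right.
Qed.

Lemma goedel_trichotomy m p q : ordinal m -> p ∈ prod m m -> q ∈ prod m m ->
  goedel_lt p q \/ p = q \/ goedel_lt q p.
Proof.
  move=> Hm Hp Hq.
  case: (square_elem m p Hm Hp) => Hp1 [Hp2 [Ep [Hp3 _]]].
  case: (square_elem m q Hm Hq) => Hq1 [Hq2 [Eq [Hq3 _]]].
  case: (ordinal_total m _ _ Hm Hp3 Hq3) => [H|[E|H]].
  - by left; left.
  - case: (ordinal_total m _ _ Hm Hp1 Hq1) => [H|[E1|H]].
    + left; right. tauto.
    + case: (ordinal_total m _ _ Hm Hp2 Hq2) => [H|[E2|H]].
      * left; right. tauto.
      * right; left. by rewrite Ep Eq E1 E2.
      * right; right; right. split=> //. right. by split.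
    + right; right; right. split=> //. by left.
  - by right; right; left.
Qed.

Lemma goedel_trans m p q r : ordinal m -> p ∈ prod m m -> q ∈ prod m m -> r ∈ prod m m ->
  goedel_lt p q -> goedel_lt q r -> goedel_lt p r.
Proof.
  move=> Hm Hp Hq Hr.
  case: (square_elem m p Hm Hp) => Hp1 [Hp2 [Ep [Hp3 _]]].
  case: (square_elem m q Hm Hq) => Hq1 [Hq2 [Eq [Hq3 _]]].
  case: (square_elem m r Hm Hr) => Hr1 [Hr2 [Er [Hr3 _]]].
  have tr : forall a b c, c ∈ m -> a ∈ b -> b ∈ c -> a ∈ c.
  { move=> a b c Hc Hab Hbc. apply: (ordinal_trans _ b) => //. exact: (ordinal_elem m). }
  rewrite /goedel_lt.
  move=> [H1|[E1 [H1|[E1' H1]]]] [H2|[E2 [H2|[E2' H2]]]].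
  - left. exact: (tr _ (gmax q)).
  - left. by rewrite -E2.
  - left. by rewrite -E2.
  - left. by rewrite E1.
  - right. split; first by rewrite E1. left. exact: (tr _ (fst q)).
  - right. split; first by rewrite E1. left. by rewrite -E2'.
  - left. by rewrite E1.
  - right. split; first by rewrite E1. left. by rewrite E1'.
  - right. split; first by rewrite E1. right. split; first by rewrite E1'.
    exact: (tr _ (snd q)).
Qed.

(** Induction on [m].  If [m] is covered by a smaller ordinal, the square of
    that ordinal is used.  Otherwise the collapse of the ordering of pairs maps
    the square of [m] injectively into [m]: a value outside [m] would cover [m]
    by a set of predecessors, hence by the square of a smaller ordinal, which is
    excluded by induction or, in the finite case, by the pigeonhole
    principle. *)
Theorem infinite_square w m : is_omega w -> ordinal m -> w ⊆ m -> covers m (prod m m).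
Proof.
  move=> Hw Hm. have Hwo := omega_ordinal _ Hw.
  apply: (ordinal_ind (fun m => w ⊆ m -> covers m (prod m m))) => //; first by definable.
  move=> {Hm} {}m Hm IH Hwm.
  case: (classic (exists n, n ∈ m /\ covers n m)) => [[n [Hn Hcov]]|Hno].
  { have Hno := ordinal_elem _ _ Hm Hn.
    have Hwn : w ⊆ n.
    { case: (ord_lt_or_ge n w) => // H; last exact: ord_le_subset.
      case: (omega_not_covered w n) => //. apply: (covers_trans _ m) => //.
      exact: (covers_mono m m m w _ _ (covers_refl m)). }
    apply: (covers_mono n m (prod m m)) => //.
    { exact: ord_le_subset _ _ Hm (or_introl Hn). }
    apply: (covers_trans _ (prod n n)); first exact: IH. exact: covers_prod. }
  case: (mostowski_collapse (prod m m) goedel_lt) => //; first exact: goedel_well_founded.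
  move=> f [_ Hf].
  have fE : forall p z, p ∈ prod m m ->
    (z ∈ app f p <-> exists q, q ∈ prod m m /\ goedel_lt q p /\ z = app f q).
  { move=> p z Hp. rewrite Hf // imgE; last by definable.
    split=> [] [q].
    - rewrite sepE; last by definable. move=> [[Hq Hqp] E]. by exists q.
    - move=> [Hq [Hqp E]]. exists q. rewrite sepE //. definable. }
  have ford : forall p, p ∈ prod m m -> ordinal (app f p).
  { apply: (well_founded_induct (prod m m) goedel_lt (fun p => ordinal (app f p)));
      [exact: goedel_well_founded|by definable|].
    move=> p Hp IHp. apply: ordinalI.
    - move=> z /fE => /(_ Hp) [q [Hq [Hqp ->]]] y /fE => /(_ Hq) [r [Hr [Hrq ->]]].
      apply/fE => //. exists r; split=> //; split=> //. exact: (goedel_trans m r q p).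
    - move=> z y /fE => /(_ Hp) [q [Hq [Hqp ->]]] /fE => /(_ Hp) [r [Hr [Hrp ->]]].
      apply: ord_trich; exact: IHp. }
  have finj : forall p q, p ∈ prod m m -> q ∈ prod m m -> app f p = app f q -> p = q.
  { move=> p q Hp Hq E. case: (goedel_trichotomy m p q) => // [H|[//|H]].
    - have : app f p ∈ app f q by apply/fE => //; exists p. by rewrite E => /mem_irrefl.
    - have : app f q ∈ app f p by apply/fE => //; exists q. by rewrite E => /mem_irrefl. }
  (* an initial segment of the order lies in the square of a smaller ordinal *)
  have fin : forall p, p ∈ prod m m -> app f p ∈ m.
  { move=> p Hp. case: (ord_lt_or_ge (app f p) m) => //; first exact: ford.
    move=> Hle. exfalso.
    case: (square_elem m p Hm Hp) => _ [_ [_ [Hmax _]]].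
    have Hmo := ordinal_elem _ _ Hm Hmax.
    pose n := succ (gmax p).
    have Hn : n ∈ m.
    { case: (succ_le _ _ Hmo Hm Hmax) => // E. case: Hno. exists (gmax p); split=> //.
      rewrite -E. apply: (covers_succ w) => //. apply: ord_le_subset => //.
      case: (ord_lt_or_ge (gmax p) w) => // H.
      case: (mem_irrefl m). apply: Hwm. rewrite -E. exact: omega_succ. }
    have Hcov : covers (prod n n) m.
    { exists f => i Hi. have {}Hi : i ∈ app f p.
      { exact: (ord_le_subset _ _ (ford p Hp) Hle). }
      move: Hi => /fE => /(_ Hp) [q [Hq [Hqp ->]]]. exists q. split=> //.
      case: (square_elem m q Hm Hq) => Hq1 [Hq2 [Eq [Hq3 [Hq4 Hq5]]]].
      have Hle' : ord_le (gmax q) (gmax p) by case: Hqp => [H|[H _]]; [left|right].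
      rewrite Eq. apply: pair_prod; rewrite /n lt_succ_le; exact: (ord_le_trans _ (gmax q)). }
    have Hnord := ordinal_elem _ _ Hm Hn.
    case: (ord_lt_or_ge n w) => // H.
    - apply: (omega_not_covered_square w n) => //. apply: (covers_trans _ m) => //.
      exact: (covers_mono m m m w _ _ (covers_refl m)).
    - apply: Hno. exists n; split=> //. apply: (covers_trans _ (prod n n)) => //.
      apply: IH => //. exact: ord_le_subset. }
  apply: (coversI _ _ (fun i => the (fun p => p ∈ prod m m /\ app f p = i))); first by definable.
  move=> p Hp. exists (app f p). split; first exact: fin.
  symmetry. apply: the_eq => // q [Hq E]. exact: finj.
Qed.

Theorem pairing_function w m : is_omega w -> ordinal m -> w ⊆ m ->
  exists G : V -> V -> V, T2 G /\ (forall x y, x ∈ m -> y ∈ m -> G x y ∈ m) /\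
    forall x y x' y', x ∈ m -> y ∈ m -> x' ∈ m -> y' ∈ m -> G x y = G x' y' -> x = x' /\ y = y'.
Proof.
  move=> Hw Hm Hwm. case: (infinite_square w m Hw Hm Hwm) => s Hs.
  pose (G := fun x y => least (fun i => i ∈ m /\ pair x y = app s i)).
  have HG : T2 G by unfold G; definable.
  have spec : forall x y, x ∈ m -> y ∈ m -> G x y ∈ m /\ pair x y = app s (G x y).
  { move=> x y Hx Hy. case: (least_spec (fun i => i ∈ m /\ pair x y = app s i)).
    - definable.
    - case: (Hs (pair x y)); first exact: pair_prod.
      move=> i [Hi E]. exists i. split=> //. exact: (ordinal_elem m).
    - by move=> _ []. }
  exists G; split=> //; split.
  - move=> x y Hx Hy. by case: (spec x y).
  - move=> x y x' y' Hx Hy Hx' Hy' E. apply: pair_inj.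
    case: (spec x y) => // _ ->. case: (spec x' y') => // _ ->. by rewrite E.
Qed.

(** The supremum of [d] ordinals covered by [d] is covered by the square of
    [d], hence by [d]. *)
Theorem successor_regular w d dp F : is_omega w -> w ⊆ d -> cardinal d ->
  cardinal_successor d dp -> T1 F -> (forall i, i ∈ d -> F i ∈ dp) ->
  exists b, b ∈ dp /\ forall i, i ∈ d -> ord_le (F i) b.
Proof.
  move=> Hw Hwd Hd Hdp HF Hf. have Hdo := cardinal_ordinal _ Hd.
  have Hdpo : ordinal dp by apply: cardinal_ordinal; case: Hdp.
  have Ho : forall x, x ∈ img d F -> ordinal x.
  { move=> x. rewrite imgE // => [] [i [Hi ->]]. apply: (ordinal_elem dp) => //. exact: Hf. }
  have Hub : forall i, i ∈ d -> ord_le (F i) (bigcup (img d F)).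
  { move=> i Hi. apply: bigcup_ub => //. exact: img_mem. }
  exists (bigcup (img d F)). split=> //.
  have Hb := bigcup_ordinal _ Ho.
  case: (ord_lt_or_ge (bigcup (img d F)) dp) => // Hle. exfalso.
  apply: (successor_not_covered d dp) => //.
  apply: (covers_mono d d (bigcup (img d F))) => //; first exact: ord_le_subset.
  case: (choice_function d (fun i s => forall y, y ∈ F i -> exists x, x ∈ d /\ y = app s x));
    first by definable.
  { move=> i Hi. apply: (below_successor d dp) => //. exact: Hf. }
  move=> S [_ HS].
  apply: (covers_trans _ (prod d d)); first exact: (infinite_square w).
  apply: (coversI _ _ (fun p => app (app S (fst p)) (snd p))); first by definable.
  move=> y. rewrite bigcupE => [] [z []]. rewrite imgE // => [] [i [Hi ->]] Hy.
  case: (HS i Hi y Hy) => x [Hx ->]. exists (pair i x). split; first exact: pair_prod.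
  by rewrite fst_pair snd_pair.
Qed.

(** The map is replaced by its running suprema.  They stay below [l] because
    the restriction of the given map to an element of [c] is bounded. *)
Lemma monotone_cofinal_map l c : (forall x, x ∈ l -> ordinal x) -> cofinality l c ->
  exists f, (forall i, i ∈ c -> app f i ∈ l) /\
    (forall i j, i ∈ c -> j ∈ c -> ord_le i j -> ord_le (app f i) (app f j)) /\
    (forall x, x ∈ l -> exists i, i ∈ c /\ ord_le x (app f i)).
Proof.
  move=> Hl [Hc [[g [/functionE [Hgf Hg] Hcof]] Hmin]].
  pose (B := fun i => least (fun b => b ∈ l /\ forall y, y ∈ succ i -> ord_le (app g y) b)).
  have HB : T1 B by unfold B; definable.
  have Bspec : forall i, i ∈ c -> B i ∈ l /\ forall y, y ∈ succ i -> ord_le (app g y) (B i).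
  { move=> i Hi.
    have Hic : forall y, y ∈ i -> y ∈ c by move=> y; apply: (ordinal_trans _ i).
    case: (least_spec (fun b => b ∈ l /\ forall y, y ∈ succ i -> ord_le (app g y) b));
      [by definable| |by move=> _ []].
    have [a [Ha Hlt]] : exists a, a ∈ l /\ forall y, y ∈ i -> ~ ord_le a (app g y).
    { apply: NNPP => H. apply: (Hmin i Hi). exists (lam i (app g)).
      have Hdf : T1 (app g) by definable.
      split.
      - apply: lam_function => // y Hy. apply: Hg. exact: Hic.
      - move=> a Ha. apply: NNPP => H'. apply: H. exists a; split=> // y Hy Hle.
        apply: H'. exists y, (app g y). rewrite lam_maps //. }
    have Hlt' : forall y, y ∈ i -> app g y ∈ a.
    { move=> y Hy. case: (ord_lt_or_ge (app g y) a) => //; try (apply: Hl => //; apply: Hg; exact: Hic).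
      move=> Hle. by case: (Hlt y Hy). }
    have Hgi := Hg i Hi.
    case: (ord_lt_or_ge a (app g i)); try exact: Hl.
    - move=> H. exists (app g i). split; first exact: Hl. split=> // y.
      rewrite succE => [] [Hy|->]; last by right. left.
      apply: (ordinal_trans _ a) => //; [exact: Hl|exact: Hlt'].
    - move=> H. exists a. split; first exact: Hl. split=> // y.
      rewrite succE => [] [Hy|->] //. left. exact: Hlt'. }
  exists (lam c B). split; [|split].
  - move=> i Hi. rewrite lam_app //. by case: (Bspec i Hi).
  - move=> i j Hi Hj Hij. rewrite !lam_app //. case: (Bspec j Hj) => H1 H2.
    apply: least_le; [by definable|exact: Hl|]. split=> // y Hy. apply: H2.
    have Hjo := ordinal_elem _ _ Hc Hj.
    apply: (ord_le_lt_trans _ i); [exact: succ_ordinal|by rewrite -lt_succ_le|].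
    by rewrite lt_succ_le.
  - move=> x Hx. case: (Hcof x Hx) => i [b [Hi [Hm Hle]]]. exists i; split=> //.
    rewrite lam_app //. case: (Bspec i Hi) => H1 H2.
    apply: (ord_le_trans _ b) => //; first exact: Hl.
    move: Hm. rewrite (function_on_maps g c) // => ->. apply: H2. exact: succ_self.
Qed.

End Squares.

(** * Coding well-founded relations by subsets of a limit ordinal *)

Section Coding.

(** The definitions of this part make sense in every structure, because they
    will be read both in [V] and in the ultrapower. *)
Definition coded_by {W : set_structure} (G x y z : W) : Prop :=
  exists p, is_pair p x y /\ maps G p z.

Definition coded_relation {W : set_structure} (G c x y : W) : Prop :=
  exists z, z ∈ c /\ coded_by G x y z.

(** [h] is a transitive collapse of the relation on [m] coded by [c]; the last
    clause adds that images under [h] exist, which is what the ultrapower will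
    be asked for. *)
Definition collapses_coded {W : set_structure} (m G c h : W) : Prop :=
  (forall x, x ∈ m -> exists v, maps h x v) /\
  (forall x v v', maps h x v -> maps h x v' -> v = v') /\
  (forall x v, x ∈ m -> maps h x v -> forall z,
     z ∈ v <-> exists y, y ∈ m /\ coded_relation G c y x /\ maps h y z) /\
  forall s, exists r, forall y, y ∈ r <-> exists x, x ∈ s /\ maps h x y.

Definition coded_collapse {W : set_structure} (m : W) : Prop :=
  limit_ordinal m -> exists G,
    (forall x y, x ∈ m -> y ∈ m -> exists z, z ∈ m /\ coded_by G x y z) /\
    (forall x y x' y' z, coded_by G x y z -> coded_by G x' y' z -> x = x' /\ y = y') /\
    (forall x y z z', coded_by G x y z -> coded_by G x y z' -> z = z') /\
    forall c,
      (forall s, s ⊆ m -> nonempty s ->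
         exists u, u ∈ s /\ forall y, y ∈ s -> ~ coded_relation G c y u) ->
      exists h, collapses_coded m G c h.

Lemma udef_coded_collapse : uniformly_definable (fun W e => @coded_collapse W (e 0)).
Proof.
  unfold coded_collapse, collapses_coded, coded_relation, coded_by, limit_ordinal, ordinal,
    transitive_set, well_ordered_by_mem, maps, is_pair, is_upair, subset, nonempty.
  udefinable.
Qed.

Context {V : zfc_model}.

Lemma omega_below_limit (w m : V) : is_omega w -> limit_ordinal m -> w ⊆ m.
Proof.
  move=> Hw Hm. have Hwo := omega_ordinal _ Hw. have Hmo : ordinal m by case: Hm.
  case: (ord_lt_or_ge m w) => //; last exact: ord_le_subset.
  move=> H. case: Hw => _ Hn. by case: (Hn m).
Qed.

(** [G] is the graph of a pairing function on [m]; [h] comes from the collapse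
    of an arbitrary well-founded relation. *)
Theorem coded_collapse_valid (m : V) : coded_collapse m.
Proof.
  move=> Hm. have Hmo : ordinal m by case: Hm.
  case: (@omega_exists V) => w Hw.
  case: (pairing_function w m Hw Hmo (omega_below_limit w m Hw Hm)) => pr [Hpr [Hin Hinj]].
  pose (G := lam (prod m m) (fun p => pr (fst p) (snd p))).
  have HG : T1 (fun p => pr (fst p) (snd p)) by definable.
  have GE : forall x y z, coded_by G x y z <-> x ∈ m /\ y ∈ m /\ z = pr x y.
  { move=> x y z. split.
    - move=> [p [/is_pairE ->]]. rewrite lam_maps // => [] [/prodE [x' [y' [Hx [Hy /pair_inj [-> ->]]]]]].
      by rewrite fst_pair snd_pair.
    - move=> [Hx [Hy ->]]. exists (pair x y). split; first by apply/is_pairE.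
      rewrite lam_maps //. split; first exact: pair_prod. by rewrite fst_pair snd_pair. }
  exists G. split; [|split; [|split]].
  - move=> x y Hx Hy. exists (pr x y). split; [exact: Hin|exact/GE].
  - move=> x y x' y' z /GE [Hx [Hy ->]] /GE [Hx' [Hy' E]]. exact: Hinj.
  - by move=> x y z z' /GE [_ [_ ->]] /GE [_ [_ ->]].
  - move=> c Hc.
    have HD : D2 (coded_relation G c) by unfold coded_relation, coded_by; definable.
    case: (mostowski_collapse m (coded_relation G c)) => // h [Hh HhE].
    have Hmaps : forall x v, maps h x v <-> x ∈ m /\ v = app h x.
    { move=> x v. split.
      - move=> H. have Hx := function_on_dom _ _ _ _ Hh H. split=> //.
        by apply/(function_on_maps h m).
      - move=> [Hx ->]. by apply/(function_on_maps h m). }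
    exists h. split; [|split; [|split]].
    + move=> x Hx. exists (app h x). exact/Hmaps.
    + by move=> x v v' /Hmaps [_ ->] /Hmaps [_ ->].
    + move=> x v Hx /Hmaps [_ ->] z. rewrite HhE // imgE; last by definable.
      split=> [] [y].
      * rewrite sepE; last by definable. move=> [[Hy Hyx] E]. exists y. split=> //. split=> //. exact/Hmaps.
      * move=> [Hy [Hyx /Hmaps [_ E]]]. exists y. rewrite sepE //. definable.
    + move=> s. exists (img (inter s m) (app h)) => y. rewrite imgE; last by definable.
      split=> [] [x].
      * move=> [/interE [Hx Hxm] E]. exists x. split=> //. exact/Hmaps.
      * move=> [Hx /Hmaps [Hxm E]]. exists x. split=> //. exact/interE.
Qed.

End Coding.

(** * The ultrapower *)

Section Ultrapower.
Context {V : zfc_model}.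
Implicit Types (a b c f g h i j k l m n p q r s u v w x y z A S T : V).
Implicit Types (P Q : V -> Prop) (F G : V -> V).

(** Here [d] is the measurable cardinal; [dp] will be its successor. *)
Variables (d U : V).
Hypotheses (Hd : measurable_cardinal d) (HU : normal_ultrafilter d U).

Lemma d_cardinal : cardinal d.
Proof. by case: Hd => [] []. Qed.

Lemma d_ordinal : ordinal d.
Proof. exact: cardinal_ordinal d_cardinal. Qed.

Lemma omega_in_d : exists w, is_omega w /\ w ∈ d.
Proof. by case: Hd => [] []. Qed.

(** ** The quantifier for almost all elements *)

(** Quantifying over measure one sets, instead of asking that the set of all
    good points be in [U], makes sense without definability of [P]. *)
Definition ae P : Prop := exists X, X ∈ U /\ forall x, x ∈ X -> P x.

Lemma U_subset X : X ∈ U -> X ⊆ d.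
Proof. case: HU => [] [H _] _. exact: H. Qed.

Lemma ae_all P : (forall x, x ∈ d -> P x) -> ae P.
Proof. move=> H. exists d. split=> //. by case: HU => [] [_ []]. Qed.

Lemma ae_mono P Q : ae P -> (forall x, x ∈ d -> P x -> Q x) -> ae Q.
Proof.
  move=> [X [HX HP]] H. exists X; split=> // x Hx. apply: H; last exact: HP.
  exact: (U_subset X).
Qed.

Lemma ae_and P Q : ae P -> ae Q -> ae (fun x => P x /\ Q x).
Proof.
  move=> [X [HX HP]] [Y [HY HQ]]. exists (inter X Y). split.
  - case: HU => [] [_ [_ [_ [_ [H _]]]]] _. apply: (H X Y) => //. by rewrite is_interE.
  - move=> x /interE [H1 H2]. split; [exact: HP|exact: HQ].
Qed.

Lemma ae_mono2 P Q R : ae P -> ae Q -> (forall x, x ∈ d -> P x -> Q x -> R x) -> ae R.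
Proof.
  move=> HP HQ H. apply: (ae_mono _ _ (ae_and _ _ HP HQ)) => x Hx []. exact: H.
Qed.

Lemma ae_ex P : ae P -> exists x, x ∈ d /\ P x.
Proof.
  move=> [X [HX HP]]. have [x Hx] : nonempty X by case: HU => [] [_ [_ [H _]]] _; exact: H.
  exists x. split; [exact: (U_subset X)|exact: HP].
Qed.

Lemma ae_sep P : D1 P -> (ae P <-> sep d P ∈ U).
Proof.
  move=> HP. split.
  - move=> [X [HX H]]. case: HU => [] [_ [_ [_ [Hup _]]]] _. apply: (Hup X) => //.
    + move=> x Hx. rewrite sepE //. split; [exact: (U_subset X)|exact: H].
    + by move=> x; rewrite sepE // => [] [].
  - move=> H. exists (sep d P); split=> // x. by rewrite sepE // => [] [].
Qed.

Lemma ae_not P : D1 P -> (ae (fun x => ~ P x) <-> ~ ae P).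
Proof.
  move=> HP. split.
  - move=> H1 H2. case: (ae_ex _ (ae_and _ _ H1 H2)) => x [_ []] //.
  - move=> H. case: HU => [] [_ [_ [_ [_ [_ Hult]]]]] _.
    case: (Hult (sep d P) (sep d (fun x => ~ P x))).
    + by move=> x; rewrite sepE // => [] [].
    + move=> x. rewrite !sepE //; last by definable. tauto.
    + by rewrite -ae_sep.
    + rewrite -ae_sep //. definable.
Qed.

Lemma ae_or P Q : D1 P -> ae (fun x => P x \/ Q x) -> ae P \/ ae Q.
Proof.
  move=> HP H. case: (classic (ae P)) => HnP; first by left. right.
  rewrite -ae_not // in HnP. apply: (ae_mono2 _ _ _ H HnP) => x _ []; tauto.
Qed.

Lemma ae_complete c (P : V -> V -> Prop) : D2 P -> c ∈ d -> (forall i, i ∈ c -> ae (P i)) ->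
  ae (fun x => forall i, i ∈ c -> P i x).
Proof.
  move=> HP Hc H. case: HU => _ [_ [Hcomp _]].
  have HF : T1 (fun i => sep d (P i)) by definable.
  have HP' : forall i, D1 (P i) by move=> i; definable.
  rewrite ae_sep; last by definable.
  apply: (Hcomp c (lam c (fun i => sep d (P i)))) => //.
  - apply: lam_function => // i Hi. rewrite -ae_sep //. exact: H.
  - move=> x. rewrite sepE; last by definable. split.
    + move=> [Hx Hall]. split=> // i Y Hi. rewrite lam_maps // => [] [_ ->].
      rewrite sepE //. split=> //. exact: Hall.
    + move=> [Hx Hall]. split=> // i Hi.
      have := Hall i (sep d (P i)) Hi. rewrite lam_maps // sepE //. tauto.
Qed.

Lemma ae_diagonal (P : V -> V -> Prop) : D2 P -> (forall i, i ∈ d -> ae (P i)) ->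
  ae (fun x => forall i, i ∈ x -> P i x).
Proof.
  move=> HP H. case: HU => _ [_ [_ Hdiag]].
  have HF : T1 (fun i => sep d (P i)) by definable.
  have HP' : forall i, D1 (P i) by move=> i; definable.
  rewrite ae_sep; last by definable.
  apply: (Hdiag (lam d (fun i => sep d (P i)))) => //.
  - apply: lam_function => // i Hi. rewrite -ae_sep //. exact: H.
  - move=> x. rewrite sepE; last by definable. split.
    + move=> [Hx Hall]. split=> // i Y Hi. rewrite lam_maps // => [] [_ ->].
      rewrite sepE //. split=> //. exact: Hall.
    + move=> [Hx Hall]. split=> // i Hi.
      have Hid : i ∈ d := ordinal_trans _ _ _ d_ordinal Hx Hi.
      have := Hall i (sep d (P i)) Hi. rewrite lam_maps // sepE //. tauto.
Qed.

Lemma ae_neq i : i ∈ d -> ae (fun x => x <> i).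
Proof.
  move=> Hi. rewrite ae_not; last by definable. rewrite ae_sep; last by definable.
  case: HU => _ [Hnp _]. apply: (Hnp i) => // x. rewrite sepE; last by definable.
  split; first tauto. move=> [] ->; tauto.
Qed.

(** The complement of [succ i] in [d] is an intersection of fewer than [d] sets
    that omit one point each. *)
Lemma ae_gt i : i ∈ d -> ae (fun x => i ∈ x).
Proof.
  move=> Hi.
  have H1 : ae (fun x => forall k, k ∈ i -> x <> k).
  { apply: (ae_complete i (fun k x => x <> k)) => //; first by definable.
    move=> k Hk. apply: ae_neq. exact: (ordinal_trans _ i _ d_ordinal). }
  apply: (ae_mono2 _ _ _ H1 (ae_neq i Hi)) => x Hx Hk Hne.
  case: (ordinal_total _ _ _ d_ordinal Hi Hx) => [//|[E|H]]; first by case: Hne.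
  by case: (Hk x H).
Qed.

(** If [F] were almost constant with no value [i], then by closure under
    diagonal intersections [F x] would almost always differ from all elements
    of [x]. *)
Lemma ae_regressive F : T1 F -> ae (fun x => F x ∈ x) -> exists i, i ∈ d /\ ae (fun x => F x = i).
Proof.
  move=> HF H. apply: NNPP => Hn.
  have H' : ae (fun x => forall i, i ∈ x -> F x <> i).
  { apply: (ae_diagonal (fun i x => F x <> i)); first by definable.
    move=> i Hi. rewrite ae_not; last by definable. move=> Hae. apply: Hn. by exists i. }
  case: (ae_ex _ (ae_and _ _ H H')) => x [_ [H1 H2]]. by case: (H2 _ H1).
Qed.

(** ** The transitive collapse *)

Definition ae_equal f g : Prop := ae (fun x => app f x = app g x).
Definition ae_member f g : Prop := ae (fun x => app f x ∈ app g x).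

Lemma D2_ae_equal : D2 ae_equal. Proof. unfold ae_equal, ae. definable. Qed.
Lemma D2_ae_member : D2 ae_member. Proof. unfold ae_member, ae. definable. Qed.
Hint Resolve D2_ae_equal D2_ae_member : definability.

Lemma ultra_rel_ae (R : V -> V -> Prop) f g : D2 R -> function_on f d -> function_on g d ->
  (ultra_rel d U R f g <-> ae (fun x => R (app f x) (app g x))).
Proof.
  move=> HR Hf Hg.
  have H : forall x, (x ∈ d /\ exists y z, maps f x y /\ maps g x z /\ R y z) <->
     (x ∈ d /\ R (app f x) (app g x)).
  { move=> x. split=> [] [Hx].
    - move=> [y [z [Hy [Hz HRyz]]]]. split=> //.
      move: Hy Hz. rewrite (function_on_maps f d) // (function_on_maps g d) // => <- <- //.
    - move=> HRx. split=> //. exists (app f x), (app g x).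
      by rewrite (function_on_maps f d) // (function_on_maps g d). }
  have HD : D1 (fun x => R (app f x) (app g x)) by definable.
  rewrite ae_sep //. split.
  - move=> [X [HX HXE]].
    have <- // : X = sep d (fun x => R (app f x) (app g x)).
    apply: set_ext => x. by rewrite HXE H sepE.
  - move=> HX. exists (sep d (fun x => R (app f x) (app g x))). split=> // x.
    by rewrite sepE // H.
Qed.

(** A descending sequence of functions would descend at almost every point,
    since [U] is closed under countable intersections. *)
Lemma ae_member_well_founded A : well_founded_on A ae_member.
Proof.
  move=> s _ [f0 Hf0]. apply: NNPP => Hn.
  case: omega_in_d => w [Hw Hwd].
  case: (dependent_choice w s ae_member f0) => //; first by definable.
  { move=> f Hf. apply: NNPP => H. apply: Hn. exists f; split=> // g Hg Hgf.
    apply: H. by exists g. }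
  move=> g Hg.
  have : ae (fun x => forall n, n ∈ w -> app (app g (succ n)) x ∈ app (app g n) x).
  { apply: (ae_complete w (fun n x => app (app g (succ n)) x ∈ app (app g n) x)) => //;
      first by definable.
    move=> n Hn'. by case: (Hg n Hn'). }
  move=> /ae_ex [x [_ H]].
  case: (foundation_set (img w (fun n => app (app g n) x)) (fun _ => True)); first by definable.
  { exists (app (app g empty) x). split=> //. apply: (img_mem w (fun n => app (app g n) x)).
    - definable.
    - exact: omega_empty. }
  move=> y []. rewrite imgE; last by definable. move=> [n [Hn' ->]] [_ Hmin].
  apply: (Hmin (app (app g (succ n)) x)) => //; last exact: H.
  apply: (img_mem w (fun n => app (app g n) x)); first by definable. exact: omega_succ.
Qed.

Definition funs T : V := setof (fun f => function f d T).

Lemma T1_funs : T1 funs. Proof. unfold funs. definable. Qed.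
Hint Resolve T1_funs : definability.

Lemma funsE T f : f ∈ funs T <-> function f d T.
Proof.
  apply: setofE. apply: (sep_is_set _ (power (prod d T))); first by definable.
  move=> g [Hg HT]. rewrite powerE => p Hp.
  case: (proj1 Hg p Hp) => x [y [Hx Hpxy]]. apply/prodE. exists x, y.
  rewrite -is_pairE. split=> //; split=> //. apply: (HT x). by exists p.
Qed.

(** The ultrapower is a proper class of functions, but it is exhausted by its
    parts with values in a transitive set [T].  Each part is collapsed
    separately; the collapses agree because members of [f] can be represented
    with values in the same transitive set as [f]. *)
Definition is_collapse T k : Prop :=
  forall f, f ∈ funs T -> app k f = img (sep (funs T) (fun g => ae_member g f)) (app k).

Lemma collapse_exists T : exists k, is_collapse T k.
Proof.
  case: (mostowski_collapse (funs T) ae_member); [by definable|exact: ae_member_well_founded|].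
  move=> k [_ H]. by exists k.
Qed.

Lemma collapseE T k f z : is_collapse T k -> f ∈ funs T ->
  (z ∈ app k f <-> exists g, g ∈ funs T /\ ae_member g f /\ z = app k g).
Proof.
  move=> Hk Hf. rewrite Hk // imgE; last by definable.
  split=> [] [g].
  - rewrite sepE; last by definable. move=> [[Hg Hgf] E]. by exists g.
  - move=> [Hg [Hgf E]]. exists g. rewrite sepE //. definable.
Qed.

Lemma collapse_ae_equal T k f g : is_collapse T k -> f ∈ funs T -> g ∈ funs T -> ae_equal f g ->
  app k f = app k g.
Proof.
  move=> Hk Hf Hg Hfg. apply: set_ext => z. rewrite !(collapseE T) //.
  split=> [] [h [Hh [Hm E]]]; exists h; split=> //; split=> //.
  - apply: (ae_mono2 _ _ _ Hm Hfg) => x _ H1 H2. by rewrite -H2.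
  - apply: (ae_mono2 _ _ _ Hm Hfg) => x _ H1 H2. by rewrite H2.
Qed.

(** The given function [f] provides values at the exceptional points. *)
Lemma funs_witness T f (R : V -> V -> Prop) : D2 R -> f ∈ funs T ->
  ae (fun x => exists z, z ∈ T /\ R x z) -> exists h, h ∈ funs T /\ ae (fun x => R x (app h x)).
Proof.
  move=> HR /funsE Hf H.
  case: (choice_function d (fun x z => z ∈ T /\ ((exists z, z ∈ T /\ R x z) -> R x z)));
    first by definable.
  { move=> x Hx. case: (classic (exists z, z ∈ T /\ R x z)) => [[z [Hz HRz]]|Hn].
    - by exists z.
    - exists (app f x). split=> //. exact: (function_app _ d). }
  move=> h [Hhd Hh]. exists h. split.
  - apply/funsE/functionE. split=> // x Hx. by case: (Hh x Hx).
  - apply: (ae_mono _ _ H) => x Hx Hex. by case: (Hh x Hx) => _; apply.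
Qed.

(** If [f] and [g] differ almost everywhere, some [h] is almost everywhere in
    one and not in the other; the collapse of [h] is then also the collapse of a
    member of the other one, and the induction hypothesis identifies the two. *)
Lemma collapse_inj T k f g : transitive_set T -> is_collapse T k ->
  f ∈ funs T -> g ∈ funs T -> app k f = app k g -> ae_equal f g.
Proof.
  move=> HT Hk Hf. move: f Hf g.
  have diff : forall f g, f ∈ funs T -> ae (fun x => exists z, z ∈ app f x /\ ~ z ∈ app g x) ->
     exists h, h ∈ funs T /\ ae_member h f /\ ~ ae_member h g.
  { move=> f g Hf H.
    case: (funs_witness T f (fun x z => z ∈ app f x /\ ~ z ∈ app g x)) => //; first by definable.
    - apply: (ae_mono _ _ H) => x Hx [z [Hz1 Hz2]]. exists z. split=> //.
      apply: (HT (app f x)) => //. apply: (function_app _ d) => //. exact/funsE.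
    - move=> h [Hh Hae]. exists h; split=> //. split.
      + by apply: (ae_mono _ _ Hae) => x _ [].
      + move=> Hm. case: (ae_ex _ (ae_and _ _ Hae Hm)) => x [_ [[_ H1] H2]]. by case: H1. }
  apply: (well_founded_induct (funs T) ae_member
    (fun f => forall g, g ∈ funs T -> app k f = app k g -> ae_equal f g));
    [exact: ae_member_well_founded|by definable|].
  move=> f Hf IH g Hg E. apply: NNPP => Hne.
  have : ae (fun x => (exists z, z ∈ app f x /\ ~ z ∈ app g x) \/
                      (exists z, z ∈ app g x /\ ~ z ∈ app f x)).
  { rewrite -ae_not in Hne; last by definable. apply: (ae_mono _ _ Hne) => x _ Hx.
    apply: NNPP => Hn. apply: Hx. apply: set_ext => z.
    split=> Hz; apply: NNPP => Hz'; apply: Hn; [left|right]; by exists z. }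
  move/ae_or => []; first by definable.
  - move=> /(diff f g Hf) [h [Hh [Hhf Hhg]]]. apply: Hhg.
    have : app k h ∈ app k g by rewrite -E; apply/(collapseE T) => //; exists h.
    move=> /(collapseE T) => /(_ Hk Hg) [h' [Hh' [Hm E']]].
    apply: (ae_mono2 _ _ _ (IH h Hh Hhf h' Hh' E') Hm) => x _ -> //.
  - move=> /(diff g f Hg) [h [Hh [Hhg Hhf]]]. apply: Hhf.
    have : app k h ∈ app k f by rewrite E; apply/(collapseE T) => //; exists h.
    move=> /(collapseE T) => /(_ Hk Hf) [h' [Hh' [Hm E']]].
    apply: (ae_mono2 _ _ _ (IH h' Hh' Hm h Hh (eq_sym E')) Hm) => x _ <- //.
Qed.

Lemma collapse_ae_member T k f g : transitive_set T -> is_collapse T k ->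
  f ∈ funs T -> g ∈ funs T -> (app k f ∈ app k g <-> ae_member f g).
Proof.
  move=> HT Hk Hf Hg. rewrite (collapseE T) //. split.
  - move=> [h [Hh [Hm E]]].
    apply: (ae_mono2 _ _ _ (collapse_inj T k f h HT Hk Hf Hh E) Hm) => x _ -> //.
  - move=> H. by exists f.
Qed.

Lemma collapse_mono T k T' k' f : transitive_set T -> T ⊆ T' ->
  is_collapse T k -> is_collapse T' k' -> f ∈ funs T -> app k f = app k' f.
Proof.
  move=> HT HTT Hk Hk'.
  have Hsub : forall f, f ∈ funs T -> f ∈ funs T'.
  { move=> g /funsE [Hg1 Hg2]. apply/funsE. split=> // x y Hxy. apply: HTT. exact: (Hg2 x). }
  move: f.
  apply: (well_founded_induct (funs T) ae_member (fun f => app k f = app k' f));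
    [exact: ae_member_well_founded|by definable|].
  move=> f Hf IH. apply: set_ext => z. rewrite (collapseE T) // (collapseE T' k') //; last exact: Hsub.
  split=> [] [g [Hg [Hm ->]]].
  - exists g. split; first exact: Hsub. split=> //. exact: IH.
  - (* a member of [f] may be changed on a null set so as to take values in [T] *)
    case: (funs_witness T f (fun x z => z = app g x)) => //; first by definable.
    { apply: (ae_mono _ _ Hm) => x Hx Hgx. exists (app g x). split=> //.
      apply: (HT (app f x)) => //. apply: (function_app _ d) => //. exact/funsE. }
    move=> h [Hh Hae]. exists h. split=> //.
    have Hhm : ae_member h f.
    { apply: (ae_mono2 _ _ _ Hae Hm) => x _ -> //. }
    split=> //. rewrite (IH h Hh Hhm). apply: (collapse_ae_equal T') => //; first exact: Hsub.
    apply: (ae_mono _ _ Hae) => x _ -> //.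
Qed.

Definition collapses_to f x : Prop :=
  exists T k, transitive_set T /\ is_collapse T k /\ f ∈ funs T /\ x = app k f.

Lemma D2_collapses_to : D2 collapses_to.
Proof. unfold collapses_to, transitive_set, is_collapse. definable. Qed.
Hint Resolve D2_collapses_to : definability.

Lemma union_transitive S T : transitive_set S -> transitive_set T -> transitive_set (union S T).
Proof.
  move=> HS HT x. rewrite unionE => [] [] Hx y Hy; rewrite unionE;
    [left; exact: (HS x)|right; exact: (HT x)].
Qed.

Lemma collapses_to_common f g x y : collapses_to f x -> collapses_to g y -> exists T k,
  transitive_set T /\ is_collapse T k /\ f ∈ funs T /\ g ∈ funs T /\ x = app k f /\ y = app k g.
Proof.
  move=> [T [k [HT [Hk [Hf ->]]]]] [T' [k' [HT' [Hk' [Hg ->]]]]].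
  case: (collapse_exists (union T T')) => l Hl.
  have HTT : T ⊆ union T T' by move=> z; rewrite unionE; left.
  have HTT' : T' ⊆ union T T' by move=> z; rewrite unionE; right.
  have Hsub : forall S h, S ⊆ union T T' -> h ∈ funs S -> h ∈ funs (union T T').
  { move=> S h HS /funsE [H1 H2]. apply/funsE. split=> // u v Huv. apply: HS. exact: (H2 u). }
  exists (union T T'), l. split; first exact: union_transitive. split=> //.
  split; first exact: (Hsub T). split; first exact: (Hsub T').
  split; [exact: (collapse_mono T _ (union T T'))|exact: (collapse_mono T' _ (union T T'))].
Qed.

Lemma collapses_to_exists f : function_on f d -> exists x, collapses_to f x.
Proof.
  move=> Hf. case: (transitive_closure (img d (app f))) => T [HT Hsub].
  case: (collapse_exists T) => k Hk. exists (app k f), T, k. split=> //; split=> //; split=> //.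
  apply/funsE/functionE. split=> // x Hx. apply: Hsub. apply: img_mem => //. definable.
Qed.

Theorem collapses_to_is_collapse : is_ultrapower_collapse d U collapses_to.
Proof.
  have Hdom : forall f x, collapses_to f x -> function_on f d.
  { by move=> f x [T [k [_ [_ [/funsE [Hf _] _]]]]]. }
  split; [|split; [|split; [|split; [|split]]]] => //.
  - apply: (D2_class_relation d). exact: D2_collapses_to.
  - move=> f Hf. case: (collapses_to_exists f Hf) => x Hx. exists x; split=> // y Hy.
    case: (collapses_to_common _ _ _ _ Hx Hy) => T [k [_ [_ [_ [_ [-> ->]]]]]] //.
  - move=> f g x y Hx Hy. rewrite (ultra_rel_ae _ _ _ D2_eq (Hdom f x Hx) (Hdom g y Hy)).
    case: (collapses_to_common _ _ _ _ Hx Hy) => T [k [HT [Hk [Hf [Hg [-> ->]]]]]].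
    split; [exact: (collapse_inj T)|exact: (collapse_ae_equal T)].
  - move=> f g x y Hx Hy. rewrite (ultra_rel_ae _ _ _ D2_mem (Hdom f x Hx) (Hdom g y Hy)).
    case: (collapses_to_common _ _ _ _ Hx Hy) => T [k [HT [Hk [Hf [Hg [-> ->]]]]]].
    exact: (collapse_ae_member T).
  - move=> f x y [T [k [HT [Hk [Hf ->]]]]] /(collapseE T) => /(_ Hk Hf) [g [Hg [_ ->]]].
    exists g, T, k. done.
Qed.

(** Induction on membership: the members of a collapsed function are the
    collapses of its members.  The induction predicate is definable because both
    collapses are classes. *)
Theorem ultrapower_collapse_unique (C C' : V -> V -> Prop) f x y :
  is_ultrapower_collapse d U C -> is_ultrapower_collapse d U C' -> C f x -> C' f y -> x = y.
Proof.
  move=> [HC [Hdom [Hex [_ [Hmem Htr]]]]] [HC' [Hdom' [Hex' [_ [Hmem' Htr']]]]].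
  apply class_relation_D2 in HC. apply class_relation_D2 in HC'.
  move: x f y.
  apply: (mem_induction (fun x => forall f y, C f x -> C' f y -> x = y)); first by definable.
  move=> x IH f y Hx Hy. apply: set_ext => z. split=> Hz.
  - case: (Htr f x z Hx Hz) => g Hg. case: (Hex' g); first exact: (Hdom _ z).
    move=> v [Hv _]. rewrite (IH z Hz g v Hg Hv).
    apply/(Hmem' g f v y) => //. by apply/(Hmem g f z x).
  - case: (Htr' f y z Hy Hz) => g Hg. case: (Hex g); first exact: (Hdom' _ z).
    move=> v [Hv _].
    have Hvx : v ∈ x. { apply/(Hmem g f v x) => //. by apply/(Hmem' g f z y). }
    by rewrite -(IH v Hvx g z Hv Hg).
Qed.

(** ** Elements of the ultrapower represented by class functions *)

Definition ul F : V := the (fun x => collapses_to (lam d F) x).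

Lemma ul_spec F : T1 F -> collapses_to (lam d F) (ul F).
Proof.
  move=> HF. apply: (the_spec (fun x => collapses_to (lam d F) x)).
  case: collapses_to_is_collapse => _ [_ [H _]]. apply: H. exact: lam_function_on.
Qed.

Lemma collapses_to_ul f x : collapses_to f x -> function_on f d /\ x = ul (app f).
Proof.
  move=> H. case: collapses_to_is_collapse => _ [Hdom [Hex _]].
  have Hf := Hdom f x H. split=> //.
  have Hs : collapses_to f (ul (app f)).
  { rewrite {1}(function_eta f d Hf). apply: ul_spec. definable. }
  case: (Hex f Hf) => y [_ Hu]. by rewrite -(Hu x H) -(Hu _ Hs).
Qed.

Local Notation M := (@Ult V d U).

Lemma UltE x : M x <-> exists f, function_on f d /\ x = ul (app f).
Proof.
  split.
  - move=> [C [HC [f Hf]]].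
    have Hfd : function_on f d by case: HC => _ [H _]; exact: (H f x).
    exists f; split=> //. case: (collapses_to_exists f Hfd) => y Hy.
    rewrite (ultrapower_collapse_unique C collapses_to f x y HC collapses_to_is_collapse Hf Hy).
    by case: (collapses_to_ul f y Hy).
  - move=> [f [Hf ->]]. exists collapses_to. split; first exact: collapses_to_is_collapse.
    exists (lam d (app f)). apply: ul_spec. definable.
Qed.

Lemma ul_in F : T1 F -> M (ul F).
Proof.
  move=> HF. exists collapses_to. split; first exact: collapses_to_is_collapse.
  exists (lam d F). exact: ul_spec.
Qed.

Lemma ae_lam (R : V -> V -> Prop) F G : T1 F -> T1 G ->
  (ae (fun x => R (app (lam d F) x) (app (lam d G) x)) <-> ae (fun x => R (F x) (G x))).
Proof.
  move=> HF HG. split=> H; apply: (ae_mono _ _ H) => x Hx; by rewrite !lam_app.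
Qed.

Lemma ul_eq F G : T1 F -> T1 G -> (ul F = ul G <-> ae (fun x => F x = G x)).
Proof.
  move=> HF HG. case: collapses_to_is_collapse => _ [_ [_ [H _]]].
  rewrite (H _ _ _ _ (ul_spec F HF) (ul_spec G HG)).
  rewrite ultra_rel_ae; try exact: lam_function_on; last exact: D2_eq.
  exact: (ae_lam eq).
Qed.

Lemma ul_mem F G : T1 F -> T1 G -> (ul F ∈ ul G <-> ae (fun x => F x ∈ G x)).
Proof.
  move=> HF HG. case: collapses_to_is_collapse => _ [_ [_ [_ [H _]]]].
  rewrite (H _ _ _ _ (ul_spec F HF) (ul_spec G HG)).
  rewrite ultra_rel_ae; try exact: lam_function_on; last exact: D2_mem.
  exact: (ae_lam mem).
Qed.

Lemma T1_app f : T1 (app f).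
Proof. definable. Qed.
Hint Resolve T1_app : definability.

Lemma Ult_transitive x y : M x -> y ∈ x -> M y.
Proof.
  move=> /UltE [f [Hf ->]] Hy. case: collapses_to_is_collapse => _ [_ [_ [_ [_ H]]]].
  case: (H _ _ y (ul_spec (app f) (T1_app f)) Hy) => g Hg.
  case: (collapses_to_ul g y Hg) => Hgd ->. apply: ul_in. exact: T1_app.
Qed.

Lemma ul_elem F y : T1 F -> y ∈ ul F ->
  exists g, function_on g d /\ y = ul (app g) /\ ae (fun x => app g x ∈ F x).
Proof.
  move=> HF Hy. have : M y := Ult_transitive _ _ (ul_in F HF) Hy.
  move=> /UltE [g [Hg E]]. exists g; split=> //; split=> //.
  rewrite E in Hy. move: Hy. rewrite ul_mem //. exact: T1_app.
Qed.

Lemma ul_ordinal F : T1 F -> ae (fun x => ordinal (F x)) -> ordinal (ul F).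
Proof.
  move=> HF Ho. apply: ordinalI.
  - move=> y /(ul_elem F) => /(_ HF) [g [_ [-> Hg]]] z /(ul_elem _ _ (T1_app g)) [h [_ [-> Hh]]].
    apply/ul_mem; [exact: T1_app|exact: HF|].
    apply: (ae_mono2 _ _ _ Ho (ae_and _ _ Hg Hh)) => x _ Hx [H1 H2].
    exact: (ordinal_trans _ (app g x)).
  - move=> y z /(ul_elem F) => /(_ HF) [g [_ [-> Hg]]] /(ul_elem F) => /(_ HF) [h [_ [-> Hh]]].
    rewrite !ul_mem ?ul_eq; try exact: T1_app.
    have : ae (fun x => app g x ∈ app h x \/ (app g x = app h x \/ app h x ∈ app g x)).
    { apply: (ae_mono2 _ _ _ Ho (ae_and _ _ Hg Hh)) => x _ Hx [H1 H2].
      exact: (ordinal_total (F x)). }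
    move=> /ae_or [|H|/ae_or [|H|H]]; try (by definable); tauto.
Qed.

(** The canonical embedding, usually written [j]. *)
Definition emb x : V := ul (fun _ => x).

Lemma T1_const x : T1 (fun _ => x).
Proof. exact: dt_const. Qed.
Hint Resolve T1_const : definability.

Lemma embE x y : ultrapower_embedding d U x y -> y = emb x.
Proof.
  move=> [C [HC [f [[Hf Hc] HCf]]]].
  have E : f = lam d (fun _ => x).
  { apply: (function_on_ext _ _ d) => //.
    - apply: lam_function_on. exact: T1_const.
    - move=> z Hz. rewrite lam_app //; last exact: T1_const.
      apply: (Hc z). by rewrite (function_on_maps f d). }
  subst f.
  exact: (ultrapower_collapse_unique C collapses_to _ _ _ HC collapses_to_is_collapse HCf (ul_spec _ (T1_const x))).
Qed.

Lemma T1_emb : T1 emb.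
Proof. unfold emb, ul. definable. Qed.
Hint Resolve T1_emb : definability.

Lemma emb_mem x y : x ∈ y -> emb x ∈ emb y.
Proof. move=> H. apply/ul_mem; try exact: T1_const. exact: ae_all. Qed.

Lemma emb_ordinal a : ordinal a -> ordinal (emb a).
Proof. move=> Ha. apply: ul_ordinal; first exact: T1_const. exact: ae_all. Qed.

(** If [a] is least with [emb a] below [a], then [emb a] is a smaller ordinal
    with this property. *)
Lemma emb_ge a : ordinal a -> ord_le a (emb a).
Proof.
  apply: (ordinal_ind (fun a => ord_le a (emb a))); first by definable.
  move=> {}a Ha IH. case: (ord_lt_or_ge (emb a) a (emb_ordinal a Ha) Ha) => // H.
  case: (ord_le_not_gt (emb a) (emb (emb a))); last exact: emb_mem.
  - apply: emb_ordinal. exact: (ordinal_elem a).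
  - exact: IH.
Qed.

Lemma Ult_ordinal a : ordinal a -> M a.
Proof.
  move=> Ha. have HM : M (emb a) by apply: ul_in; exact: T1_const.
  case: (emb_ge a Ha) => [H|-> //]. exact: (Ult_transitive (emb a)).
Qed.

(** ** The theorem of Los *)

Lemma def_sat (p : formula) : forall t : nat -> (nat -> V) -> V, (forall n : nat, definable_term (t n)) ->
  definable_prop (fun e => sat (fun n : nat => t n e) p).
Proof.
  elim: p => [i j|i j|p IH|p IHp q IHq|p IH] t Ht /=.
  - have Hi := Ht i. have Hj := Ht j. apply: (def_rel2 _ _ _ D2_mem Hi Hj).
  - have Hi := Ht i. have Hj := Ht j. apply: (def_rel2 _ _ _ D2_eq Hi Hj).
  - apply: def_not. exact: IH.
  - apply: def_and; [exact: IHp|exact: IHq].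
  - apply: (def_all (fun z e => sat (scons z (fun n : nat => t n e)) p)).
    apply: (def_ext (fun e => sat (fun n : nat => match n with 0 => e 0 | S m => t m (fun k : nat => e (S k)) end) p)).
    + move=> e. apply: sat_ext. by case.
    + apply: (IH (fun (n : nat) e => match n with 0 => e 0 | S m => t m (fun k : nat => e (S k)) end)).
      case=> [|m]; first exact: dt_var. exact: (dt_rename _ S (Ht m)).
Qed.

(** For a universal quantifier, counterexamples at almost all points are
    collected and chosen into a function, which represents a counterexample in
    the ultrapower. *)
Theorem Los (p : formula) : forall (E : nat -> class_structure M) (F : nat -> V -> V),
  (forall n : nat, T1 (F n)) -> (forall n : nat, proj1_sig (E n) = ul (F n)) ->
  (sat E p <-> ae (fun x => sat (fun n : nat => F n x) p)).
Proof.
  elim: p => [i j|i j|p IH|p IHp q IHq|p IH] E F HF HE /=.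
  - rewrite !HE. exact: ul_mem.
  - rewrite -ul_eq // -!HE. split; first by move=> ->.
    move: (E i) (E j) => [x Hx] [y Hy] /= Exy. subst y. f_equal. exact: proof_irrelevance.
  - rewrite (IH E F) // ae_not //.
    apply: (def_sat p (fun (n : nat) e => F n (e 0))) => n. exact: HF.
  - rewrite (IHp E F) // (IHq E F) //. split; first by move=> [] ? ?; exact: ae_and.
    move=> H. split; apply: (ae_mono _ _ H); by move=> x _ [].
  - pose (F' := fun h (n : nat) => match n with 0 => app h | S m => F m end).
    have HF' : forall h (n : nat), T1 (F' h n) by move=> h [|n]; [exact: T1_app|exact: HF].
    have Hsat : forall h x, sat (fun n : nat => F' h n x) p <-> sat (scons (app h x) (fun n : nat => F n x)) p.
    { move=> h x. apply: sat_ext. by case. }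
    have HE' : forall h H (n : nat), proj1_sig (scons (exist M (ul (app h)) H : class_structure M) E n) = ul (F' h n).
    { move=> h H [|n] //=. }
    pose (R := fun x z => sat (scons z (fun n : nat => F n x)) p).
    have HR : D2 R.
    { apply: (def_ext (fun e => sat (fun n : nat => match n with 0 => e 1 | S m => F m (e 0) end) p)).
      - move=> e. apply: sat_ext. by case.
      - apply: (def_sat p (fun (n : nat) e => match n with 0 => e 1 | S m => F m (e 0) end)).
        case=> [|m]; [exact: dt_var|exact: (dt_op1 _ _ (HF m) (dt_var 0))]. }
    change ((forall z : class_structure M, sat (scons z E) p) <-> ae (fun x => forall z, R x z)).
    split.
    + move=> H. apply: NNPP => Hn.
      rewrite -ae_not in Hn; last by definable.
      case: (choice_function d (fun x z => (exists z, ~ R x z) -> ~ R x z)); first by definable.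
      { move=> x _. case: (classic (exists z, ~ R x z)) => [[z Hz]|Hno].
        - by exists z.
        - by exists x. }
      move=> h [_ Hh].
      have := H (exist M (ul (app h)) (ul_in _ (T1_app h))).
      rewrite (IH _ (F' h)) // => Hae.
      case: (ae_ex _ (ae_and _ _ Hae Hn)) => x [Hx [H1 H2]]. rewrite Hsat in H1.
      apply: (Hh x Hx) => //. exact: not_all_ex_not.
    + move=> H [x Hx]. case: (proj1 (UltE x) Hx) => h [_ Eh]. subst x.
      rewrite (IH _ (F' h)) //. apply: (ae_mono _ _ H) => x _ Hx'. rewrite Hsat. exact: Hx'.
Qed.

(** ** Small subsets of the ultrapower *)

Lemma ae_regressive_witness (R : V -> V -> Prop) : D2 R ->
  ae (fun x => exists i, i ∈ x /\ R i x) -> exists i, i ∈ d /\ ae (R i).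
Proof.
  move=> HR H.
  pose (r := fun x => least (fun i => i ∈ x /\ R i x)).
  have Hr : T1 r by unfold r; definable.
  have rspec : ae (fun x => r x ∈ x /\ R (r x) x).
  { apply: (ae_mono _ _ H) => x Hx [i Hi].
    case: (least_spec (fun i => i ∈ x /\ R i x)); [by definable| |by move=> _ []].
    exists i; split=> //. apply: (ordinal_elem x); last by case: Hi.
    exact: (ordinal_elem _ _ d_ordinal). }
  case: (ae_regressive r Hr); first by apply: (ae_mono _ _ rspec) => x _ [].
  move=> i [Hi Hae]. exists i. split=> //.
  by apply: (ae_mono2 _ _ _ rspec Hae) => x _ [_ H1] <-.
Qed.

(** The representing function takes at [x] the values at [x] of the terms with
    index in [x].  A member of the set it represents has, at [x], the value of
    the term with index [r x] in [x], and [r] is almost constant by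
    normality. *)
Lemma small_subset_represented S : (forall y, y ∈ S -> M y) -> covers d S ->
  exists G, T1 G /\ S = ul G /\ forall x, x ∈ d -> covers x (G x).
Proof.
  move=> HSM [s Hs].
  case: (choice_function d (fun i k => app s i ∈ S -> app s i = ul (app k))).
  { unfold ul. definable. }
  { move=> i Hi. case: (classic (app s i ∈ S)) => H.
    - case: (proj1 (UltE _) (HSM _ H)) => k [_ Hk]. by exists k.
    - by exists i. }
  move=> K [_ HK].
  pose (G := fun x => img (sep x (fun i => app s i ∈ S)) (fun i => app (app K i) x)).
  have HG : T1 G by unfold G; definable.
  have GE : forall x z, z ∈ G x <-> exists i, i ∈ x /\ app s i ∈ S /\ z = app (app K i) x.
  { move=> x z. rewrite imgE; last by definable. split=> [] [i].
    - rewrite sepE; last by definable. move=> [[H1 H2] H3]. by exists i.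
    - move=> [H1 [H2 H3]]. exists i. rewrite sepE //. definable. }
  exists G. split=> //. split.
  - apply: set_ext => y. split.
    + move=> Hy. case: (Hs y Hy) => i [Hi E]. rewrite E in Hy *. rewrite (HK i Hi Hy).
      apply/ul_mem; [exact: T1_app|exact: HG|].
      apply: (ae_mono _ _ (ae_gt i Hi)) => x _ Hix. apply/GE. by exists i.
    + move=> /(ul_elem _ _ HG) [g [_ [-> Hg]]].
      case: (ae_regressive_witness (fun i x => app s i ∈ S /\ app g x = app (app K i) x)).
      * definable.
      * by apply: (ae_mono _ _ Hg) => x _ /GE.
      * move=> i [Hi Hae]. case: (ae_ex _ Hae) => _ [_ [Hsi _]].
        have -> // : ul (app g) = app s i.
        rewrite (HK i Hi Hsi). apply/ul_eq; try exact: T1_app.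
        by apply: (ae_mono _ _ Hae) => x _ [].
  - move=> x Hx. apply: (coversI _ _ (fun i => app (app K i) x)); first by definable.
    move=> z /GE [i [Hi [_ E]]]. by exists i.
Qed.

Lemma small_subset_in S : (forall y, y ∈ S -> M y) -> covers d S -> M S.
Proof.
  move=> H1 H2. case: (small_subset_represented S H1 H2) => G [HG [-> _]]. exact: ul_in.
Qed.

Lemma small_subset_ae G : T1 G -> covers d (ul G) -> ae (fun x => covers x (G x)).
Proof.
  move=> HG Hc. case: (small_subset_represented (ul G)) => //.
  { move=> y. apply: Ult_transitive. exact: ul_in. }
  move=> G' [HG' [E H]]. move: E. rewrite ul_eq // => E.
  apply: (ae_mono _ _ E) => x Hx ->. exact: H.
Qed.

(** ** Unbounded sets with small initial segments *)

Lemma limit_is_ordinal l : limit_ordinal l -> ordinal l.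
Proof. by case. Qed.

Lemma unbounded_fresh l A : limit_ordinal l -> unbounded_subset A l ->
  (forall b, b ∈ l -> M (inter A b)) -> ~ M A -> fresh_over M A.
Proof.
  move=> Hl [HAl Hun] Hseg HA. have Hlo := limit_is_ordinal _ Hl.
  split; first by move=> a /HAl; exact: (ordinal_elem l).
  split=> //. exists l. split.
  - split=> //. split; first by move=> a /HAl; left.
    move=> m Hm Hub. case: (ord_lt_or_ge m l) => // Hml.
    case: Hl => _ [_ Hlim]. case: (Hlim m Hml) => y [Hy Hmy].
    case: (Hun y Hy) => b [Hb Hyb].
    have Hbo : ordinal b by apply: (ordinal_elem l) => //; exact: HAl.
    by case: (ord_le_not_gt b m Hm (Hub b Hb)); apply: (ord_lt_le_trans m y).
  - move=> a Ha. exists (inter A a). split; first by rewrite is_interE. exact: Hseg.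
Qed.

Lemma small_segment_in l A b : ordinal l -> A ⊆ l -> covers d (inter A b) -> M (inter A b).
Proof.
  move=> Hl HA. apply: small_subset_in => y /interE [Hy _].
  apply: Ult_ordinal. apply: (ordinal_elem l) => //. exact: HA.
Qed.

(** By monotonicity, the elements of the image below [F i] have indices below
    [i], and [d] covers each [i] in its successor cardinal. *)
Lemma monotone_image_small dp l F : cardinal_successor d dp -> limit_ordinal l -> T1 F ->
  (forall i, i ∈ dp -> F i ∈ l) ->
  (forall i j, i ∈ dp -> j ∈ dp -> ord_le i j -> ord_le (F i) (F j)) ->
  (forall x, x ∈ l -> exists i, i ∈ dp /\ ord_le x (F i)) ->
  unbounded_subset (img dp F) l /\ forall b, b ∈ l -> covers d (inter (img dp F) b).
Proof.
  move=> Hdp Hl HF Hin Hmono Hcof. have Hlo := limit_is_ordinal _ Hl.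
  have Hdpo : ordinal dp by apply: cardinal_ordinal; case: Hdp.
  split; [split|].
  - move=> y. rewrite imgE // => [] [i [Hi ->]]. exact: Hin.
  - move=> a Ha. case: (Hcof a Ha) => i [Hi Hle]. exists (F i). split=> //. exact: img_mem.
  - move=> b Hb. case: (Hcof b Hb) => i [Hi Hle].
    apply: (covers_trans _ i); first exact: (below_successor d dp _ d_ordinal).
    apply: (coversI _ _ F) => // y /interE []. rewrite imgE // => [] [j [Hj ->]] Hjb.
    exists j. split=> //.
    case: (ord_lt_or_ge j i) => //; try exact: (ordinal_elem dp).
    move=> Hij. exfalso.
    have Hbo := ordinal_elem _ _ Hlo Hb.
    have Hfj := ordinal_elem _ _ Hlo (Hin j Hj).
    apply: (ord_le_not_gt b (F j)) => //.
    apply: (ord_le_trans _ (F i)) => //. exact: Hmono.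
Qed.

Lemma enumeration_cofinal l A t r : unbounded_subset A l ->
  (forall i, i ∈ t -> app r i ∈ A) -> (forall y, y ∈ A -> exists i, i ∈ t /\ y = app r i) ->
  exists f, cofinal_map f t l.
Proof.
  move=> [HA Hun] Hr Hon. exists (lam t (app r)).
  split; first by apply: lam_function; [exact: T1_app|move=> i Hi; apply: HA; exact: Hr].
  move=> a Ha. case: (Hun a Ha) => y [Hy Hle]. case: (Hon y Hy) => i [Hi E].
  exists i, y. split=> //. split=> //. rewrite lam_maps //. exact: T1_app.
Qed.

Lemma ul_inter F G : T1 F -> T1 G -> ul (fun x => inter (F x) (G x)) = inter (ul F) (ul G).
Proof.
  move=> HF HG. have HI : T1 (fun x => inter (F x) (G x)) by definable.
  apply: set_ext => y. rewrite interE. split.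
  - move=> /(ul_elem _ _ HI) [g [_ [-> Hg]]].
    rewrite !ul_mem //; try exact: T1_app.
    split; apply: (ae_mono _ _ Hg) => x _ /interE [] //.
  - move=> [/(ul_elem _ _ HF) [g [_ [-> Hg]]]]. rewrite !ul_mem //; try exact: T1_app.
    move=> Hg'. apply: (ae_mono2 _ _ _ Hg Hg') => x _ H1 H2. exact/interE.
Qed.

(** Values of a representing function may be cut down, which makes properties
    of the elements of [F x] available at every point. *)
Lemma represent_subset A F : T1 F -> M A -> A ⊆ ul F ->
  exists G, T1 G /\ A = ul G /\ forall x, G x ⊆ F x.
Proof.
  move=> HF /UltE [g [_ E]] Hs.
  exists (fun x => inter (app g x) (F x)). split; first by definable. split.
  - rewrite ul_inter //; last exact: T1_app. rewrite -E. apply: set_ext => z.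
    rewrite interE. split; last by case. move=> Hz. split=> //. exact: Hs.
  - by move=> x z /interE [].
Qed.

(** Otherwise [h x] can be chosen in [G x] such that no element of [d] covers
    the part of [G x] below [h x]; but this part represents an initial segment
    covered by [d], so that [x] covers it for almost all [x] in [d]. *)
Lemma small_segments_order_type G : T1 G -> (forall x y, y ∈ G x -> ordinal y) ->
  (forall b, b ∈ ul G -> covers d (inter (ul G) b)) ->
  ae (fun x => exists t r, ord_le t d /\ (forall i, i ∈ t -> app r i ∈ G x) /\
     forall y, y ∈ G x -> exists i, i ∈ t /\ y = app r i).
Proof.
  move=> HG Ho Hseg.
  have : ae (fun x => (exists t r, ord_le t d /\ (forall i, i ∈ t -> app r i ∈ G x) /\
     forall y, y ∈ G x -> exists i, i ∈ t /\ y = app r i) \/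
     (exists h, h ∈ G x /\ forall e, e ∈ d -> ~ covers e (inter (G x) h))).
  { apply: ae_all => x _. apply: order_type_dichotomy; [exact: d_cardinal|exact: Ho]. }
  move=> /ae_or [|//|H]; first by definable. exfalso.
  pose (h := fun x => least (fun h => h ∈ G x /\ forall e, e ∈ d -> ~ covers e (inter (G x) h))).
  have Hh : T1 h by unfold h; definable.
  have hspec : ae (fun x => h x ∈ G x /\ forall e, e ∈ d -> ~ covers e (inter (G x) (h x))).
  { apply: (ae_mono _ _ H) => x Hx [k Hk].
    case: (least_spec (fun h => h ∈ G x /\ forall e, e ∈ d -> ~ covers e (inter (G x) h)));
      [by definable| |by move=> _ []].
    exists k. split=> //. apply: (Ho x). by case: Hk. }
  have Hin : ul h ∈ ul G.
  { apply/ul_mem => //. by apply: (ae_mono _ _ hspec) => x _ []. }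
  have := Hseg _ Hin. rewrite -ul_inter // => Hc.
  have Hae := small_subset_ae (fun x => inter (G x) (h x)) _ Hc.
  case: (ae_ex _ (ae_and _ _ hspec (Hae _))); first by definable.
  move=> x [Hx [[_ H1] H2]]. exact: (H1 x).
Qed.

Lemma cantor a : ~ covers a (power a).
Proof.
  move=> [s Hs].
  have HE : forall y, y ∈ sep a (fun y => ~ y ∈ app s y) <-> y ∈ a /\ ~ y ∈ app s y.
  { move=> y. apply: sepE. definable. }
  case: (Hs (sep a (fun y => ~ y ∈ app s y))).
  - rewrite powerE => y /HE [] //.
  - move=> i [Hi E]. have := HE i. rewrite {1}E. tauto.
Qed.

(** A subset of [ul G] is represented by a choice of subsets of the [G x].
    Covering each [G x] by [d], these subsets are together a subset of the
    square of [d], and a pairing function turns it into a subset of [d]. *)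
Lemma subsets_coded G : T1 G -> ae (fun x => covers d (G x)) ->
  (forall A, A ⊆ ul G -> M A) -> covers (power d) (power (ul G)).
Proof.
  move=> HG Hcov Hsub. case: omega_in_d => w [Hw Hwd].
  have Hwd' : w ⊆ d := ord_le_subset _ _ d_ordinal (or_introl Hwd).
  case: (pairing_function w d Hw d_ordinal Hwd') => pr [Hpr [Hprd Hprinj]].
  case: (choice_function d (fun x s => covers d (G x) ->
     forall y, y ∈ G x -> exists i, i ∈ d /\ y = app s i)); first by definable.
  { move=> x _. case: (classic (covers d (G x))) => [[s Hs]|H]; [by exists s|by exists x]. }
  move=> S [_ HS].
  apply: (coversI _ _ (fun X => ul (fun x => sep (G x) (fun y =>
     exists i, i ∈ d /\ y = app (app S x) i /\ pr x i ∈ X)))).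
  { unfold ul. definable. }
  move=> A. rewrite powerE => HA.
  case: (represent_subset A G HG (Hsub A HA) HA) => a [Ha [-> Hsuba]].
  pose (X := sep d (fun z => exists x i, x ∈ d /\ i ∈ d /\ z = pr x i /\ app (app S x) i ∈ a x)).
  have XE : forall x i, x ∈ d -> i ∈ d -> (pr x i ∈ X <-> app (app S x) i ∈ a x).
  { move=> x i Hx Hi. rewrite sepE; last by definable. split.
    - move=> [_ [x' [i' [Hx' [Hi' [E H]]]]]].
      by case: (Hprinj x i x' i' Hx Hi Hx' Hi' E) => -> ->.
    - move=> H. split; first exact: Hprd. by exists x, i. }
  exists X. split; first by rewrite powerE => z; rewrite sepE; [case|definable].
  apply/ul_eq => //; first by definable.
  apply: (ae_mono _ _ Hcov) => x Hx Hcx. apply: set_ext => y. rewrite sepE; last by definable.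
  split.
  - move=> Hy. split; first exact: Hsuba.
    case: (HS x Hx Hcx y); first exact: Hsuba. move=> i [Hi E].
    exists i. split=> //. split=> //. apply/XE => //. by rewrite -E.
  - move=> [_ [i [Hi [-> /XE H]]]]. exact: H.
Qed.

Lemma equinumerous_covers_sym a b : equinumerous a b -> covers b a.
Proof.
  move=> [f [[Hf Hb] H]].
  apply: (coversI _ _ (fun y => the (fun x => x ∈ a /\ app f x = y))); first by definable.
  move=> x Hx. exists (app f x). split; first by apply: (function_app f a).
  symmetry. apply: the_eq => // x' [Hx' E].
  case: (H (app f x)); first exact: (function_app f a).
  move=> x0 [_ Hu]. rewrite -(Hu x'); last by rewrite (function_on_maps f a).
  apply: Hu. by rewrite (function_on_maps f a).
Qed.

(** The set [A0] of values of a monotone cofinal map has small segments.  If it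
    had no fresh unbounded subset, all its subsets would be in the ultrapower,
    hence coded by subsets of [d]; as [A0] maps onto [dp], which maps onto the
    power set of [d], this contradicts the theorem of Cantor. *)
Theorem fresh_of_cofinality_successor l dp : cardinal_successor d dp -> two_power d dp ->
  limit_ordinal l -> cofinality l dp -> exists A, unbounded_subset A l /\ fresh_over M A.
Proof.
  move=> Hdp H2 Hl Hcof. have Hlo := limit_is_ordinal _ Hl.
  have Hlx : forall x, x ∈ l -> ordinal x by move=> x; exact: ordinal_elem.
  case: (monotone_cofinal_map l dp Hlx Hcof) => f [Hfl [Hmono Hfcof]].
  case: (monotone_image_small dp l (app f) Hdp Hl (T1_app f) Hfl Hmono Hfcof).
  set A0 := img dp (app f) => HA0 Hsmall.
  apply: NNPP => Hno.
  have Hsub : forall A, A ⊆ A0 -> M A.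
  { move=> A HA. apply: NNPP => HnA.
    have HAl : A ⊆ l by move=> z /HA; exact: (proj1 HA0).
    have Hseg : forall b, b ∈ l -> M (inter A b).
    { move=> b Hb. apply: (small_segment_in l) => //. apply: (covers_mono d d _ _ _ _ (Hsmall b Hb)) => //.
      move=> z /interE [H1 H3]. apply/interE. split=> //. exact: HA. }
    case: (classic (unbounded_subset A l)) => Hun.
    - apply: Hno. exists A; split=> //. exact: (unbounded_fresh l).
    - have [a [Ha Hlt]] : exists a, a ∈ l /\ forall b, b ∈ A -> ~ ord_le a b.
      { apply: NNPP => H. apply: Hun. split=> // a Ha. apply: NNPP => H'. apply: H.
        exists a; split=> // b Hb Hle. apply: H'. by exists b. }
      apply: HnA. have -> : A = inter A a; last exact: Hseg.
      apply: set_ext => z. rewrite interE. split; last by case.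
      move=> Hz. split=> //.
      case: (ord_lt_or_ge z a) => //; try (apply: Hlx => //; exact: HAl).
      move=> Hle. by case: (Hlt z Hz). }
  have HA0M : M A0 by exact: Hsub.
  case: (represent_subset A0 (fun _ => l) (T1_const l) HA0M).
  { move=> z /(proj1 HA0). apply: ord_le_subset; [exact: emb_ordinal|exact: emb_ge]. }
  move=> G [HG [EG HGl]].
  have Hae : ae (fun x => covers d (G x)).
  { have H : ae (fun x => exists t r, ord_le t d /\ (forall i, i ∈ t -> app r i ∈ G x) /\
       forall y, y ∈ G x -> exists i, i ∈ t /\ y = app r i).
    { apply: small_segments_order_type => //.
      - move=> x y /HGl. exact: Hlx.
      - rewrite -EG => b Hb. apply: Hsmall. exact: (proj1 HA0). }
    apply: (ae_mono _ _ H) => x _ [t [r [Ht [_ Hr]]]]. exists r => y Hy.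
    case: (Hr y Hy) => i [Hi E]. exists i; split=> //.
    exact: (ord_le_subset _ _ d_ordinal Ht). }
  apply: (cantor A0).
  apply: (covers_trans _ (power d)); last first.
  { rewrite EG. apply: subsets_coded => //. by rewrite -EG. }
  apply: (covers_trans _ dp); last first.
  { case: H2 => _ [p [Hp Heq]].
    have <- : p = power d by apply: set_ext => z; rewrite powerE Hp.
    exact: equinumerous_covers_sym. }
  (* the order type of [A0] is at least the cofinality of [l] *)
  have HA0o : forall x, x ∈ A0 -> ordinal x by move=> x /(proj1 HA0); exact: Hlx.
  have Hdpo : ordinal dp by case: Hcof.
  case: (order_type A0 HA0o) => k [t [Ht [Hkt [Hkmono [_ [Hon _]]]]]].
  case: (ord_lt_or_ge t dp) => // Htdp.
  - exfalso. case: Hcof => _ [_ Hmin]. apply: (Hmin t Htdp).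
    case: (monotone_enumeration A0 t k HA0o Hkmono Hkt Hon) => r [Hr1 Hr2].
    exact: (enumeration_cofinal l A0 t r).
  - exists k => i Hi. apply: Hon. exact: (ord_le_subset _ _ Ht Htdp).
Qed.

Lemma Los_binary (R : forall W : set_structure, W -> W -> Prop) F G (x y : class_structure M) :
  uniformly_definable (fun W e => R W (e 0) (e 1)) -> T1 F -> T1 G -> proj1_sig x = ul F -> proj1_sig y = ul G ->
  (R _ x y <-> ae (fun z => R V (F z) (G z))).
Proof.
  move=> [p Hp] HF HG Ex Ey.
  rewrite (Hp _ (scons x (fun _ => y))).
  rewrite (Los p (scons x (fun _ => y)) (fun n : nat => match n with 0 => F | S _ => G end)).
  - split=> H; apply: (ae_mono _ _ H) => z _ Hz.
    + apply: (proj2 (Hp V (fun n : nat => (match n with 0 => F | S _ => G end) z))). exact: Hz.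
    + exact: (proj1 (Hp V (fun n : nat => (match n with 0 => F | S _ => G end) z)) Hz).
  - by case.
  - by case.
Qed.

(** Running suprema [B x] of cofinal maps from [dp] to [L x], evaluated at a
    common argument, represent the elements of [A].  That [A] is unbounded uses
    the regularity of [dp]: the arguments needed at the points of [d] have a
    common bound.  If [A] were in the ultrapower, almost all [L x] would have a
    cofinal subset of order type at most [d]. *)
Theorem fresh_of_internal_cofinality l dp : limit_ordinal l -> cardinal_successor d dp ->
  cofinality_in M l (emb dp) -> exists A, unbounded_subset A l /\ fresh_over M A.
Proof.
  move=> Hl Hdp [l' [c' [El [Ec Hcof]]]]. have Hlo := limit_is_ordinal _ Hl.
  have Hlx : forall x, x ∈ l -> ordinal x by move=> x; exact: ordinal_elem.
  have Hdpo : ordinal dp by apply: cardinal_ordinal; case: Hdp.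
  have Hddp : d ∈ dp by case: Hdp => _ [].
  case: omega_in_d => w [Hw Hwd].
  have Hwd' : w ⊆ d := ord_le_subset _ _ d_ordinal (or_introl Hwd).
  case: (represent_subset l (fun _ => l) (T1_const l) (Ult_ordinal l Hlo)).
  { apply: ord_le_subset; [exact: emb_ordinal|exact: emb_ge]. }
  move=> L [HL [EL HLl]].
  have HLo : forall x y, y ∈ L x -> ordinal y by move=> x y /HLl; exact: Hlx.
  have Hae : ae (fun x => cofinality (L x) dp).
  { rewrite EL in El.
    exact: (proj1 (Los_binary (@cofinality) L (fun _ => dp) l' c' udef_cofinality HL (T1_const dp) El Ec) Hcof). }
  pose (good := fun x f => (forall i, i ∈ dp -> app f i ∈ L x) /\
    (forall i j, i ∈ dp -> j ∈ dp -> ord_le i j -> ord_le (app f i) (app f j)) /\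
    (forall y, y ∈ L x -> exists i, i ∈ dp /\ ord_le y (app f i))).
  have Hgood : D2 good by unfold good; definable.
  case: (choice_function d (fun x f => (exists f, good x f) -> good x f)); first by definable.
  { move=> x _. case: (classic (exists f, good x f)) => [[f Hf]|H]; [by exists f|by exists x]. }
  move=> B [_ HB].
  have {}HB : ae (fun x => good x (app B x)).
  { apply: (ae_mono _ _ Hae) => x Hx Hcx. apply: HB => //.
    apply: monotone_cofinal_map => //. exact: HLo. }
  pose (F := fun i => ul (fun x => app (app B x) i)).
  have HF : T1 F by unfold F, ul; definable.
  have HBi : forall i, T1 (fun x => app (app B x) i) by move=> i; definable.
  case: (monotone_image_small dp l F) => //.
  { move=> i Hi. rewrite {1}EL. apply/ul_mem => //.
    apply: (ae_mono _ _ HB) => x _ [H _]. exact: H. }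
  { move=> i j Hi Hj Hij.
    have : ae (fun x => app (app B x) i ∈ app (app B x) j \/ app (app B x) i = app (app B x) j).
    { apply: (ae_mono _ _ HB) => x _ [_ [H _]]. exact: H. }
    move=> /ae_or [|H|H]; [by definable|left|right].
    - exact/ul_mem.
    - exact/ul_eq. }
  { move=> y. rewrite {1}EL => /(ul_elem _ _ HL) [g [_ [-> Hg]]].
    case: (choice_function d (fun x i => i ∈ dp /\
      ((exists i, i ∈ dp /\ ord_le (app g x) (app (app B x) i)) ->
        ord_le (app g x) (app (app B x) i)))); first by definable.
    { move=> x _.
      case: (classic (exists i, i ∈ dp /\ ord_le (app g x) (app (app B x) i))) => [[i [Hi1 Hi2]]|H].
      - by exists i.
      - by exists d. }
    move=> h [_ Hh].
    case: (successor_regular w d dp (app h) Hw Hwd' d_cardinal Hdp (T1_app h)).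
    { move=> i Hi. by case: (Hh i Hi). }
    move=> b [Hb Hhb]. exists b; split=> //.
    have : ae (fun x => app g x ∈ app (app B x) b \/ app g x = app (app B x) b).
    { apply: (ae_mono2 _ _ _ HB Hg) => x Hx [H1 [H2 H3]] Hgx.
      case: (Hh x Hx) => Hhx1 Hhx2. case: (H3 _ Hgx) => i Hi.
      apply: (ord_le_trans _ (app (app B x) (app h x))).
      - apply: (HLo x). exact: H1.
      - apply: Hhx2. by exists i.
      - apply: H2 => //. exact: Hhb. }
    move=> /ae_or [|H|H]; [by definable|left|right].
    - apply/ul_mem => //. exact: T1_app.
    - apply/ul_eq => //. exact: T1_app. }
  set A := img dp F => HA Hsmall.
  exists A. split=> //. apply: (unbounded_fresh l) => //.
  { move=> b Hb. apply: (small_segment_in l) => //; [exact: (proj1 HA)|exact: Hsmall]. }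
  move=> HAM.
  case: (represent_subset A L HL HAM); first by rewrite -EL; exact: (proj1 HA).
  move=> G [HG [EG HGL]].
  have Hot : ae (fun x => exists t r, ord_le t d /\ (forall i, i ∈ t -> app r i ∈ G x) /\
       forall y, y ∈ G x -> exists i, i ∈ t /\ y = app r i).
  { apply: small_segments_order_type => //.
    - move=> x y /HGL. exact: HLo.
    - rewrite -EG => b Hb. apply: Hsmall. exact: (proj1 HA). }
  have Hun : ae (fun x => unbounded_subset (G x) (L x)).
  { apply: NNPP => Hn. unfold unbounded_subset in Hn. rewrite -ae_not in Hn; last by definable.
    pose (Z := fun x => least (fun z => z ∈ L x /\ forall b, b ∈ G x -> ~ ord_le z b)).
    have HZ : T1 Z by unfold Z; definable.
    have Zspec : ae (fun x => Z x ∈ L x /\ forall b, b ∈ G x -> ~ ord_le (Z x) b).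
    { apply: (ae_mono _ _ Hn) => x Hx Hnx.
      case: (least_spec (fun z => z ∈ L x /\ forall b, b ∈ G x -> ~ ord_le z b));
        [by definable| |by move=> _ []].
      apply: NNPP => H. apply: Hnx. split; first exact: HGL.
      move=> a Ha. apply: NNPP => H'. apply: H. exists a. split; first exact: (HLo x).
      split=> // b Hb Hle. apply: H'. by exists b. }
    have HZl : ul Z ∈ l.
    { rewrite EL. apply/ul_mem => //. by apply: (ae_mono _ _ Zspec) => x _ []. }
    case: (proj2 HA _ HZl) => b []. rewrite {1}EG => /(ul_elem _ _ HG) [g [_ [-> Hg]]] Hle.
    have Hle' : ae (fun x => ord_le (Z x) (app g x)).
    { case: Hle => H.
      - move: H. rewrite ul_mem //; last exact: T1_app.
        move=> H. by apply: (ae_mono _ _ H) => x _; left.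
      - move: H. rewrite ul_eq //; last exact: T1_app.
        move=> H. by apply: (ae_mono _ _ H) => x _; right. }
    case: (ae_ex _ (ae_and _ _ Zspec (ae_and _ _ Hg Hle'))) => x [_ [[_ H1] [H2 H3]]].
    exact: (H1 _ H2). }
  case: (ae_ex _ (ae_and _ _ Hae (ae_and _ _ Hot Hun))) => x [_ [[_ [_ Hmin]] [[t [r [Ht [Hr1 Hr2]]]] Hunx]]].
  apply: (Hmin t); first exact: (ord_le_lt_trans _ d).
  exact: (enumeration_cofinal (L x) (G x) t r).
Qed.

(** ** Power sets in the ultrapower *)

Lemma Ult_pair x y : M x -> M y -> M (pair x y).
Proof.
  case: omega_in_d => w [Hw Hwd].
  have Hwd' : w ⊆ d := ord_le_subset _ _ d_ordinal (or_introl Hwd).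
  have H0 := omega_empty _ Hw. have H1 := omega_succ _ _ Hw H0.
  have Hup : forall a b, M a -> M b -> M (upair a b).
  { move=> a b Ha Hb. apply: small_subset_in; first by move=> z /upairE [] ->.
    apply: (coversI _ _ (fun i => cond (i = empty) a b)); first by definable.
    move=> z /upairE [] ->.
    - exists empty. split; first exact: Hwd'. by rewrite cond_true.
    - exists (succ empty). split; first exact: Hwd'. rewrite cond_false // => E.
      have := succ_self (empty : V). by rewrite E => /emptyE. }
  move=> Hx Hy.
  have -> : pair x y = upair (upair x x) (upair x y).
  { symmetry. apply/is_pairE => z. by rewrite upairE !is_upairE. }
  apply: (Hup); exact: Hup.
Qed.

Lemma Ult_elem_eq (x y : class_structure M) : x = y <-> proj1_sig x = proj1_sig y.
Proof.
  split; first by move=> ->. move: x y => [x Hx] [y Hy] /= E. subst y.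
  f_equal. exact: proof_irrelevance.
Qed.

(** Pairs are absolute, since the ultrapower is transitive and contains the
    unordered pairs of its elements. *)
Lemma Ult_is_pair (p x y : class_structure M) :
  is_pair p x y <-> is_pair (proj1_sig p) (proj1_sig x) (proj1_sig y).
Proof.
  have Hupair : forall (z a b : class_structure M), is_upair z a b <-> is_upair (proj1_sig z) (proj1_sig a) (proj1_sig b).
  { move=> [z Hz] [a Ha] [b Hb]. split=> /= H v.
    - split.
      + move=> Hv. have Hvm := Ult_transitive _ _ Hz Hv.
        case: (proj1 (H (exist M v Hvm)) Hv) => E; [left|right]; by case: E.
      + move=> [] ->; [apply: (proj2 (H (exist M a Ha)))|apply: (proj2 (H (exist M b Hb)))]; tauto.
    - rewrite !Ult_elem_eq. exact: (H (proj1_sig v)). }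
  have Hmem : forall (z : class_structure M), z ∈ p <-> proj1_sig z ∈ proj1_sig p by [].
  have Hup : forall a b, M a -> M b -> M (upair a b).
  { move=> a b Ha Hb. have HP := Ult_pair a b Ha Hb.
    apply: (Ult_transitive (pair a b)) => //.
    have : is_pair (pair a b) a b by apply/is_pairE.
    move=> H. apply/H. right. by apply/is_upairE. }
  split=> H v.
  - split.
    + move=> Hv. have Hvm := Ult_transitive _ _ (proj2_sig p) Hv.
      case: (proj1 (H (exist M v Hvm)) Hv) => /Hupair E; by [left|right].
    + move=> Hor. have Hvm : M v.
      { case: Hor => /is_upairE ->; apply: Hup; exact: proj2_sig. }
      apply: (proj2 (H (exist M v Hvm))).
      case: Hor => E; [left|right]; exact/Hupair.
  - rewrite Hmem H. by rewrite !Hupair.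
Qed.

Lemma Ult_maps (f x y : class_structure M) :
  maps f x y <-> maps (proj1_sig f) (proj1_sig x) (proj1_sig y).
Proof.
  split.
  - move=> [p [Hp Hpf]]. exists (proj1_sig p). split=> //. exact/Ult_is_pair.
  - move=> [p [Hp Hpf]]. have Hpm := Ult_transitive _ _ (proj2_sig f) Hpf.
    exists (exist M p Hpm). split=> //. exact/Ult_is_pair.
Qed.

Lemma Ult_limit_ordinal (m : class_structure M) :
  limit_ordinal (proj1_sig m) -> limit_ordinal m.
Proof.
  move: m => [m Hm] /= [Hmo [[x Hx] Hlim]].
  have tr : forall y, y ∈ m -> M y by move=> y; exact: Ult_transitive.
  split; [split; [|split; [|split; [|split]]]|split].
  - move=> [y Hy] Hym [z Hz] Hzy. exact: (ordinal_trans _ y _ Hmo Hym Hzy).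
  - move=> [y Hy] _. exact: mem_irrefl.
  - move=> [y Hy] [z Hz] [v Hv] Hym Hzm Hvm Hyz Hzv.
    exact: (ordinal_trans _ _ _ (ordinal_elem _ _ Hmo Hvm) Hzv Hyz).
  - move=> [y Hy] [z Hz] Hym Hzm.
    case: (ordinal_total _ _ _ Hmo Hym Hzm) => [H|[E|H]]; [by left| |by right; right].
    right; left. exact/Ult_elem_eq.
  - move=> [s Hs] Hsm [[y Hy] Hys].
    case: (foundation_set s (fun _ => True)); [by definable|by exists y|].
    move=> u [Hu [_ Hmin]]. exists (exist M u (Ult_transitive _ _ Hs Hu)). split=> //.
    move=> [v Hv] Hvs. exact: Hmin.
  - by exists (exist M x (tr x Hx)).
  - move=> [y Hy] Hym. case: (Hlim y Hym) => z [Hz Hyz].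
    by exists (exist M z (tr z Hz)).
Qed.

(** A map [s] that covers [a] by [m] induces the well-founded relation [less] on
    [m].  By the theorem of Los the ultrapower has a pairing function on [m];
    the code of [less] is a subset of [m], hence in the ultrapower, and its
    collapse [h] there agrees with [s] wherever [s] takes values in [a].  A
    subset of [a] is the image under [h] of a subset of [m]. *)
Lemma powerset_below a m : ordinal a -> limit_ordinal m -> covers m a ->
  powerset_included m M -> powerset_included a M.
Proof.
  move=> Ha Hm [s Hs] HP X HX.
  have Hmo := limit_is_ordinal _ Hm. have HmM := Ult_ordinal m Hmo.
  have trm : forall y, y ∈ m -> M y by move=> y; exact: Ult_transitive.
  pose (m' := exist M m HmM : class_structure M).
  have Hphi : @coded_collapse (class_structure M) m'.
  { case: udef_coded_collapse => p Hp. apply: (proj2 (Hp _ (fun _ => m'))).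
    case: (proj1 (UltE m) HmM) => g [_ Hg].
    apply: (proj2 (Los p (fun _ => m') (fun _ => app g) (fun _ => T1_app g) (fun _ => Hg))).
    apply: ae_all => x _. apply: (proj1 (Hp V (fun _ => app g x))). exact: coded_collapse_valid. }
  case: (Hphi (Ult_limit_ordinal m' Hm)) => [[G HG]] [Htot [Hinj [Hfun Hcoll]]].
  pose (code := fun x y z => exists p, is_pair p x y /\ maps G p z).
  have Hcode : D3 code by unfold code; definable.
  have codeE : forall x y z (Hx : M x) (Hy : M y) (Hz : M z),
    coded_by (exist M G HG : class_structure M) (exist M x Hx) (exist M y Hy) (exist M z Hz) <-> code x y z.
  { move=> x y z Hx Hy Hz. split.
    - move=> [p [/Ult_is_pair Hp /Ult_maps Hpz]]. by exists (proj1_sig p).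
    - move=> [p [Hp Hpz]]. have HpM : M p.
      { move/is_pairE: Hp => ->. exact: Ult_pair. }
      exists (exist M p HpM). split; [exact/Ult_is_pair|exact/Ult_maps]. }
  pose (less := fun x y => app s x ∈ a /\ app s y ∈ a /\ app s x ∈ app s y).
  have Hless : D2 less by unfold less; definable.
  pose (c := sep m (fun z => exists x y, x ∈ m /\ y ∈ m /\ less x y /\ code x y z)).
  have cE : forall z, z ∈ c <-> z ∈ m /\ exists x y, x ∈ m /\ y ∈ m /\ less x y /\ code x y z.
  { move=> z. apply: sepE. definable. }
  have HcM : M c by apply: HP => z /cE [].
  pose (c' := exist M c HcM : class_structure M).
  have relE : forall x y (Hx : M x) (Hy : M y), x ∈ m -> y ∈ m ->
    (coded_relation (exist M G HG : class_structure M) c' (exist M x Hx) (exist M y Hy) <-> less x y).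
  { move=> x y Hx Hy Hxm Hym. split.
    - move=> [[z Hz] [/cE [_ [x' [y' [Hx'm [Hy'm [Hl Hc']]]]]] Hc]].
      have := Hinj _ _ _ _ _ Hc (proj2 (codeE x' y' z (trm _ Hx'm) (trm _ Hy'm) Hz) Hc').
      by move=> [] [->] [->].
    - move=> Hl. case: (Htot (exist M x Hx) (exist M y Hy) Hxm Hym) => [[z Hz] [Hzm Hc]].
      exists (exist M z Hz). split=> //. apply/cE. split=> //.
      exists x, y. split=> //. split=> //. split=> //. exact/codeE. }
  case: (Hcoll c').
  { move=> [q Hq] Hqm [[y Hy] Hyq].
    have Hqm' : q ⊆ m by move=> z Hz; exact: (Hqm (exist M z (Ult_transitive _ _ Hq Hz)) Hz).
    case: (foundation_by q (app s) (fun _ => True)); [exact: T1_app|by definable|by exists y|].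
    move=> u [Hu [_ Hmin]]. exists (exist M u (Ult_transitive _ _ Hq Hu)). split=> //.
    move=> [v Hv] Hvq /relE => /(_ (Hqm' _ Hvq) (Hqm' _ Hu)) [_ [_ H]].
    exact: (Hmin v). }
  move=> [h Hh] [Hhtot [Hhfun [HhE Himg]]].
  have hval : forall b, ordinal b -> forall x v, x ∈ m -> app s x = b -> b ∈ a ->
     maps h x v -> v = b.
  { apply: (ordinal_ind (fun b => forall x v, x ∈ m -> app s x = b -> b ∈ a -> maps h x v -> v = b));
      first by definable.
    move=> b Hb IH x v Hx Ex Hba Hxv.
    have hM : forall y z, y ∈ m -> maps h y z -> M z.
    { move=> y z Hy Hyz. case: (Hhtot (exist M y (trm y Hy)) Hy) => [[z' Hz']] /Ult_maps /= Hyz'.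
      case: Hyz => p [Hp Hph]. have HpM := Ult_transitive _ _ Hh Hph.
      have Hup : is_upair (upair y z) y z by apply/is_upairE.
      apply: (Ult_transitive (upair y z)); last by apply/upairE; right.
      apply: (Ult_transitive p) => //. apply/Hp. by right. }
    have HvM := hM x v Hx Hxv.
    have Hv := HhE (exist M x (trm x Hx)) (exist M v HvM) Hx (proj2 (Ult_maps (exist M h Hh) (exist M x (trm x Hx)) (exist M v HvM)) Hxv).
    apply: set_ext => z. split.
    - move=> Hz. have HzM := Ult_transitive _ _ HvM Hz.
      case: (proj1 (Hv (exist M z HzM)) Hz) => [[y Hy] [Hym [/relE Hl /Ult_maps /= Hyz]]].
      case: (Hl Hym Hx) => Hsy [_ Hyx]. rewrite Ex in Hyx.
      by rewrite (IH (app s y) Hyx y z Hym eq_refl Hsy Hyz).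
    - move=> Hz. have Hza := ordinal_trans _ _ _ Ha Hba Hz.
      case: (Hs z Hza) => y [Hym Ey].
      case: (Hhtot (exist M y (trm y Hym)) Hym) => [[v' Hv'] Hyv'].
      have Hyv : maps h y v' by exact: (proj1 (Ult_maps _ _ _) Hyv').
      have E : v' = z.
      { rewrite Ey. apply: (IH (app s y) _ y) => //; by rewrite -Ey. }
      subst v'. apply: (proj2 (Hv (exist M z Hv'))). exists (exist M y (trm y Hym)).
      split=> //. split=> //. apply/relE => //. rewrite /less Ex -Ey. done. }
  pose (t := sep m (fun x => app s x ∈ X)).
  have tE : forall x, x ∈ t <-> x ∈ m /\ app s x ∈ X.
  { move=> x. apply: sepE. definable. }
  have HtM : M t by apply: HP => z /tE [].
  case: (Himg (exist M t HtM)) => [[Y HY] HYE].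
  have -> // : X = Y.
  apply: set_ext => z. split.
  - move=> Hz. have Hza := HX _ Hz. have HzM := Ult_ordinal z (ordinal_elem _ _ Ha Hza).
    case: (Hs z Hza) => x [Hx Ex]. apply: (proj2 (HYE (exist M z HzM))).
    exists (exist M x (trm x Hx)). split; first by apply/tE; rewrite -Ex.
    case: (Hhtot (exist M x (trm x Hx)) Hx) => [[v Hv] Hxv].
    have Hxv' : maps h x v by exact: (proj1 (Ult_maps _ _ _) Hxv).
    apply/Ult_maps => /=.
    have <- // : v = z. apply: (hval z _ x) => //. exact: (ordinal_elem a).
  - move=> Hz. have HzM := Ult_transitive _ _ HY Hz.
    case: (proj1 (HYE (exist M z HzM)) Hz) => [[x Hx] [/tE [Hxm HsX] /Ult_maps /= Hxz]].
    have Hsa := HX _ HsX.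
    by rewrite (hval (app s x) (ordinal_elem _ _ Ha Hsa) x z Hxm eq_refl Hsa Hxz).
Qed.

(** Any subset of [k] outside the ultrapower is fresh: its initial segments are
    subsets of smaller ordinals, all of which are in the ultrapower. *)
Theorem fresh_of_minimal_powerset k : cardinal k -> d ∈ k -> ~ powerset_included k M ->
  (forall m, cardinal m -> d ∈ m -> m ∈ k -> powerset_included m M) ->
  exists A, unbounded_subset A k /\ fresh_over M A.
Proof.
  move=> Hk Hdk Hnk Hmin. have Hko := cardinal_ordinal _ Hk.
  case: omega_in_d => w [Hw Hwd].
  have Hwk : w ∈ k := ordinal_trans _ _ _ Hko Hdk Hwd.
  have Hlim := infinite_cardinal_limit w k Hw Hk Hwk.
  have Hbelow : forall a, a ∈ k -> powerset_included a M.
  { move=> a Ha. have Hao := ordinal_elem _ _ Hko Ha.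
    case: (ordinal_cardinality _ Hao) => m [Hm [Hle Hcov]]. have Hmo := cardinal_ordinal _ Hm.
    case: (ord_lt_or_ge d m d_ordinal Hmo) => Hdm.
    - apply: (powerset_below a m) => //.
      + apply: (infinite_cardinal_limit w) => //. exact: (ordinal_trans _ d).
      + apply: Hmin => //. exact: (ord_le_lt_trans _ a).
    - move=> X HX. apply: small_subset_in.
      + move=> y Hy. apply: Ult_ordinal. apply: (ordinal_elem a) => //. exact: HX.
      + apply: (covers_mono m d a X) => //. exact: (ord_le_subset _ _ d_ordinal). }
  have [X [HX HnX]] : exists X, X ⊆ k /\ ~ M X.
  { apply: NNPP => H. apply: Hnk => X HX. apply: NNPP => HnX. apply: H. by exists X. }
  have Hseg : forall b, b ∈ k -> M (inter X b).
  { move=> b Hb. apply: (Hbelow b Hb). by move=> z /interE []. }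
  have Hun : unbounded_subset X k.
  { split=> // a Ha. apply: NNPP => H. apply: HnX.
    have -> : X = inter X a; last exact: Hseg.
    apply: set_ext => z. rewrite interE. split; last by case.
    move=> Hz. split=> //.
    case: (ord_lt_or_ge z a) => //; try exact: (ordinal_elem k).
    - apply: (ordinal_elem k) => //. exact: HX.
    - move=> Hle. case: H. by exists z. }
  exists X. split=> //. exact: (unbounded_fresh k).
Qed.

End Ultrapower.

Theorem proposition1p3 (V : set_structure) (HV : ZFC V) (delta U : V)
  (Hdelta : measurable_cardinal delta) (HU : normal_ultrafilter delta U) :
  (forall kappa : V,
     cardinal kappa -> delta ∈ kappa ->
     ~ powerset_included kappa (Ult delta U) ->
     (forall mu : V, cardinal mu -> delta ∈ mu -> mu ∈ kappa ->
        powerset_included mu (Ult delta U)) ->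
     exists A : V, unbounded_subset A kappa /\ fresh_over (Ult delta U) A)
  /\
  (forall lambda delta_plus j_delta_plus : V,
     limit_ordinal lambda ->
     cardinal_successor delta delta_plus ->
     ultrapower_embedding delta U delta_plus j_delta_plus ->
     cofinality_in (Ult delta U) lambda j_delta_plus ->
     exists A : V, unbounded_subset A lambda /\ fresh_over (Ult delta U) A)
  /\
  (forall lambda delta_plus : V,
     cardinal_successor delta delta_plus ->
     two_power delta delta_plus ->
     limit_ordinal lambda ->
     cofinality lambda delta_plus ->
     exists A : V, unbounded_subset A lambda /\ fresh_over (Ult delta U) A).
Proof.
  pose (V' := ZFCModel V HV).
  split; [|split].
  - exact: (@fresh_of_minimal_powerset V' delta U Hdelta HU).
  - move=> lambda dp jdp Hl Hdp Hj Hcof.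
    apply: (@fresh_of_internal_cofinality V' delta U Hdelta HU lambda dp Hl Hdp).
    by rewrite -(@embE V' delta U Hdelta HU dp jdp Hj).
  - move=> lambda dp. exact: (@fresh_of_cofinality_successor V' delta U Hdelta HU lambda dp).
Qed.
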